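(* Consider the family of piecewise polynomial holomorphic systems $$\dot z = iz+\varepsilon h^{\sigma}(z),\qquad z\in\Sigma_\sigma,\quad \sigma\in\{+,c,-\},$$ where $\Sigma_+=\{\Im(z)>1\}$, $\Sigma_c=\{|\Im(z)|<1\}$, $\Sigma_-=\{\Im(z)<-1\}$, and $$h^{\sigma}(z)=\sum_{j=0}^{4}(a_j^{\sigma}+ib_j^{\sigma})z^j,\qquad a_j^\sigma,b_j^\sigma\in\mathbb R .$$ Then, for $\varepsilon$ sufficiently small, a lower bound for the (maximum) number of limit cycles bifurcating from the periodic solutions of the unperturbed center $\dot z=iz$ is $4$. That is, the coefficients $a_j^\sigma,b_j^\sigma$ can be chosen so that for all sufficiently small $\varepsilon\neq 0$ the system has at least $4$ limit cycles bifurcating from periodic orbits of $\dot z=iz$.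
   Context: The system is a planar piecewise-smooth system ($z=x+iy\in\mathbb C\cong\mathbb R^2$) with three zones $\Sigma_+,\Sigma_c,\Sigma_-$ separated by the two lines $\Im(z)=\pm1$; the dynamics on the lines follows Filippov's convention (where both adjacent vector fields cross the line transversally in the same direction, trajectories are obtained by concatenation). A limit cycle is an isolated periodic orbit. A limit cycle $\gamma_\varepsilon$ bifurcates from a periodic orbit $L$ of the unperturbed ($\varepsilon=0$) system if $\gamma_\varepsilon\to L$ as $\varepsilon\to0$. *)

(* Defs.v *)
From Stdlib Require Import Reals.
From Coquelicot Require Import Coquelicot.
Open Scope R_scope.

Inductive zone := Upper | Central | Lower.

Definition hpoly (a b : zone -> nat -> R) (s : zone) (z : C) : C :=
  sum_n (fun j => ((RtoC (a s j) + Ci * RtoC (b s j)) * Cpow z j)%C) 4.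

Definition field (eps : R) (a b : zone -> nat -> R) (s : zone) (z : C) : C :=
  (Ci * z + RtoC eps * hpoly a b s z)%C.

Definition between (p q v : C) : Prop :=
  exists l : R, 0 <= l <= 1 /\ v = (RtoC l * p + RtoC (1 - l) * q)%C.

(* Filippov's convexification.  Each polynomial field extends continuously to
   the closure of its zone, so on a switching line the Filippov set is the
   segment joining the two adjacent fields; crossing by concatenation and
   sliding motion are both covered by the resulting differential inclusion. *)
Definition filippov (eps : R) (a b : zone -> nat -> R) (z v : C) : Prop :=
     (1 < Im z /\ v = field eps a b Upper z)
  \/ (Im z = 1 /\ between (field eps a b Upper z) (field eps a b Central z) v)
  \/ (Rabs (Im z) < 1 /\ v = field eps a b Central z)
  \/ (Im z = -1 /\ between (field eps a b Central z) (field eps a b Lower z) v)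
  \/ (Im z < -1 /\ v = field eps a b Lower z).

(* Lebesgue-null subset of the line. *)
Definition null_set (N : R -> Prop) : Prop :=
  forall e : R, 0 < e ->
  exists u v : nat -> R,
    (forall n, u n <= v n) /\
    (forall t, N t -> exists n, u n < t < v n) /\
    ex_series (fun n => v n - u n) /\
    Series (fun n => v n - u n) <= e.

(* A finite family of non-overlapping intervals is listed from left to right:
   [u 0, v 0], ..., [u n, v n]. *)
Definition locally_abs_continuous (z : R -> C) : Prop :=
  forall p q : R, forall e : R, 0 < e ->
  exists d : R, 0 < d /\
  forall (n : nat) (u v : nat -> R),
    (forall k, (k <= n)%nat -> p <= u k /\ u k <= v k /\ v k <= q) ->
    (forall k, (k < n)%nat -> v k <= u (S k)) ->
    sum_n (fun k => v k - u k) n < d ->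
    sum_n (fun k => Cmod (z (v k) - z (u k))%C) n < e.

Definition filippov_solution (eps : R) (a b : zone -> nat -> R)
    (z : R -> C) : Prop :=
  locally_abs_continuous z /\
  null_set (fun t => ~ exists v : C, is_derive z t v /\ filippov eps a b (z t) v).

(* A periodic orbit is the trace of a non-constant periodic solution. *)
Definition periodic_orbit (eps : R) (a b : zone -> nat -> R)
    (G : C -> Prop) : Prop :=
  exists (z : R -> C) (T : R),
    filippov_solution eps a b z /\
    0 < T /\ (forall t, z (t + T) = z t) /\
    (exists t, z t <> z 0) /\
    (forall w, G w <-> exists t, w = z t).

Definition within (d : R) (G H : C -> Prop) : Prop :=
  forall w, G w -> exists p, H p /\ Cmod (w - p)%C < d.

Definition same_set (G H : C -> Prop) : Prop := forall w, G w <-> H w.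

(* Isolated: some neighbourhood of G contains no other periodic orbit.  As G is
   compact, its metric neighbourhoods are a neighbourhood basis. *)
Definition limit_cycle (eps : R) (a b : zone -> nat -> R)
    (G : C -> Prop) : Prop :=
  periodic_orbit eps a b G /\
  exists d : R, 0 < d /\
    forall H, periodic_orbit eps a b H -> within d H G -> same_set H G.

(* Convergence G eps -> L, as eps -> 0 with eps <> 0, in Hausdorff distance. *)
Definition tends_to (G : R -> C -> Prop) (L : C -> Prop) : Prop :=
  forall d : R, 0 < d -> exists e0 : R, 0 < e0 /\
    forall eps, 0 < Rabs eps < e0 -> within d (G eps) L /\ within d L (G eps).

(* Main.v *)
(** Take the linear focus (i + eps al) z above Im z = 1 and one holomorphic field
    f = iz + eps h, with h = i b0 + a1 z + i b2 z^2 + i b4 z^4, below it.  The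
    function Im (int dz/f) is a first integral of z' = f, and the focus is
    explicit, so an orbit leaving the line Im z = 1 at x > 0 and meeting it again
    at -x' is periodic iff (x, x') solves two scalar equations.  Modulo o(eps)
    they reduce to x = x' and to the vanishing of
      D(x) = 2 (al - a1) atan x - 2 pi al - 2 b0 x/(1+x^2) + 2 b2 x + (2/3) b4 (x^3 - 3x).
    The coefficients are chosen so that D vanishes at 1, 2, 3, 4; since
    (1+x^2)^2 D'(x) is a cubic in x^2, Rolle's theorem makes these zeros simple,
    and each of them continues to a solution of the two equations.

    For the isolation, a nearby periodic Filippov solution crosses the line
    transversally, and its successive crossing abscissae are iterates of a
    monotone map, so it can only close up at a fixed point, that is, at the
    solution of the two equations.  Absolutely continuous solutions are reduced
    to classical ones away from the line by a Cousin covering argument. *)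

(* In the code [Upper] carries the polynomial field f, while [Central] and [Lower] both carry the
   focus: the overview has the two sides exchanged. The field f has an equilibrium near 0, where 1/f
   has a pole. The arc above the line stays in a rectangle away from it, on which the first integral
   is single-valued; the arc around the origin is left to the explicit focus. Since the two lower
   zones share one field, the line Im z = -1 causes no switching.

   What rules out a direct implicit function argument is that at eps = 0 both return equations
   degenerate to x = x'. In their sum the terms of order zero cancel; multiplied by eps D'(x0)/2,
   this sum increases in x and in x', whatever the signs of eps and D'(x0). Monotonicity then gives
   both uniqueness and existence, and the same monotonicity makes the return map increasing.

   The function D ranges over combinations of 1, atan x, x/(1+x^2), x and x^3. Fixing the
   coefficient of atan x leaves four free parameters, which is what four prescribed zeros
   require. *)
Require Import Defs.
From Stdlib Require Import Reals ZArith Lra Lia List ClassicalEpsilon.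
From Coquelicot Require Import Coquelicot.
Import ListNotations.
Open Scope R_scope.

(** * Absolutely continuous functions *)

(** The supremum [c] of the points reached from [p] is itself reached and cannot lie below [q]: an
    interval tagged at [c] glues on from the left and extends beyond [c]. *)
Lemma cousin (Q : R -> R -> Prop) (p q : R) :
  p <= q ->
  (forall t, p <= t <= q -> exists d, 0 < d /\
     forall s1 s2, p <= s1 <= t -> t <= s2 <= q -> t - d < s1 -> s2 < t + d -> Q s1 s2) ->
  (forall a b c, p <= a <= b -> b <= c <= q -> Q a b -> Q b c -> Q a c) ->
  Q p q.
Proof.
  intros Hpq Hg Htr.
  destruct (completeness (fun s => p <= s <= q /\ Q p s)) as [c [Hub Hlub]].
  { exists q. intros s Hs. apply Hs. }
  { exists p. split; [lra|].
    destruct (Hg p) as [d [Hd H]]; [lra|]. apply H; lra. }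
  assert (Hpc : p <= c).
  { apply Hub. split; [lra|]. destruct (Hg p) as [d [Hd H]]; [lra|]. apply H; lra. }
  assert (Hcq : c <= q) by (apply Hlub; intros s Hs; apply Hs).
  destruct (Hg c) as [d [Hd H]]; [lra|].
  assert (Hs : exists s, (p <= s <= q /\ Q p s) /\ c - d < s).
  { apply NNPP. intros Hn. assert (c <= c - d); [|lra].
    apply Hlub. intros s Hs. apply Rnot_lt_le. intros Hlt. apply Hn. now exists s. }
  destruct Hs as [s [[Hs HQ] Hsd]].
  assert (Hsc : s <= c) by now apply Hub.
  assert (Hstep : forall s', c <= s' <= q -> s' < c + d -> Q p s').
  { intros s' Hs' Hsd'. apply (Htr p s s'); try lra; auto. apply H; lra. }
  destruct (Rlt_le_dec c q) as [Hlt|Hle].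
  - exfalso. set (s' := Rmin q (c + d / 2)).
    assert (c < s' /\ s' <= q /\ s' < c + d) as [H1 [H2 H3]].
    { unfold s', Rmin. destruct (Rle_dec q (c + d / 2)); lra. }
    assert (s' <= c); [|lra]. apply Hub. split; [lra|]. apply Hstep; lra.
  - apply Hstep; lra.
Qed.

Definition abs_continuous_on (f : R -> R) (p q : R) : Prop :=
  forall e, 0 < e -> exists d, 0 < d /\
  forall (n : nat) (u v : nat -> R),
    (forall k, (k <= n)%nat -> p <= u k /\ u k <= v k /\ v k <= q) ->
    (forall k, (k < n)%nat -> v k <= u (S k)) ->
    sum_n (fun k => v k - u k) n < d ->
    sum_n (fun k => Rabs (f (v k) - f (u k))) n < e.

(** Lists replace the functions [u], [v] of absolute continuity because the covering argument joins
    families with [++]. Gaps between consecutive intervals are allowed. *)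
Fixpoint chain (l : list (R * R)) (p q : R) : Prop :=
  match l with
  | [] => p <= q
  | (a, b) :: l' => p <= a /\ a <= b /\ chain l' b q
  end.

Definition list_sum (g : R * R -> R) (l : list (R * R)) : R :=
  fold_right (fun x s => g x + s) 0 l.

Lemma chain_le l p q : chain l p q -> p <= q.
Proof.
  revert p; induction l as [|[a b] l IH]; simpl; intros p; auto.
  intros (H1 & H2 & H3). apply IH in H3. lra.
Qed.

Lemma chain_weaken l p p' q : p' <= p -> chain l p q -> chain l p' q.
Proof. destruct l as [|[a b] l]; simpl; intros; try lra; intuition lra. Qed.

Lemma chain_app l l' p q r : chain l p q -> chain l' q r -> chain (l ++ l') p r.
Proof.
  revert p; induction l as [|[a b] l IH]; simpl; intros p H1 H2.
  - now apply chain_weaken with q.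
  - destruct H1 as (H3 & H4 & H5). auto.
Qed.

Lemma list_sum_app g l l' : list_sum g (l ++ l') = list_sum g l + list_sum g l'.
Proof. unfold list_sum. induction l as [|x l IH]; simpl; [|rewrite IH]; ring. Qed.

Lemma sum_n_shift (a : nat -> R) n : sum_n a (S n) = a O + sum_n (fun k => a (S k)) n.
Proof.
  induction n as [|n IH].
  - now rewrite sum_Sn, !sum_O.
  - rewrite sum_Sn, IH, (sum_Sn _ n). unfold plus; simpl. apply Rplus_assoc.
Qed.

Lemma sum_n_nth g x l d :
  sum_n (fun k => g (nth k (x :: l) d)) (length l) = list_sum g (x :: l).
Proof.
  revert x; induction l as [|y l IH]; intros x.
  - simpl. rewrite sum_O. symmetry. apply Rplus_0_r.
  - simpl length. rewrite sum_n_shift.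
    change (g x + sum_n (fun k => g (nth k (y :: l) d)) (length l) = g x + list_sum g (y :: l)).
    now rewrite IH.
Qed.

Lemma chain_nth l p q d : chain l p q -> forall k, (k < length l)%nat ->
  p <= fst (nth k l d) /\ fst (nth k l d) <= snd (nth k l d) /\ snd (nth k l d) <= q.
Proof.
  revert p; induction l as [|[a b] l IH]; simpl; intros p H k Hk; [lia|].
  destruct H as (H1 & H2 & H3). destruct k as [|k]; simpl.
  - apply chain_le in H3. lra.
  - destruct (IH b H3 k) as (H4 & H5 & H6); [lia|]. lra.
Qed.

Lemma chain_nth_S l p q d : chain l p q -> forall k, (S k < length l)%nat ->
  snd (nth k l d) <= fst (nth (S k) l d).
Proof.
  revert p; induction l as [|[a b] l IH]; simpl; intros p H k Hk; [lia|].
  destruct H as (H1 & H2 & H3). destruct k as [|k].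
  - apply (chain_nth _ _ _ d H3 O). lia.
  - apply (IH b H3 k). lia.
Qed.

Lemma abs_continuous_on_chain f p q : abs_continuous_on f p q ->
  forall e, 0 < e -> exists d, 0 < d /\ forall l, chain l p q ->
    list_sum (fun x => snd x - fst x) l < d ->
    list_sum (fun x => Rabs (f (snd x) - f (fst x))) l < e.
Proof.
  intros Hf e He. destruct (Hf e He) as [d [Hd H]]. exists d. split; auto.
  intros [|x l] Hc Hl; [assumption|].
  rewrite <- (sum_n_nth _ x l (0, 0)) in Hl. rewrite <- (sum_n_nth _ x l (0, 0)).
  apply (H (length l) (fun k => fst (nth k (x :: l) (0, 0)))
                      (fun k => snd (nth k (x :: l) (0, 0)))); auto.
  - intros k Hk. apply (chain_nth _ _ _ (0, 0) Hc). simpl; lia.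
  - intros k Hk. apply (chain_nth_S _ _ _ (0, 0) Hc). simpl; lia.
Qed.

Lemma Series_ge_term (a : nat -> R) n : (forall k, 0 <= a k) -> ex_series a -> a n <= Series a.
Proof.
  intros Ha Hex. apply Rle_trans with (sum_n a n).
  - destruct n; [rewrite sum_O; lra|]. rewrite sum_Sn. unfold plus; simpl.
    assert (0 <= sum_n a n); [|lra].
    clear Hex. induction n; [rewrite sum_O; auto|rewrite sum_Sn; unfold plus; simpl].
    generalize (Ha (S n)); lra.
  - apply (is_lim_seq_incr_compare (sum_n a) (Series a)).
    + apply Series_correct, Hex.
    + intros k. rewrite sum_Sn. unfold plus; simpl. generalize (Ha (S k)); lra.
Qed.

Lemma null_set_add_point N a : null_set N -> null_set (fun t => N t \/ t = a).
Proof.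
  intros HN e He. destruct (HN (e / 2)) as (u & v & H1 & H2 & H3 & H4); [lra|].
  set (u' := fun n => match n with O => a - e / 4 | S n => u n end).
  set (v' := fun n => match n with O => a + e / 4 | S n => v n end).
  exists u', v'.
  assert (Hex : ex_series (fun n => v' n - u' n)) by (apply ex_series_incr_1; exact H3).
  repeat split; auto.
  - intros [|n]; simpl; [lra|auto].
  - intros t [Ht|Ht].
    + destruct (H2 t Ht) as [n Hn]. now exists (S n).
    + exists O. simpl. lra.
  - rewrite Series_incr_1; auto. simpl. lra.
Qed.

Lemma null_set_subset (N N' : R -> Prop) : (forall t, N t -> N' t) -> null_set N' -> null_set N.
Proof.
  intros H HN e He. destruct (HN e He) as (u & v & H1 & H2 & H3 & H4).
  exists u, v. repeat split; auto.
Qed.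

(** Cousin's principle splits [p, q] into two kinds of intervals. Those tagged outside [N] lose at
    most [e] times their length, by the derivative. Those tagged in [N] are collected in a list of
    small total length, on which absolute continuity bounds the loss by [e]. *)
Lemma abs_continuous_ae_closed (f : R -> R) (N : R -> Prop) (p q : R) :
  p <= q -> abs_continuous_on f p q -> null_set N ->
  (forall t, p <= t <= q -> ~ N t -> exists l, 0 <= l /\ is_derive f t l) ->
  f p <= f q.
Proof.
  intros Hpq Hac HN Hd.
  assert (Hmain : forall e, 0 < e -> f p - f q <= e * (q - p) + e).
  { intros e He.
    destruct (abs_continuous_on_chain _ _ _ Hac e He) as [d [Hd0 Hch]].
    destruct (HN (d / 2)) as (u & v & H1 & H2 & H3 & H4); [lra|].
    (* [tau s n] is the length of the part of the n-th covering interval to the left of [s], so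
       [sg s] is the total covered length to the left of [s]. An interval tagged in [N] lies inside
       some covering interval, and the increment of [sg] pays for its length. *)
    set (tau := fun s n => Rmax 0 (Rmin s (v n) - u n)).
    assert (Ht0 : forall s n, 0 <= tau s n <= v n - u n).
    { intros s n. specialize (H1 n). unfold tau, Rmax, Rmin.
      repeat destruct (Rle_dec _ _); lra. }
    assert (Hte : forall s, ex_series (tau s)).
    { intros s. apply (ex_series_le (V := R_CompleteNormedModule)) with (fun n => v n - u n); auto.
      intros n. unfold norm; simpl. unfold abs; simpl. rewrite Rabs_pos_eq; apply Ht0. }
    assert (Hti : forall s s' n, s <= s' -> 0 <= tau s' n - tau s n).
    { intros s s' n Hs. unfold tau, Rmax, Rmin.
      repeat destruct (Rle_dec _ _); lra. }
    set (sg := fun s => Series (tau s)).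
    assert (Hsg : forall s s' n, s <= s' -> tau s' n - tau s n <= sg s' - sg s).
    { intros s s' n Hs. unfold sg. rewrite <- Series_minus; auto.
      apply (Series_ge_term (fun k => tau s' k - tau s k) n); auto.
      apply (ex_series_minus (V := R_NormedModule)); auto. }
    assert (Hsgi : forall s s', s <= s' -> sg s <= sg s').
    { intros s s' Hs. generalize (Hsg s s' O Hs) (Hti s s' O Hs). lra. }
    assert (HQ : exists l, chain l p q /\
        list_sum (fun x => snd x - fst x) l <= sg q - sg p /\
        f p - f q <= e * (q - p) + list_sum (fun x => Rabs (f (snd x) - f (fst x))) l).
    { apply (cousin (fun s1 s2 => exists l, chain l s1 s2 /\
        list_sum (fun x => snd x - fst x) l <= sg s2 - sg s1 /\
        f s1 - f s2 <= e * (s2 - s1) + list_sum (fun x => Rabs (f (snd x) - f (fst x))) l)); auto.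
      - intros t Ht. destruct (classic (N t)) as [HNt|HNt].
        + destruct (H2 t HNt) as [n Hn].
          exists (Rmin (t - u n) (v n - t)). split.
          { apply Rmin_glb_lt; lra. }
          intros s1 s2 Hs1 Hs2 Hs3 Hs4.
          generalize (Rmin_l (t - u n) (v n - t)) (Rmin_r (t - u n) (v n - t)). intros Hm1 Hm2.
          exists [(s1, s2)]. simpl. repeat split; try lra.
          * generalize (Hsg s1 s2 n). unfold tau.
            rewrite (Rmin_left s1), (Rmin_left s2), !Rmax_right; lra.
          * generalize (Rle_abs (f s1 - f s2)). rewrite Rabs_minus_sym.
            assert (0 <= e * (s2 - s1)) by (apply Rmult_le_pos; lra). lra.
        + destruct (Hd t Ht HNt) as [l [Hl0 Hl]].
          destruct Hl as [_ Hl]. specialize (Hl t (fun P H => H) (mkposreal e He)).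
          destruct Hl as [dl Hl]. exists dl. split; [apply cond_pos|].
          intros s1 s2 Hs1 Hs2 Hs3 Hs4.
          assert (Hl1 := Hl s1). assert (Hl2 := Hl s2). clear Hl.
          unfold ball in Hl1, Hl2; simpl in Hl1, Hl2.
          unfold AbsRing_ball, norm, minus, plus, opp, scal, abs in Hl1, Hl2; simpl in Hl1, Hl2.
          unfold abs, plus, opp, mult in Hl1, Hl2; simpl in Hl1, Hl2.
          rewrite (Rabs_left1 (s1 + - t)) in Hl1 by lra.
          rewrite (Rabs_pos_eq (s2 + - t)) in Hl2 by lra.
          specialize (Hl1 ltac:(lra)). specialize (Hl2 ltac:(lra)).
          apply Rabs_le_between in Hl1. apply Rabs_le_between in Hl2.
          exists []. simpl. repeat split; try lra.
          * generalize (Hsgi s1 s2). lra.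
          * assert (0 <= l * (s2 - s1)) by (apply Rmult_le_pos; lra).
            assert (0 <= l * (t - s1)) by (apply Rmult_le_pos; lra).
            assert (0 <= l * (s2 - t)) by (apply Rmult_le_pos; lra).
            lra.
      - intros a b c Ha Hc [l1 (Hl1 & Hl2 & Hl3)] [l2 (Hm1 & Hm2 & Hm3)].
        exists (l1 ++ l2). rewrite !list_sum_app. repeat split.
        + now apply chain_app with b.
        + lra.
        + lra. }
    destruct HQ as [l (Hl1 & Hl2 & Hl3)].
    assert (Hs0 : sg q - sg p <= d / 2).
    { assert (0 <= sg p).
      { unfold sg. apply Rle_trans with (tau p O); [apply Ht0|].
        apply Series_ge_term; auto. intros k; apply Ht0. }
      assert (sg q <= Series (fun n => v n - u n)); [|lra].
      unfold sg. apply Series_le; auto. }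
    specialize (Hch l Hl1). lra. }
  (* With this value of [e] the right side of [Hmain] is half of [f p - f q], which contradicts
     [f q < f p]. *)
  apply Rnot_lt_le. intros Hlt.
  specialize (Hmain ((f p - f q) / (2 * (q - p + 1)))).
  assert (0 < (f p - f q) / (2 * (q - p + 1))) as He by (apply Rdiv_lt_0_compat; lra).
  specialize (Hmain He).
  replace ((f p - f q) / (2 * (q - p + 1)) * (q - p) + (f p - f q) / (2 * (q - p + 1)))
    with ((f p - f q) / 2) in Hmain by (field; lra).
  lra.
Qed.

(** The two endpoints, where the derivative is not controlled, are added to the null set. *)
Lemma abs_continuous_ae_incr (f : R -> R) (N : R -> Prop) (p q : R) :
  p <= q -> abs_continuous_on f p q -> null_set N ->
  (forall t, p < t < q -> ~ N t -> exists l, 0 <= l /\ is_derive f t l) ->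
  f p <= f q.
Proof.
  intros Hpq Hac HN Hd.
  apply abs_continuous_ae_closed with (N := fun t => (N t \/ t = p) \/ t = q); auto.
  - now do 2 apply null_set_add_point.
  - intros t Ht Hn. apply Hd; [|tauto].
    split; apply Rnot_le_lt; intros Hle; apply Hn.
    + left; right; lra.
    + right; lra.
Qed.

Lemma sum_n_dominated (L : R) (f a b : nat -> R) n :
  (forall k, (k <= n)%nat -> f k <= L * (a k + b k)) -> sum_n f n <= L * (sum_n a n + sum_n b n).
Proof.
  induction n as [|n IH]; intros H.
  - rewrite !sum_O. now apply H.
  - rewrite !sum_Sn. unfold plus; simpl.
    assert (H1 := IH (fun k Hk => H k (Nat.le_trans _ _ _ Hk (Nat.le_succ_diag_r n)))).
    specialize (H (S n) (le_n _)). lra.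
Qed.

(* The form in which absolute continuity is transported from a solution to
   functions of it. *)
Lemma abs_continuous_dominated (z : R -> C) (f : R -> R) (L p q : R) :
  locally_abs_continuous z ->
  (forall s t, p <= s <= t -> t <= q ->
     Rabs (f t - f s) <= L * ((t - s) + Cmod (z t - z s)%C)) ->
  abs_continuous_on f p q.
Proof.
  intros Hz HL e He.
  set (M := Rmax L 1). assert (HM : 0 < M) by (unfold M; generalize (Rmax_r L 1); lra).
  assert (Hq : 0 < e / (2 * M)) by (apply Rdiv_lt_0_compat; lra).
  destruct (Hz p q _ Hq) as [d [Hd H]].
  exists (Rmin d (e / (2 * M))). split; [now apply Rmin_glb_lt|].
  intros n u v H1 H2 H3.
  specialize (H n u v H1 H2 (Rlt_le_trans _ _ _ H3 (Rmin_l _ _))).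
  assert (H4 := Rlt_le_trans _ _ _ H3 (Rmin_r _ _)).
  apply Rle_lt_trans with (M * (sum_n (fun k => v k - u k) n + sum_n (fun k => Cmod (z (v k) - z (u k))%C) n)).
  - apply (sum_n_dominated M (fun k => Rabs (f (v k) - f (u k))) (fun k => v k - u k)
      (fun k => Cmod (z (v k) - z (u k))%C)).
    intros k Hk. destruct (H1 k Hk) as (Ha & Hb & Hc).
    apply Rle_trans with (1 := HL (u k) (v k) (conj Ha Hb) Hc).
    apply Rmult_le_compat_r; [|apply Rmax_l]. generalize (Cmod_ge_0 (z (v k) - z (u k))%C); lra.
  - replace e with (M * (e / (2 * M) + e / (2 * M))) by (field; lra). apply Rmult_lt_compat_l; lra.
Qed.

(** The mean value inequality for derivatives known almost everywhere: [m * t - s * f t] is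
    nondecreasing for [s = 1] and for [s = -1]. *)
Lemma abs_continuous_ae_bound (z : R -> C) (f : R -> R) (N : R -> Prop) (L m p q : R) :
  p <= q -> locally_abs_continuous z ->
  (forall s t, p <= s <= t -> t <= q -> Rabs (f t - f s) <= L * ((t - s) + Cmod (z t - z s)%C)) ->
  null_set N -> (forall t, p < t < q -> ~ N t -> exists l, Rabs l <= m /\ is_derive f t l) ->
  Rabs (f q - f p) <= m * (q - p).
Proof.
  intros Hpq Hz HL HN Hd.
  assert (Hg : forall s, Rabs s = 1 -> s * (f q - f p) <= m * (q - p)).
  { intros s Hs.
    assert (H : m * p - s * f p <= m * q - s * f q); [|lra].
    apply abs_continuous_ae_incr with (f := fun t => m * t - s * f t) (N := N); auto.
    - apply (abs_continuous_dominated z _ (Rabs m + L)); auto. intros a b Ha Hb.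
      replace (m * b - s * f b - (m * a - s * f a)) with (m * (b - a) + - (s * (f b - f a))) by ring.
      eapply Rle_trans; [apply Rabs_triang|].
      rewrite Rabs_Ropp, !Rabs_mult, Hs, (Rabs_pos_eq (b - a)) by lra.
      specialize (HL a b Ha Hb). generalize (Cmod_ge_0 (z b - z a)%C) (Rabs_pos m). nra.
    - intros t Ht Hn. destruct (Hd t Ht Hn) as [l [Hl Hfl]]. exists (m - s * l). split.
      + generalize (Rle_abs (s * l)). rewrite Rabs_mult, Hs. lra.
      + apply (is_derive_minus (fun t => m * t) (fun t => s * f t)).
        * auto_derive; auto; ring.
        * apply is_derive_scal, Hfl. }
  apply Rabs_le. split.
  - specialize (Hg (-1) Rabs_m1). lra.
  - specialize (Hg 1 Rabs_R1). lra.
Qed.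

Lemma is_derive_fst (z : R -> C) t v : is_derive z t v -> is_derive (fun s => Re (z s)) t (Re v).
Proof.
  intros H. unfold is_derive.
  apply filterdiff_ext_lin with (fun y => fst (scal y v)).
  - apply (filterdiff_comp' z fst); auto.
    apply filterdiff_linear, is_linear_fst.
  - now intros y.
Qed.

Lemma is_derive_snd (z : R -> C) t v : is_derive z t v -> is_derive (fun s => Im (z s)) t (Im v).
Proof.
  intros H. unfold is_derive.
  apply filterdiff_ext_lin with (fun y => snd (scal y v)).
  - apply (filterdiff_comp' z snd); auto.
    apply filterdiff_linear, is_linear_snd.
  - now intros y.
Qed.

Lemma is_derive_pair (x y : R -> R) t a b :
  is_derive x t a -> is_derive y t b -> is_derive (fun s => (x s, y s) : C) t (a, b).
Proof.
  intros Hx Hy. split.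
  { apply is_linear_scal_l. }
  intros w Hw e. assert (Hwt : w = t) by (symmetry; apply is_filter_lim_locally_unique, Hw).
  subst w.
  destruct Hx as [_ Hx]. destruct Hy as [_ Hy].
  assert (He : 0 < e / 2) by (generalize (cond_pos e); lra).
  specialize (Hx t (fun P H => H) (mkposreal _ He)).
  specialize (Hy t (fun P H => H) (mkposreal _ He)).
  generalize (filter_and _ _ Hx Hy). apply filter_imp. clear.
  intros s [H1 H2]. simpl in H1, H2.
  eapply Rle_trans. apply (norm_prod (K := R_AbsRing)). simpl.
  apply Rle_trans with (sqrt 2 * (e / 2 * norm (minus s t))).
  - apply Rmult_le_compat_l; [apply sqrt_pos|]. apply Rmax_lub; assumption.
  - assert (0 <= norm (minus s t)) by apply norm_ge_0.
    set (nm := norm (minus s t) : R) in *.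
    assert (sqrt 2 <= 2).
    { rewrite <- (sqrt_square 2) at 2 by lra. apply sqrt_le_1; lra. }
    assert (0 < e) by apply cond_pos.
    apply Rle_trans with (2 * (e / 2 * nm)); [|right; change (2 * (e / 2 * nm) = e * nm); field].
    apply Rmult_le_compat_r; auto. apply Rmult_le_pos; lra.
Qed.

Lemma Re_le_Cmod_minus (a b : C) : Rabs (Re a - Re b) <= Cmod (a - b)%C.
Proof. apply (re_le_Cmod (a - b)%C). Qed.

Lemma im_le_Cmod (a : C) : Rabs (Im a) <= Cmod a.
Proof.
  unfold Cmod, Im. rewrite <- sqrt_Rsqr_abs. apply sqrt_le_1_alt. unfold Rsqr. nra.
Qed.

Lemma Im_le_Cmod_minus (a b : C) : Rabs (Im a - Im b) <= Cmod (a - b)%C.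
Proof. apply (im_le_Cmod (a - b)%C). Qed.

Lemma Cmod_le_Rabs (a : C) : Cmod a <= Rabs (Re a) + Rabs (Im a).
Proof.
  unfold Cmod. rewrite <- (sqrt_square (Rabs (Re a) + Rabs (Im a))).
  - apply sqrt_le_1_alt. unfold Re, Im.
    rewrite <- (Rsqr_pow2 (fst a)), <- (Rsqr_pow2 (snd a)), (Rsqr_abs (fst a)), (Rsqr_abs (snd a)).
    unfold Rsqr. generalize (Rabs_pos (fst a)) (Rabs_pos (snd a)). nra.
  - generalize (Rabs_pos (Re a)) (Rabs_pos (Im a)); lra.
Qed.

Lemma locally_abs_continuous_cont (z : R -> C) : locally_abs_continuous z ->
  forall t e, 0 < e -> exists d, 0 < d /\ forall s, Rabs (s - t) < d -> Cmod (z s - z t)%C < e.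
Proof.
  intros Hz t e He. destruct (Hz (t - 1) (t + 1) e He) as [d [Hd H]].
  exists (Rmin d 1). split; [apply Rmin_glb_lt; lra|].
  intros s Hs. assert (Hs1 := Rlt_le_trans _ _ _ Hs (Rmin_l _ _)).
  assert (Hs2 := Rlt_le_trans _ _ _ Hs (Rmin_r _ _)).
  apply Rabs_lt_between in Hs1. apply Rabs_lt_between in Hs2.
  destruct (Rle_lt_dec t s) as [Hts|Hts].
  - specialize (H O (fun _ => t) (fun _ => s)). rewrite !sum_O in H. apply H; try lra.
    + intros; lra.
    + intros; lia.
  - specialize (H O (fun _ => s) (fun _ => t)). rewrite !sum_O in H.
    replace (z s - z t)%C with (- (z t - z s))%C by ring. rewrite Cmod_opp. apply H; try lra.
    + intros; lra.
    + intros; lia.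
Qed.

Lemma continuity_Re (z : R -> C) : locally_abs_continuous z -> continuity (fun t => Re (z t)).
Proof.
  intros Hz t e He. destruct (locally_abs_continuous_cont z Hz t e He) as [d [Hd H]].
  exists d. split; auto. intros s [_ Hs].
  eapply Rle_lt_trans; [apply Re_le_Cmod_minus|]. now apply H.
Qed.

Lemma continuity_Im (z : R -> C) : locally_abs_continuous z -> continuity (fun t => Im (z t)).
Proof.
  intros Hz t e He. destruct (locally_abs_continuous_cont z Hz t e He) as [d [Hd H]].
  exists d. split; auto. intros s [_ Hs].
  eapply Rle_lt_trans; [apply Im_le_Cmod_minus|]. now apply H.
Qed.

Lemma Lipschitz_locally_abs_continuous (z : R -> C) :
  (forall p q, exists L, forall s t, p <= s <= t -> t <= q -> Cmod (z t - z s)%C <= L * (t - s)) ->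
  locally_abs_continuous z.
Proof.
  intros HL p q e He. destruct (HL p q) as [L H].
  set (M := Rmax L 1). assert (HM : 0 < M) by (unfold M; generalize (Rmax_r L 1); lra).
  exists (e / (2 * M)). split; [apply Rdiv_lt_0_compat; lra|].
  intros n u v H1 H2 H3.
  apply Rle_lt_trans with (M * (sum_n (fun k => v k - u k) n + sum_n (fun k => v k - u k) n)).
  - apply (sum_n_dominated M (fun k => Cmod (z (v k) - z (u k))%C) (fun k => v k - u k) (fun k => v k - u k)).
    intros k Hk. destruct (H1 k Hk) as (Ha & Hb & Hc).
    apply Rle_trans with (1 := H (u k) (v k) (conj Ha Hb) Hc).
    apply Rle_trans with (M * (v k - u k)); [|apply Rmult_le_compat_l; lra].
    apply Rmult_le_compat_r; [lra|apply Rmax_l].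
  - replace e with (M * (e / (2 * M) + e / (2 * M))) by (field; lra). apply Rmult_lt_compat_l; lra.
Qed.

Lemma Lipschitz_of_derive (f df : R -> R) (L p q : R) :
  (forall t, p <= t <= q -> is_derive f t (df t)) ->
  (forall t, p <= t <= q -> Rabs (df t) <= L) ->
  forall s t, p <= s <= t -> t <= q -> Rabs (f t - f s) <= L * (t - s).
Proof.
  intros Hd HL s t Hs Ht.
  destruct (MVT_gen f s t df) as [c [Hc He]].
  - intros c. rewrite Rmin_left, Rmax_right by lra. intros Hc. apply Hd; lra.
  - intros c. rewrite Rmin_left, Rmax_right by lra. intros Hc.
    apply derivable_continuous_pt. exists (df c). apply is_derive_Reals, Hd; lra.
  - rewrite Rmin_left, Rmax_right in Hc by lra. rewrite He, Rabs_mult, (Rabs_pos_eq (t - s)) by lra.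
    apply Rmult_le_compat_r; [lra|]. apply HL; lra.
Qed.

(** * Curves close to a rotation *)

Lemma Rabs_cos_minus s t : s <= t -> Rabs (cos t - cos s) <= t - s.
Proof.
  intros H. rewrite <- (Rmult_1_l (t - s)).
  apply (Lipschitz_of_derive cos (fun t => - sin t) 1 s t); try lra.
  - intros c _. apply is_derive_Reals, derivable_pt_lim_cos.
  - intros c _. apply Rabs_le. generalize (SIN_bound c); lra.
Qed.

Lemma Rabs_sin_minus s t : s <= t -> Rabs (sin t - sin s) <= t - s.
Proof.
  intros H. rewrite <- (Rmult_1_l (t - s)).
  apply (Lipschitz_of_derive sin cos 1 s t); try lra.
  - intros c _. apply is_derive_Reals, derivable_pt_lim_sin.
  - intros c _. apply Rabs_le. generalize (COS_bound c); lra.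
Qed.

(** The velocity is [i z] up to [m] in each coordinate, almost everywhere. The qualitative picture
    of a lap rests on this alone, whichever field or convex combination of fields the solution
    follows. *)
Record near_rotation (z : R -> C) (p q B m : R) : Prop := {
  nr_ac : locally_abs_continuous z;
  nr_bound : forall t, p <= t <= q -> Rabs (Re (z t)) <= B /\ Rabs (Im (z t)) <= B;
  nr_derive : exists N, null_set N /\ forall t, p < t < q -> ~ N t ->
    exists v : C, is_derive z t v /\ Rabs (Re v + Im (z t)) <= m /\ Rabs (Im v - Re (z t)) <= m }.

Lemma is_derive_Rmult (f g : R -> R) x df dg : is_derive f x df -> is_derive g x dg ->
  is_derive (fun t => f t * g t) x (df * g x + f x * dg).
Proof. intros Hf Hg. apply (is_derive_mult f g); auto. intros; apply Rmult_comm. Qed.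

Lemma near_rotation_close z p q B m : near_rotation z p q B m ->
  forall s t, p <= s <= t -> t <= q ->
    Rabs (Re (z t) - (Re (z s) * cos (t - s) - Im (z s) * sin (t - s))) <= 2 * m * (t - s) /\
    Rabs (Im (z t) - (Re (z s) * sin (t - s) + Im (z s) * cos (t - s))) <= 2 * m * (t - s).
Proof.
  intros [Hac HB [N [HN Hd]]] s t Hs Ht.
  assert (Hsin1 : forall a, Rabs (sin a) <= 1) by (intros a; apply Rabs_le; generalize (SIN_bound a); lra).
  assert (Hcos1 : forall a, Rabs (cos a) <= 1) by (intros a; apply Rabs_le; generalize (COS_bound a); lra).
  (* In a rotating frame the solution moves at speed at most [2 m]. *)
  set (U := fun a r => Re (z r) * cos (r + a) + Im (z r) * sin (r + a)).
  assert (HU : forall a, Rabs (U a t - U a s) <= 2 * m * (t - s)).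
  { intros a. apply abs_continuous_ae_bound with z N (2 * B + 2); auto; try lra.
    - intros u v Hu Hv. unfold U.
      assert (HCr := Re_le_Cmod_minus (z v) (z u)). assert (HCi := Im_le_Cmod_minus (z v) (z u)).
      set (cm := Cmod (z v - z u)%C) in *.
      destruct (HB u) as [HB1 HB2]; [lra|].
      replace (Re (z v) * cos (v + a) + Im (z v) * sin (v + a) - (Re (z u) * cos (u + a) + Im (z u) * sin (u + a)))
        with (((Re (z v) - Re (z u)) * cos (v + a) + Re (z u) * (cos (v + a) - cos (u + a))) +
              ((Im (z v) - Im (z u)) * sin (v + a) + Im (z u) * (sin (v + a) - sin (u + a)))) by ring.
      assert (T : forall x y d e, Rabs x <= cm -> Rabs y <= B -> Rabs d <= 1 -> Rabs e <= v - u ->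
        Rabs (x * d + y * e) <= cm + B * (v - u)).
      { intros x y d e K1 K2 K3 K4. eapply Rle_trans; [apply Rabs_triang|]. rewrite !Rabs_mult.
        generalize (Rabs_pos x) (Rabs_pos y) (Rabs_pos d) (Rabs_pos e). nra. }
      assert (C1 := Rabs_cos_minus (u + a) (v + a) ltac:(lra)). assert (C2 := Rabs_sin_minus (u + a) (v + a) ltac:(lra)).
      replace (v + a - (u + a)) with (v - u) in C1, C2 by ring.
      eapply Rle_trans; [apply Rabs_triang|].
      assert (T1 := T _ _ _ _ HCr HB1 (Hcos1 (v + a)) C1). assert (T2 := T _ _ _ _ HCi HB2 (Hsin1 (v + a)) C2).
      assert (0 <= B) by (generalize (Rabs_pos (Re (z u))); lra).
      assert (0 <= B * cm) by (apply Rmult_le_pos; [auto|apply Cmod_ge_0]). nra.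
    - intros r Hr Hn. destruct (Hd r) as [v (Hv & Hv1 & Hv2)]; [lra|auto|].
      exists ((Re v + Im (z r)) * cos (r + a) + (Im v - Re (z r)) * sin (r + a)). split.
      + eapply Rle_trans; [apply Rabs_triang|]. rewrite !Rabs_mult.
        specialize (Hsin1 (r + a)). specialize (Hcos1 (r + a)).
        generalize (Rabs_pos (Re v + Im (z r))) (Rabs_pos (Im v - Re (z r)))
          (Rabs_pos (sin (r + a))) (Rabs_pos (cos (r + a))). nra.
      + apply is_derive_fst in Hv as Hv3. apply is_derive_snd in Hv as Hv4.
        replace ((Re v + Im (z r)) * cos (r + a) + (Im v - Re (z r)) * sin (r + a)) with
          ((Re v * cos (r + a) + Re (z r) * (- sin (r + a))) + (Im v * sin (r + a) + Im (z r) * cos (r + a)))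
          by ring.
        apply (is_derive_plus (fun r => Re (z r) * cos (r + a)) (fun r => Im (z r) * sin (r + a))).
        * apply (is_derive_Rmult (fun r => Re (z r)) (fun r => cos (r + a)) r (Re v)); auto.
          auto_derive; auto; ring.
        * apply (is_derive_Rmult (fun r => Im (z r)) (fun r => sin (r + a)) r (Im v)); auto.
          auto_derive; auto; ring. }
  (* [U a r] is the real part of [z r] turned by the angle [-(r + a)]. These two phases make its
     value at time [t] equal to [Re (z t)] and to [Im (z t)]. *)
  assert (H1 := HU (- t)). assert (H2 := HU (PI / 2 - t)). unfold U in H1, H2.
  replace (t + - t) with 0 in H1 by ring. replace (s + - t) with (- (t - s)) in H1 by ring.
  replace (t + (PI / 2 - t)) with (PI / 2) in H2 by ring. replace (s + (PI / 2 - t)) with (PI / 2 - (t - s)) in H2 by ring.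
  rewrite cos_neg, sin_neg, cos_0, sin_0 in H1. rewrite cos_shift, sin_shift, cos_PI2, sin_PI2 in H2.
  split; [eapply Rle_trans; [|apply H1]|eapply Rle_trans; [|apply H2]]; right; f_equal; ring.
Qed.

(** The height has derivative [Re z] up to [m], hence of absolute value at least [c - m > 0] and of
    constant sign wherever [Re z] stays beyond [c] or [- c]. This replaces transversality for
    solutions that are only absolutely continuous. *)
Lemma near_rotation_monotone z p q B m c : near_rotation z p q B m -> m < c ->
  forall s t, p <= s < t -> t <= q ->
   ((forall r, s <= r <= t -> c <= Re (z r)) -> Im (z s) < Im (z t)) /\
   ((forall r, s <= r <= t -> Re (z r) <= - c) -> Im (z t) < Im (z s)).
Proof.
  intros [Hac HB [N [HN Hd]]] Hmc s t Hs Ht.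
  assert (Hg : forall sg, Rabs sg = 1 -> (forall r, s <= r <= t -> c <= sg * Re (z r)) -> sg * Im (z s) < sg * Im (z t)).
  { intros sg Hsg Hc.
    assert (H : sg * Im (z s) - (c - m) * s <= sg * Im (z t) - (c - m) * t); [|nra].
    apply (abs_continuous_ae_incr (fun r => sg * Im (z r) - (c - m) * r) N); auto; try lra.
    - apply (abs_continuous_dominated z _ (Rabs (c - m) + 1)); auto. intros a b Ha Hb.
      replace (sg * Im (z b) - (c - m) * b - (sg * Im (z a) - (c - m) * a))
        with (sg * (Im (z b) - Im (z a)) + - ((c - m) * (b - a))) by ring.
      eapply Rle_trans; [apply Rabs_triang|].
      rewrite Rabs_Ropp, !Rabs_mult, Hsg, (Rabs_pos_eq (b - a)) by lra.
      generalize (Im_le_Cmod_minus (z b) (z a)) (Rabs_pos (c - m)) (Cmod_ge_0 (z b - z a)%C). nra.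
    - intros r Hr Hn. destruct (Hd r) as [v (Hv & Hv1 & Hv2)]; [lra|auto|].
      exists (sg * Im v - (c - m)). split.
      + assert (K : Rabs (sg * (Im v - Re (z r))) <= m) by (rewrite Rabs_mult, Hsg; lra).
        apply Rabs_le_between in K. specialize (Hc r). lra.
      + apply (is_derive_minus (fun r => sg * Im (z r)) (fun r => (c - m) * r)).
        * apply is_derive_scal. now apply is_derive_snd.
        * auto_derive; auto; ring. }
  split; intros Hc.
  - assert (K := Hg 1 Rabs_R1). rewrite !Rmult_1_l in K. apply K. intros r Hr. rewrite Rmult_1_l. auto.
  - assert (K : -1 * Im (z s) < -1 * Im (z t)); [|lra]. apply (Hg (-1) Rabs_m1). intros r Hr. specialize (Hc r Hr). lra.
Qed.

Lemma cos_ge_near_0 eta b : 0 <= eta <= PI / 2 -> - eta <= b <= eta -> cos eta <= cos b.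
Proof.
  intros He Hb. generalize PI_RGT_0. intros HPI.
  destruct (Rle_lt_dec 0 b).
  - apply cos_decr_1; lra.
  - rewrite <- (cos_neg b). apply cos_decr_1; lra.
Qed.

Lemma sin_ge_near_PI2 eta b : 0 <= eta <= PI / 2 -> eta <= b <= PI - eta -> sin eta <= sin b.
Proof.
  intros He Hb. rewrite <- (cos_shift eta), <- (cos_shift b). apply cos_ge_near_0; lra.
Qed.

Lemma sin_shift_PI2 a : sin a = cos (a - PI / 2).
Proof. rewrite <- (cos_shift a), <- cos_neg. f_equal; ring. Qed.

Lemma cos_shift_PI2 a : cos a = - sin (a - PI / 2).
Proof. rewrite <- (sin_shift a), <- sin_neg. f_equal; ring. Qed.

Lemma sin_shift_3PI2 a : sin a = - cos (a - 3 * (PI / 2)).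
Proof.
  set (b := a - 3 * (PI / 2)). replace a with (b + PI / 2 + PI) by (unfold b; field).
  rewrite neg_sin, sin_plus, cos_PI2, sin_PI2. ring.
Qed.

Lemma cos_shift_3PI2 a : cos a = sin (a - 3 * (PI / 2)).
Proof.
  set (b := a - 3 * (PI / 2)). replace a with (b + PI / 2 + PI) by (unfold b; field).
  rewrite neg_cos, cos_plus, cos_PI2, sin_PI2. ring.
Qed.

Lemma IVT_unit (f : R -> R) (a b y : R) : continuity f -> a < b ->
  (f a < y < f b \/ f b < y < f a) -> exists c, a < c < b /\ f c = y.
Proof.
  intros Hf Hab Hy. destruct (IVT_gen f a b y Hf) as [c [Hc He]].
  - unfold Rmin, Rmax. repeat destruct (Rle_dec _ _); lra.
  - rewrite Rmin_left, Rmax_right in Hc by lra. exists c. split; auto.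
    destruct (Req_dec c a) as [->|]; [lra|]. destruct (Req_dec c b) as [->|]; lra.
Qed.

(** * Half laps between consecutive crossings of Im z = 1 *)

Section HalfLaps.

Variables r0 eta c kap m B : R.
Hypothesis Heta : 0 < eta < PI / 4.
Hypothesis Hcos : 1 < r0 * cos eta - kap.
Hypothesis Hsin : c <= r0 * sin eta - kap.
Hypothesis Hmc : m < c.
Hypothesis Hc0 : 0 < c.
Hypothesis Hr0 : 0 < r0.

(** The reference runs on the circle of radius [r0] at unit angular speed. By [Hcos], the solution
    is above 1 or below -1 when the reference is within angle [eta] of the vertical axis; by [Hsin],
    its real part is at least [c] in absolute value otherwise. So at every time either the position
    relative to the line or the monotony of the height is known. *)
Definition near_circle (z : R -> C) (phi p q : R) : Prop := forall t, p <= t <= q ->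
  Rabs (Re (z t) - r0 * cos (phi + t)) <= kap /\ Rabs (Im (z t) - r0 * sin (phi + t)) <= kap.

Lemma near_circle_right z phi p q : near_circle z phi p q -> forall t, p <= t <= q ->
  3 * (PI / 2) + eta <= phi + t <= 5 * (PI / 2) - eta -> c <= Re (z t).
Proof.
  intros H t Ht Ha. destruct (H t Ht) as [H1 _]. apply Rabs_le_between in H1.
  assert (sin eta <= cos (phi + t)); [|nra].
  rewrite cos_shift_3PI2. apply sin_ge_near_PI2; generalize PI_RGT_0; lra.
Qed.

Lemma near_circle_right0 z phi p q : near_circle z phi p q -> forall t, p <= t <= q ->
  eta - PI / 2 <= phi + t <= PI / 2 - eta -> c <= Re (z t).
Proof.
  intros H t Ht Ha. destruct (H t Ht) as [H1 _]. apply Rabs_le_between in H1.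
  assert (sin eta <= cos (phi + t)); [|nra].
  rewrite <- sin_shift. apply sin_ge_near_PI2; generalize PI_RGT_0; lra.
Qed.

Lemma near_circle_left z phi p q : near_circle z phi p q -> forall t, p <= t <= q ->
  PI / 2 + eta <= phi + t <= 3 * (PI / 2) - eta -> Re (z t) <= - c.
Proof.
  intros H t Ht Ha. destruct (H t Ht) as [H1 _]. apply Rabs_le_between in H1.
  assert (sin eta <= - cos (phi + t)); [|nra].
  rewrite cos_shift_PI2, Ropp_involutive. apply sin_ge_near_PI2; generalize PI_RGT_0; lra.
Qed.

Lemma near_circle_top z phi p q : near_circle z phi p q -> forall t, p <= t <= q ->
  PI / 2 - eta <= phi + t <= PI / 2 + eta -> 1 < Im (z t).
Proof.
  intros H t Ht Ha. destruct (H t Ht) as [_ H1]. apply Rabs_le_between in H1.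
  assert (cos eta <= sin (phi + t)); [|nra].
  rewrite sin_shift_PI2. apply cos_ge_near_0; generalize PI_RGT_0; lra.
Qed.

Lemma near_circle_top2 z phi p q : near_circle z phi p q -> forall t, p <= t <= q ->
  5 * (PI / 2) - eta <= phi + t <= 5 * (PI / 2) + eta -> 1 < Im (z t).
Proof.
  intros H t Ht Ha. apply (near_circle_top z (phi - 2 * PI) p q); auto; [|lra].
  intros s Hs. destruct (H s Hs) as [H1 H2].
  replace (phi - 2 * PI + s) with (phi + s - 2 * PI) by ring.
  replace (phi + s) with (phi + s - 2 * PI + 2 * PI) in H1, H2 by ring.
  now rewrite cos_plus, sin_plus, cos_2PI, sin_2PI, !Rmult_0_r, !Rmult_1_r, Rminus_0_r, Rplus_0_r in *.
Qed.

Lemma near_circle_bottom z phi p q : near_circle z phi p q -> forall t, p <= t <= q ->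
  3 * (PI / 2) - eta <= phi + t <= 3 * (PI / 2) + eta -> Im (z t) < -1.
Proof.
  intros H t Ht Ha. destruct (H t Ht) as [_ H1]. apply Rabs_le_between in H1.
  assert (cos eta <= - sin (phi + t)); [|nra].
  rewrite sin_shift_3PI2, Ropp_involutive. apply cos_ge_near_0; generalize PI_RGT_0; lra.
Qed.

(** The reference starts at angle [PI / 2 - 2 * eta]. The height rises for a time [eta], stays above
    1 while the angle is within [eta] of [PI / 2], and then falls until the bottom of the circle;
    the level 1 is met during this fall. A window of length 8 exceeds a full turn. *)
Lemma upper_half z tc : near_rotation z tc (tc + 8) B m ->
  near_circle z (PI / 2 - 2 * eta - tc) tc (tc + 8) -> Im (z tc) = 1 ->
  exists t1, tc < t1 < tc + 8 /\ Im (z t1) = 1 /\ Re (z t1) <= - c /\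
    forall t, tc < t < t1 -> 1 < Im (z t).
Proof.
  intros Hz Hn Hy. generalize PI_RGT_0 PI_4. intros HP0 HP4.
  assert (Hm := near_rotation_monotone _ _ _ _ _ c Hz Hmc).
  set (tA := tc + 3 * eta). set (tB := tc + PI + eta).
  assert (HyA : 1 < Im (z tA)).
  { apply (near_circle_top z _ _ _ Hn); unfold tA; lra. }
  assert (HyB : Im (z tB) < -1).
  { apply (near_circle_bottom z _ _ _ Hn); unfold tB; lra. }
  destruct (IVT_unit (fun t => Im (z t)) tA tB 1) as [t1 [Ht1 Hy1]]; auto.
  { apply continuity_Im, Hz. } { unfold tA, tB; lra. } { right; lra. }
  exists t1. unfold tA, tB in *. repeat split; auto; try lra.
  - apply (near_circle_left z _ _ _ Hn); lra.
  - intros t Ht. destruct (Rle_lt_dec t (tc + eta)) as [H1|H1].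
    + rewrite <- Hy. apply (Hm tc t); try lra.
      intros r Hr. apply (near_circle_right0 z _ _ _ Hn); lra.
    + destruct (Rle_lt_dec t (tc + 3 * eta)) as [H2|H2].
      * apply (near_circle_top z _ _ _ Hn); lra.
      * rewrite <- Hy1. apply (Hm t t1); try lra.
        intros r Hr. apply (near_circle_left z _ _ _ Hn); lra.
Qed.

(** The same picture, started on the left at angle [PI / 2 + 2 * eta]. The bound [tc + 1 < t2]
    guarantees a uniform gain of time per lap, and [t2 < tc + 2 * PI] selects the branch of the
    angle in [spiral_angle]. *)
Lemma lower_half z tc : near_rotation z tc (tc + 8) B m ->
  near_circle z (PI / 2 + 2 * eta - tc) tc (tc + 8) -> Im (z tc) = 1 ->
  exists t2, tc + 1 < t2 < tc + 2 * PI /\ Im (z t2) = 1 /\ c <= Re (z t2) /\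
    forall t, tc < t < t2 -> Im (z t) < 1.
Proof.
  intros Hz Hn Hy. generalize PI_RGT_0 PI_4 PI2_3_2. intros HP0 HP4 HP3.
  assert (Hm := near_rotation_monotone _ _ _ _ _ c Hz Hmc).
  set (tA := tc + PI - eta). set (tB := tc + 2 * PI - 3 * eta).
  assert (HyA : Im (z tA) < -1).
  { apply (near_circle_bottom z _ _ _ Hn); unfold tA; lra. }
  assert (HyB : 1 < Im (z tB)).
  { apply (near_circle_top2 z _ _ _ Hn); unfold tB; lra. }
  destruct (IVT_unit (fun t => Im (z t)) tA tB 1) as [t1 [Ht1 Hy1]]; auto.
  { apply continuity_Im, Hz. } { unfold tA, tB; lra. } { left; lra. }
  exists t1. unfold tA, tB in *. repeat split; auto; try lra.
  - apply (near_circle_right z _ _ _ Hn); lra.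
  - intros t Ht. destruct (Rle_lt_dec t (tc + PI - 3 * eta)) as [H1|H1].
    + rewrite <- Hy. apply (Hm tc t); try lra.
      intros r Hr. apply (near_circle_left z _ _ _ Hn); lra.
    + destruct (Rle_lt_dec t (tc + PI - eta)) as [H2|H2].
      * assert (Im (z t) < -1); [|lra]. apply (near_circle_bottom z _ _ _ Hn); lra.
      * rewrite <- Hy1. apply (Hm t t1); try lra.
        intros r Hr. apply (near_circle_right z _ _ _ Hn); lra.
Qed.

(** If the starting angle is at most [- (PI / 2) - eta], the bottom lies ahead and the crossing
    occurs on the following ascent. Otherwise the ascent between angles [3 * (PI / 2)] and
    [5 * (PI / 2)] is used; it is over within a time [3 * PI], which is at most 12. *)
Lemma crossing_exists z phi tc : - PI <= phi + tc <= PI -> near_rotation z tc (tc + 12) B m ->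
  near_circle z phi tc (tc + 12) -> exists t, tc < t /\ Im (z t) = 1 /\ c <= Re (z t).
Proof.
  intros Hphi Hz Hn. generalize PI_RGT_0 PI_4. intros HP0 HP4.
  destruct (Rle_lt_dec (phi + tc) (- (PI / 2) - eta)) as [Hlow|Hhigh].
  - set (tA := - (PI / 2) - eta - phi). set (tB := PI / 2 - phi).
    assert (Hn' : near_circle z (phi + 2 * PI) tc (tc + 12)).
    { intros s Hs. destruct (Hn s Hs) as [H1 H2].
      replace (phi + 2 * PI + s) with (phi + s + 2 * PI) by ring.
      now rewrite (cos_plus (phi + s)), (sin_plus (phi + s)), cos_2PI, sin_2PI,
        !Rmult_0_r, !Rmult_1_r, Rminus_0_r, Rplus_0_r. }
    destruct (IVT_unit (fun t => Im (z t)) tA tB 1) as [t1 [Ht1 Hy1]].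
    { apply continuity_Im, Hz. } { unfold tA, tB; lra. }
    { left. split.
      - assert (Im (z tA) < -1); [|lra]. apply (near_circle_bottom z _ _ _ Hn'); unfold tA; lra.
      - apply (near_circle_top z _ _ _ Hn); unfold tB; lra. }
    unfold tA, tB in *. exists t1. repeat split; auto; try lra.
    destruct (Rle_lt_dec t1 (3 * (PI / 2) + eta - (phi + 2 * PI))) as [H1|H1].
    + assert (Im (z t1) < -1); [|lra]. apply (near_circle_bottom z _ _ _ Hn'); lra.
    + destruct (Rle_lt_dec t1 (PI / 2 - eta - phi)) as [H2|H2].
      * apply (near_circle_right z _ _ _ Hn'); lra.
      * assert (1 < Im (z t1)); [|lra]. apply (near_circle_top z _ _ _ Hn); lra.
  - set (tA := 3 * (PI / 2) - phi). set (tB := 5 * (PI / 2) - eta - phi).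
    destruct (IVT_unit (fun t => Im (z t)) tA tB 1) as [t1 [Ht1 Hy1]].
    { apply continuity_Im, Hz. } { unfold tA, tB; lra. }
    { left. split.
      - assert (Im (z tA) < -1); [|lra]. apply (near_circle_bottom z _ _ _ Hn); unfold tA; lra.
      - apply (near_circle_top2 z _ _ _ Hn); unfold tB; lra. }
    unfold tA, tB in *. exists t1. repeat split; auto; try lra.
    destruct (Rle_lt_dec t1 (3 * (PI / 2) + eta - phi)) as [H1|H1].
    + assert (Im (z t1) < -1); [|lra]. apply (near_circle_bottom z _ _ _ Hn); lra.
    + destruct (Rle_lt_dec t1 (5 * (PI / 2) - eta - phi)) as [H2|H2].
      * apply (near_circle_right z _ _ _ Hn); lra.
      * assert (1 < Im (z t1)); [|lra]. apply (near_circle_top2 z _ _ _ Hn); lra.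
Qed.

End HalfLaps.

Lemma locally_open_interval (P : R -> Prop) a b x : a < x < b -> (forall u, a < u < b -> P u) -> locally x P.
Proof.
  intros Hx HP. assert (He : 0 < Rmin (x - a) (b - x)) by (apply Rmin_glb_lt; lra).
  exists (mkposreal _ He). intros u Hu. apply HP.
  unfold ball in Hu; simpl in Hu. unfold AbsRing_ball, minus, plus, opp, abs in Hu; simpl in Hu.
  generalize (Rmin_l (x - a) (b - x)) (Rmin_r (x - a) (b - x)). intros H1 H2.
  apply Rabs_lt_between in Hu. lra.
Qed.

(** * From derivatives almost everywhere to classical derivatives *)

Lemma ex_RInt_cont (g : R -> R) a b : continuity g -> ex_RInt g a b.
Proof.
  intros Hg. apply (ex_RInt_continuous (V := R_CompleteNormedModule)). intros w _.
  apply continuity_pt_filterlim, Hg.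
Qed.

Lemma RInt_derive_cont (g : R -> R) p t : continuity g -> is_derive (fun t => RInt g p t) t (g t).
Proof.
  intros Hg. apply (is_derive_RInt g _ p t).
  - apply filter_forall. intros r. apply (RInt_correct (V := R_CompleteNormedModule)). now apply ex_RInt_cont.
  - apply continuity_pt_filterlim, Hg.
Qed.

Lemma is_derive_continuity (f df : R -> R) : (forall t, is_derive f t (df t)) -> continuity f.
Proof.
  intros H t. apply derivable_continuous_pt. exists (df t). apply is_derive_Reals, H.
Qed.

Lemma continuity_bounded (g : R -> R) p q : continuity g -> exists L, 0 <= L /\ forall r, p <= r <= q -> Rabs (g r) <= L.
Proof.
  intros Hg. destruct (Rle_lt_dec p q) as [Hpq|Hpq]; [|exists 0; split; [lra|intros; lra]].
  destruct (continuity_ab_maj g p q) as [M1 [HM1 _]]; auto.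
  destruct (continuity_ab_min g p q) as [M2 [HM2 _]]; auto.
  exists (Rabs (g M1) + Rabs (g M2)). generalize (Rabs_pos (g M1)) (Rabs_pos (g M2)). intros.
  split; [lra|]. intros r Hr. specialize (HM1 r Hr). specialize (HM2 r Hr).
  apply Rabs_le. generalize (Rle_abs (g M1)) (Rle_abs (- g M2)). rewrite Rabs_Ropp. lra.
Qed.

Definition clamp (a b x : R) : R := Rmax a (Rmin b x).

Lemma clamp_in a b x : a <= b -> a <= clamp a b x <= b.
Proof. unfold clamp, Rmax, Rmin. repeat destruct (Rle_dec _ _); lra. Qed.

Lemma clamp_id a b x : a <= x <= b -> clamp a b x = x.
Proof. unfold clamp, Rmax, Rmin. repeat destruct (Rle_dec _ _); lra. Qed.

Lemma clamp_step a b x y : a <= b -> x <= y -> 0 <= clamp a b y - clamp a b x <= y - x.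
Proof. unfold clamp, Rmax, Rmin. repeat destruct (Rle_dec _ _); lra. Qed.

Lemma clamp_Lipschitz a b x y : a <= b -> Rabs (clamp a b x - clamp a b y) <= Rabs (x - y).
Proof.
  intros Hab. destruct (Rle_lt_dec x y) as [H|H].
  - destruct (clamp_step a b x y Hab H). rewrite !Rabs_left1; lra.
  - destruct (clamp_step a b y x Hab ltac:(lra)). rewrite !Rabs_pos_eq; lra.
Qed.

(** The difference between [x] and a primitive [G] of [g] has derivative 0 almost everywhere, hence
    is constant by the mean value inequality with bound 0; and [G] is differentiable everywhere
    because [g] is continuous. *)
Lemma derive_of_ae (z : R -> C) (x g : R -> R) (N : R -> Prop) (p q : R) :
  locally_abs_continuous z -> (forall s t, Rabs (x t - x s) <= Cmod (z t - z s)%C) ->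
  continuity g -> null_set N ->
  (forall t, p < t < q -> ~ N t -> is_derive x t (g t)) ->
  forall t, p < t < q -> is_derive x t (g t).
Proof.
  intros Hz Hx Hg HN Hd t Ht.
  set (G := fun t => RInt g p t : R).
  assert (HG : forall t, is_derive G t (g t)) by (intros; now apply (RInt_derive_cont g)).
  destruct (continuity_bounded g p q Hg) as [L [HL0 HL]].
  assert (Hcst : forall s, p <= s <= q -> x s - G s = x p - G p).
  { intros s Hs. assert (H : Rabs ((x s - G s) - (x p - G p)) <= 0 * (s - p)).
    { apply (abs_continuous_ae_bound z (fun s => x s - G s) N (L + 1)); auto; try lra.
      - intros a b Ha Hb. replace (x b - G b - (x a - G a)) with ((x b - x a) + - (G b - G a)) by ring.
        eapply Rle_trans; [apply Rabs_triang|]. rewrite Rabs_Ropp.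
        assert (Rabs (G b - G a) <= L * (b - a)).
        { apply (Lipschitz_of_derive G g L a b); try lra; auto. intros r Hr. apply HL; lra. }
        generalize (Hx a b) (Cmod_ge_0 (z b - z a)%C). nra.
      - intros r Hr Hn. exists 0. split; [rewrite Rabs_R0; lra|].
        replace 0 with (g r - g r) by ring.
        apply (is_derive_minus x G); auto. apply Hd; auto; lra. }
    rewrite Rmult_0_l in H. apply Rabs_le_between in H. lra. }
  apply (is_derive_ext_loc (fun s => (x p - G p) + G s)).
  - apply (locally_open_interval _ p q); auto. intros s Hs.
    assert (K := Hcst s ltac:(lra)). change (x p - G p + G s = x s). lra.
  - replace (g t) with (0 + g t) by ring.
    apply (is_derive_plus (fun _ => x p - G p) G); auto. auto_derive; auto.
Qed.

(** Boundedness and Lipschitz continuity on squares are stated together so that the class is closed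
    under products, hence contains every polynomial. It supplies the estimates, the continuity and
    the uniqueness of solutions for the fields below. *)
Definition box_bounded (F : R -> R -> R) : Prop := forall B, exists M, 0 <= M /\
  forall x y x' y', Rabs x <= B -> Rabs y <= B -> Rabs x' <= B -> Rabs y' <= B ->
    Rabs (F x y) <= M /\ Rabs (F x y - F x' y') <= M * (Rabs (x - x') + Rabs (y - y')).

Lemma box_bounded_const c : box_bounded (fun _ _ => c).
Proof.
  intros B. exists (Rabs c). split; [apply Rabs_pos|]. intros x y x' y' _ _ _ _. split; [lra|].
  rewrite Rminus_diag, Rabs_R0. apply Rmult_le_pos; [apply Rabs_pos|].
  generalize (Rabs_pos (x - x')) (Rabs_pos (y - y')). lra.
Qed.

Lemma box_bounded_fst : box_bounded (fun x _ => x).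
Proof.
  intros B. exists (Rabs B + 1). split; [generalize (Rabs_pos B); lra|].
  intros x y x' y' Hx _ _ _. split.
  - generalize (Rle_abs B). lra.
  - generalize (Rabs_pos (x - x')) (Rabs_pos (y - y')) (Rabs_pos B). nra.
Qed.

Lemma box_bounded_snd : box_bounded (fun _ y => y).
Proof.
  intros B. exists (Rabs B + 1). split; [generalize (Rabs_pos B); lra|].
  intros x y x' y' _ Hx _ _. split.
  - generalize (Rle_abs B). lra.
  - generalize (Rabs_pos (x - x')) (Rabs_pos (y - y')) (Rabs_pos B). nra.
Qed.

Lemma box_bounded_plus F G : box_bounded F -> box_bounded G -> box_bounded (fun x y => F x y + G x y).
Proof.
  intros HF HG B. destruct (HF B) as [M1 [H1 HF']]. destruct (HG B) as [M2 [H2 HG']].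
  exists (M1 + M2). split; [lra|]. intros x y x' y' Hx Hy Hx' Hy'.
  destruct (HF' x y x' y' Hx Hy Hx' Hy'). destruct (HG' x y x' y' Hx Hy Hx' Hy').
  split.
  - eapply Rle_trans; [apply Rabs_triang|]. lra.
  - replace (F x y + G x y - (F x' y' + G x' y')) with ((F x y - F x' y') + (G x y - G x' y')) by ring.
    eapply Rle_trans; [apply Rabs_triang|]. lra.
Qed.

Lemma box_bounded_mult F G : box_bounded F -> box_bounded G -> box_bounded (fun x y => F x y * G x y).
Proof.
  intros HF HG B. destruct (HF B) as [M1 [H1 HF']]. destruct (HG B) as [M2 [H2 HG']].
  exists (2 * M1 * M2). split; [nra|]. intros x y x' y' Hx Hy Hx' Hy'.
  destruct (HF' x y x' y' Hx Hy Hx' Hy') as [K1 K2]. destruct (HG' x y x' y' Hx Hy Hx' Hy') as [K3 K4].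
  destruct (HG' x' y' x y Hx' Hy' Hx Hy) as [K5 _].
  generalize (Rabs_pos (x - x')) (Rabs_pos (y - y')); intros D1 D2.
  split.
  - rewrite Rabs_mult. generalize (Rabs_pos (F x y)) (Rabs_pos (G x y)).
    intros. apply Rle_trans with (M1 * M2); [apply Rmult_le_compat; auto|nra].
  - replace (F x y * G x y - F x' y' * G x' y')
      with (F x y * (G x y - G x' y') + (F x y - F x' y') * G x' y') by ring.
    eapply Rle_trans; [apply Rabs_triang|]. rewrite !Rabs_mult.
    assert (T1 := Rmult_le_compat _ _ _ _ (Rabs_pos _) (Rabs_pos _) K1 K4).
    assert (T2 := Rmult_le_compat _ _ _ _ (Rabs_pos _) (Rabs_pos _) K2 K5). nra.
Qed.

Lemma box_bounded_ext F G : (forall x y, F x y = G x y) -> box_bounded F -> box_bounded G.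
Proof.
  intros H HF B. destruct (HF B) as [M [HM HF']]. exists M. split; auto.
  intros x y x' y'. rewrite <- !H. apply HF'.
Qed.

Lemma box_bounded_pow F n : box_bounded F -> box_bounded (fun x y => F x y ^ n).
Proof.
  intros HF. induction n as [|n IH]; simpl.
  - apply box_bounded_const.
  - now apply box_bounded_mult.
Qed.

Lemma box_bounded_minus F G : box_bounded F -> box_bounded G -> box_bounded (fun x y => F x y - G x y).
Proof.
  intros HF HG. apply box_bounded_ext with (fun x y => F x y + (-1) * G x y).
  - intros; ring.
  - apply box_bounded_plus; auto. apply box_bounded_mult; auto. apply box_bounded_const.
Qed.

Ltac box_bounded :=
  repeat first [ apply box_bounded_const | apply box_bounded_fst | apply box_bounded_snd
    | apply box_bounded_minus | apply box_bounded_plus | apply box_bounded_mult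
    | apply box_bounded_pow ].

Lemma box_bounded_continuity F (x y : R -> R) : box_bounded F -> continuity x -> continuity y ->
  continuity (fun t => F (x t) (y t)).
Proof.
  intros HF Hx Hy t e He.
  set (B := Rabs (x t) + Rabs (y t) + 1).
  destruct (HF B) as [M [HM H]].
  assert (He' : 0 < e / (2 * (M + 1))) by (apply Rdiv_lt_0_compat; lra).
  destruct (Hx t (Rmin 1 (e / (2 * (M + 1))))) as [d1 [Hd1 H1]]; [apply Rmin_glb_lt; lra|].
  destruct (Hy t (Rmin 1 (e / (2 * (M + 1))))) as [d2 [Hd2 H2]]; [apply Rmin_glb_lt; lra|].
  exists (Rmin d1 d2). split; [apply Rmin_glb_lt; lra|].
  intros s [Hs1 Hs2]. simpl in *. unfold Rdist in *.
  specialize (H1 s (conj Hs1 (Rlt_le_trans _ _ _ Hs2 (Rmin_l _ _)))).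
  specialize (H2 s (conj Hs1 (Rlt_le_trans _ _ _ Hs2 (Rmin_r _ _)))).
  assert (H1a := Rlt_le_trans _ _ _ H1 (Rmin_l _ _)). assert (H1b := Rlt_le_trans _ _ _ H1 (Rmin_r _ _)).
  assert (H2a := Rlt_le_trans _ _ _ H2 (Rmin_l _ _)). assert (H2b := Rlt_le_trans _ _ _ H2 (Rmin_r _ _)).
  generalize (Rabs_pos (x t)) (Rabs_pos (y t)). intros P1 P2.
  assert (Rabs (x s) <= B).
  { replace (x s) with ((x s - x t) + x t) by ring. eapply Rle_trans; [apply Rabs_triang|]. unfold B; lra. }
  assert (Rabs (y s) <= B).
  { replace (y s) with ((y s - y t) + y t) by ring. eapply Rle_trans; [apply Rabs_triang|]. unfold B; lra. }
  destruct (H (x s) (y s) (x t) (y t)) as [_ K3]; auto; try (unfold B; lra).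
  eapply Rle_lt_trans; [apply K3|].
  apply Rle_lt_trans with (M * (2 * (e / (2 * (M + 1))))).
  - apply Rmult_le_compat_l; lra.
  - replace (M * (2 * (e / (2 * (M + 1))))) with (e * (M / (M + 1))) by (field; lra).
    rewrite <- (Rmult_1_r e) at 2. apply Rmult_lt_compat_l; auto.
    apply Rmult_lt_reg_r with (M + 1); [lra|]. unfold Rdiv. rewrite Rmult_assoc, Rinv_l; lra.
Qed.

(** * The vector fields *)

Definition follows (F1 F2 : R -> R -> R) (z : R -> C) (t : R) : Prop :=
  is_derive (fun s => Re (z s)) t (F1 (Re (z t)) (Im (z t))) /\
  is_derive (fun s => Im (z s)) t (F2 (Re (z t)) (Im (z t))).

Section System.

Variables al a1 b0 b2 b4 : R.

(** The polynomial field sits in [Upper]. [Central] and [Lower] receive the same focus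
    [(i + eps al) z], whose only nonzero coefficient is the real one of degree 1. *)
Definition coefA (s : zone) (j : nat) : R :=
  match s, j with Upper, 1%nat => a1 | Upper, _ => 0 | _, 1%nat => al | _, _ => 0 end.

Definition coefB (s : zone) (j : nat) : R :=
  match s, j with Upper, 0%nat => b0 | Upper, 2%nat => b2 | Upper, 4%nat => b4 | _, _ => 0 end.

(** Real part of [i b0 + a1 z + i b2 z^2 + i b4 z^4]; the imaginary part is [him]. *)
Definition hre (x y : R) : R := a1 * x - b2 * (2 * x * y) - b4 * (4 * x ^ 3 * y - 4 * x * y ^ 3).
Definition him (x y : R) : R :=
  b0 + a1 * y + b2 * (x ^ 2 - y ^ 2) + b4 * (x ^ 4 - 6 * x ^ 2 * y ^ 2 + y ^ 4).

Lemma box_bounded_hre : box_bounded hre.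
Proof. unfold hre. box_bounded. Qed.

Lemma box_bounded_him : box_bounded him.
Proof. unfold him. box_bounded. Qed.

Definition fre (eps x y : R) : R := - y + eps * hre x y.
Definition fim (eps x y : R) : R := x + eps * him x y.

Definition gre (eps x y : R) : R := - y + eps * (al * x).
Definition gim (eps x y : R) : R := x + eps * (al * y).

Lemma box_bounded_fre eps : box_bounded (fre eps).
Proof.
  apply box_bounded_ext with (fun x y => 0 - y + eps * hre x y).
  - intros; unfold fre; ring.
  - apply box_bounded_plus; [box_bounded|]. apply box_bounded_mult; [box_bounded|apply box_bounded_hre].
Qed.

Lemma box_bounded_fim eps : box_bounded (fim eps).
Proof.
  apply box_bounded_plus; [box_bounded|]. apply box_bounded_mult; [box_bounded|apply box_bounded_him].
Qed.

Lemma box_bounded_gre eps : box_bounded (gre eps).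
Proof.
  apply box_bounded_ext with (fun x y => 0 - y + eps * (al * x)); [intros; unfold gre; ring|box_bounded].
Qed.

Lemma box_bounded_gim eps : box_bounded (gim eps).
Proof. unfold gim. box_bounded. Qed.

Lemma field_upper eps z : field eps coefA coefB Upper z = (fre eps (Re z) (Im z), fim eps (Re z) (Im z)).
Proof.
  destruct z as [x y]. unfold field, hpoly. rewrite !sum_Sn, sum_O.
  unfold plus, coefA, coefB, fre, fim, hre, him, Re, Im; simpl.
  unfold Cplus, Cmult, RtoC, Ci; simpl. apply injective_projections; simpl; ring.
Qed.

Lemma field_lower eps s z : s <> Upper ->
  field eps coefA coefB s z = (gre eps (Re z) (Im z), gim eps (Re z) (Im z)).
Proof.
  intros Hs. destruct z as [x y]. unfold field, hpoly. rewrite !sum_Sn, sum_O.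
  destruct s; [congruence| |];
  unfold plus, coefA, coefB, gre, gim, Re, Im; simpl;
  unfold Cplus, Cmult, RtoC, Ci; simpl; apply injective_projections; simpl; ring.
Qed.

Lemma between_same (p v : C) : Defs.between p p v <-> v = p.
Proof.
  split.
  - intros [l [_ ->]]. destruct p as [x y]. unfold Cplus, Cmult, RtoC; simpl.
    apply injective_projections; simpl; ring.
  - intros ->. exists 1. split; [lra|]. destruct p as [x y]. unfold Cplus, Cmult, RtoC; simpl.
    apply injective_projections; simpl; ring.
Qed.

Lemma filippov_above eps z v : 1 < Im z ->
  filippov eps coefA coefB z v <-> v = (fre eps (Re z) (Im z), fim eps (Re z) (Im z)).
Proof.
  intros H. unfold filippov. rewrite field_upper. split.
  - intros [[_ H1]|[[H1 _]|[[H1 _]|[[H1 _]|[H1 _]]]]]; auto; try lra.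
    apply Rabs_lt_between in H1; lra.
  - intros ->. now left.
Qed.

(** On Im z = -1 the two adjacent fields coincide, so the Filippov segment degenerates to a point
    and this line disappears from the problem. *)
Lemma filippov_below eps z v : Im z < 1 ->
  filippov eps coefA coefB z v <-> v = (gre eps (Re z) (Im z), gim eps (Re z) (Im z)).
Proof.
  intros H. unfold filippov. rewrite !(field_lower eps Central), !(field_lower eps Lower) by congruence.
  rewrite between_same. split.
  - intros [[H1 _]|[[H1 _]|[[H1 H2]|[[H1 H2]|[H1 H2]]]]]; auto; lra.
  - intros ->. destruct (Rtotal_order (Im z) (-1)) as [H1|[H1|H1]].
    + now do 4 right.
    + do 3 right; now left.
    + do 2 right; left. split; auto. apply Rabs_lt_between; lra.
Qed.

(** Both fields differ from [i z] by O(eps), and convexity extends the bound to the whole segment on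
    the switching line, so crossing and sliding need no separate treatment. *)
Lemma filippov_near_rotation B : exists M, 0 < M /\ forall eps z v,
  Rabs (Re z) <= B -> Rabs (Im z) <= B -> filippov eps coefA coefB z v ->
  Rabs (Re v + Im z) <= Rabs eps * M /\ Rabs (Im v - Re z) <= Rabs eps * M.
Proof.
  destruct (box_bounded_hre B) as [M1 [HM1 H1]]. destruct (box_bounded_him B) as [M2 [HM2 H2]].
  exists (M1 + M2 + Rabs al * Rabs B + 1). split.
  { generalize (Rabs_pos al) (Rabs_pos B); nra. }
  intros eps z v HBx HBy Hv. set (M := M1 + M2 + Rabs al * Rabs B + 1).
  assert (HM0 : 0 <= Rabs al * Rabs B) by (apply Rmult_le_pos; apply Rabs_pos).
  assert (HU : Rabs (fre eps (Re z) (Im z) + Im z) <= Rabs eps * M /\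
               Rabs (fim eps (Re z) (Im z) - Re z) <= Rabs eps * M).
  { unfold fre, fim. split.
    - replace (- Im z + eps * hre (Re z) (Im z) + Im z) with (eps * hre (Re z) (Im z)) by ring.
      rewrite Rabs_mult. apply Rmult_le_compat_l; [apply Rabs_pos|].
      destruct (H1 (Re z) (Im z) (Re z) (Im z)); auto. unfold M; lra.
    - replace (Re z + eps * him (Re z) (Im z) - Re z) with (eps * him (Re z) (Im z)) by ring.
      rewrite Rabs_mult. apply Rmult_le_compat_l; [apply Rabs_pos|].
      destruct (H2 (Re z) (Im z) (Re z) (Im z)); auto. unfold M; lra. }
  assert (HL : Rabs (gre eps (Re z) (Im z) + Im z) <= Rabs eps * M /\
               Rabs (gim eps (Re z) (Im z) - Re z) <= Rabs eps * M).
  { unfold gre, gim. generalize (Rle_abs B) (Rabs_pos al). intros HB Ha. split.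
    - replace (- Im z + eps * (al * Re z) + Im z) with (eps * (al * Re z)) by ring.
      rewrite Rabs_mult. apply Rmult_le_compat_l; [apply Rabs_pos|].
      rewrite Rabs_mult. unfold M. assert (Rabs al * Rabs (Re z) <= Rabs al * Rabs B); [|lra].
      apply Rmult_le_compat_l; lra.
    - replace (Re z + eps * (al * Im z) - Re z) with (eps * (al * Im z)) by ring.
      rewrite Rabs_mult. apply Rmult_le_compat_l; [apply Rabs_pos|].
      rewrite Rabs_mult. unfold M. assert (Rabs al * Rabs (Im z) <= Rabs al * Rabs B); [|lra].
      apply Rmult_le_compat_l; lra. }
  destruct (Rtotal_order (Im z) 1) as [H|[H|H]].
  - apply filippov_below in Hv; auto. subst v. exact HL.
  - destruct Hv as [[H3 _]|[[_ H3]|[[H3 _]|[[H3 _]|[H3 _]]]]]; try lra.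
    2: { rewrite H, Rabs_R1 in H3; lra. }
    rewrite field_upper, (field_lower eps Central) in H3 by congruence.
    destruct H3 as [l [Hl ->]].
    unfold Re at 1, Im at 2. unfold Cplus, Cmult, RtoC; simpl.
    set (A1 := fre eps (Re z) (Im z)) in *. set (A2 := fim eps (Re z) (Im z)) in *.
    set (A3 := gre eps (Re z) (Im z)) in *. set (A4 := gim eps (Re z) (Im z)) in *.
    destruct HU as [HU1 HU2]. destruct HL as [HL1 HL2].
    apply Rabs_le_between in HU1. apply Rabs_le_between in HU2.
    apply Rabs_le_between in HL1. apply Rabs_le_between in HL2.
    split; apply Rabs_le.
    + replace (l * A1 - 0 * A2 + ((1 - l) * A3 - 0 * A4) + Im z)
        with (l * (A1 + Im z) + (1 - l) * (A3 + Im z)) by ring. nra.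
    + replace (l * A2 + 0 * A1 + ((1 - l) * A4 + 0 * A3) - Re z)
        with (l * (A2 - Re z) + (1 - l) * (A4 - Re z)) by ring. nra.
  - apply filippov_above in Hv; auto. subst v. exact HU.
Qed.

Lemma solution_near_rotation eps B M z p q :
  (forall z v, Rabs (Re z) <= B -> Rabs (Im z) <= B -> filippov eps coefA coefB z v ->
    Rabs (Re v + Im z) <= Rabs eps * M /\ Rabs (Im v - Re z) <= Rabs eps * M) ->
  filippov_solution eps coefA coefB z ->
  (forall t, p <= t <= q -> Rabs (Re (z t)) <= B /\ Rabs (Im (z t)) <= B) ->
  near_rotation z p q B (Rabs eps * M).
Proof.
  intros HM [Hac HN] HB. split; auto.
  eexists. split; [apply HN|]. intros t Ht Hn. apply NNPP in Hn. destruct Hn as [v [Hv1 Hv2]].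
  exists v. split; auto. destruct (HB t); [lra|]. now apply HM.
Qed.

Lemma solution_follows eps F1 F2 z p q : filippov_solution eps coefA coefB z ->
  box_bounded F1 -> box_bounded F2 ->
  (forall t v, p < t < q -> filippov eps coefA coefB (z t) v -> v = (F1 (Re (z t)) (Im (z t)), F2 (Re (z t)) (Im (z t)))) ->
  forall t, p < t < q -> follows F1 F2 z t.
Proof.
  intros [Hac HN] HF1 HF2 HF t Ht.
  assert (Hc1 := continuity_Re z Hac). assert (Hc2 := continuity_Im z Hac). split.
  - refine (derive_of_ae z (fun s => Re (z s)) (fun t => F1 (Re (z t)) (Im (z t))) _ p q Hac _ _ HN _ t Ht).
    + intros a b. apply Re_le_Cmod_minus.
    + now apply box_bounded_continuity.
    + intros s Hs Hn. apply NNPP in Hn. destruct Hn as [v [Hv1 Hv2]].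
      apply is_derive_fst in Hv1. now rewrite (HF s v Hs Hv2) in Hv1.
  - refine (derive_of_ae z (fun s => Im (z s)) (fun t => F2 (Re (z t)) (Im (z t))) _ p q Hac _ _ HN _ t Ht).
    + intros a b. apply Im_le_Cmod_minus.
    + now apply box_bounded_continuity.
    + intros s Hs Hn. apply NNPP in Hn. destruct Hn as [v [Hv1 Hv2]].
      apply is_derive_snd in Hv1. now rewrite (HF s v Hs Hv2) in Hv1.
Qed.

Lemma solution_derive_above eps z p q : filippov_solution eps coefA coefB z ->
  (forall t, p < t < q -> 1 < Im (z t)) -> forall t, p < t < q -> follows (fre eps) (fim eps) z t.
Proof.
  intros Hz Hab. apply (solution_follows eps); auto using box_bounded_fre, box_bounded_fim.
  intros t v Ht. apply (filippov_above eps). auto.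
Qed.

Lemma solution_derive_below eps z p q : filippov_solution eps coefA coefB z ->
  (forall t, p < t < q -> Im (z t) < 1) -> forall t, p < t < q -> follows (gre eps) (gim eps) z t.
Proof.
  intros Hz Hab. apply (solution_follows eps); auto using box_bounded_gre, box_bounded_gim.
  intros t v Ht. apply (filippov_below eps). auto.
Qed.

End System.

(** * The first integral *)

(** The increment is taken along two legs with corner [(x, v)], and the mean value theorem is
    applied on each leg. *)
Lemma differentiable_of_partials (f fx fy : R -> R -> R) x y :
  locally_2d (fun u v => is_derive (fun r => f r v) u (fx u v) /\ is_derive (fun r => f u r) v (fy u v)) x y ->
  continuity_2d_pt fx x y -> continuity_2d_pt fy x y ->
  differentiable_pt_lim f x y (fx x y) (fy x y).
Proof.
  intros [d0 H0] Hx Hy e.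
  assert (He : 0 < e / 2) by (generalize (cond_pos e); lra).
  destruct (Hx (mkposreal _ He)) as [d1 H1]. destruct (Hy (mkposreal _ He)) as [d2 H2].
  assert (Hd : 0 < Rmin d0 (Rmin d1 d2)) by (repeat apply Rmin_glb_lt; apply cond_pos).
  exists (mkposreal _ Hd). simpl. intros u v Hu Hv. simpl in H1, H2.
  assert (M0 := Rmin_l d0 (Rmin d1 d2)). assert (M1 := Rmin_r d0 (Rmin d1 d2)).
  assert (M2 := Rmin_l d1 d2). assert (M3 := Rmin_r d1 d2).
  assert (Hin : forall a b c, Rmin a b <= c <= Rmax a b -> Rabs (c - a) <= Rabs (b - a)).
  { intros a b c. unfold Rmin, Rmax. destruct (Rle_dec a b); intros Hc.
    - rewrite !Rabs_pos_eq; lra.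
    - rewrite !Rabs_left1; lra. }
  destruct (MVT_gen (fun r => f r v) x u (fun r => fx r v)) as [c1 [Hc1 E1]].
  { intros c Hc. destruct (H0 c v) as [D _]; auto; try lra.
    assert (K := Hin x u c ltac:(lra)). lra. }
  { intros c Hc. apply derivable_continuous_pt. exists (fx c v). apply is_derive_Reals.
    destruct (H0 c v) as [D _]; auto; try lra. assert (K := Hin x u c Hc). lra. }
  destruct (MVT_gen (fun r => f x r) y v (fun r => fy x r)) as [c2 [Hc2 E2]].
  { intros c Hc. destruct (H0 x c) as [_ D]; auto.
    { rewrite Rminus_diag, Rabs_R0. apply cond_pos. }
    assert (K := Hin y v c ltac:(lra)). lra. }
  { intros c Hc. apply derivable_continuous_pt. exists (fy x c). apply is_derive_Reals.
    destruct (H0 x c) as [_ D]; auto.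
    { rewrite Rminus_diag, Rabs_R0. apply cond_pos. }
    assert (K := Hin y v c Hc). lra. }
  assert (K1 := Hin x u c1 Hc1). assert (K2 := Hin y v c2 Hc2).
  replace (f u v - f x y - (fx x y * (u - x) + fy x y * (v - y)))
    with ((fx c1 v - fx x y) * (u - x) + (fy x c2 - fy x y) * (v - y)) by nra.
  assert (L1 : Rabs (fx c1 v - fx x y) < e / 2) by (apply H1; lra).
  assert (L2 : Rabs (fy x c2 - fy x y) < e / 2).
  { apply H2; [|lra]. rewrite Rminus_diag, Rabs_R0. apply cond_pos. }
  eapply Rle_trans; [apply Rabs_triang|]. rewrite !Rabs_mult.
  generalize (Rmax_l (Rabs (u - x)) (Rabs (v - y))) (Rmax_r (Rabs (u - x)) (Rabs (v - y)))
    (Rabs_pos (u - x)) (Rabs_pos (v - y)). intros. nra.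
Qed.

Lemma box_bounded_continuity_2d F x y : box_bounded F -> continuity_2d_pt F x y.
Proof.
  intros HF e. destruct (HF (Rabs x + Rabs y + 1)) as [M [HM H]].
  assert (Hd : 0 < Rmin 1 (e / (2 * (M + 1)))).
  { apply Rmin_glb_lt; [lra|]. apply Rdiv_lt_0_compat; [apply cond_pos|lra]. }
  exists (mkposreal _ Hd). simpl. intros u v Hu Hv.
  assert (Hu1 := Rlt_le_trans _ _ _ Hu (Rmin_l _ _)). assert (Hu2 := Rlt_le_trans _ _ _ Hu (Rmin_r _ _)).
  assert (Hv1 := Rlt_le_trans _ _ _ Hv (Rmin_l _ _)). assert (Hv2 := Rlt_le_trans _ _ _ Hv (Rmin_r _ _)).
  generalize (Rabs_pos x) (Rabs_pos y) (Rabs_triang (u - x) x) (Rabs_triang (v - y) y).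
  replace (u - x + x) with u by ring. replace (v - y + y) with v by ring. intros.
  destruct (H u v x y) as [_ K]; try lra.
  eapply Rle_lt_trans; [apply K|].
  apply Rle_lt_trans with (M * (2 * (e / (2 * (M + 1))))).
  - apply Rmult_le_compat_l; lra.
  - replace (M * (2 * (e / (2 * (M + 1))))) with (e * (M / (M + 1))) by (field; lra).
    rewrite <- (Rmult_1_r e) at 2. apply Rmult_lt_compat_l; [apply cond_pos|].
    apply Rmult_lt_reg_r with (M + 1); [lra|]. unfold Rdiv. rewrite Rmult_assoc, Rinv_l; lra.
Qed.

Lemma continuity_2d_pt_snd F x y : continuity_2d_pt F x y -> continuity_pt (fun v => F x v) y.
Proof.
  intros H e He. destruct (H (mkposreal _ He)) as [d Hd]. exists d. split; [apply cond_pos|].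
  intros v [_ Hv]. apply Hd; auto. rewrite Rminus_diag, Rabs_R0. apply cond_pos.
Qed.

Lemma continuity_2d_pt_fst F x y : continuity_2d_pt F x y -> continuity_pt (fun u => F u y) x.
Proof.
  intros H e He. destruct (H (mkposreal _ He)) as [d Hd]. exists d. split; [apply cond_pos|].
  intros v [_ Hv]. apply Hd; auto. rewrite Rminus_diag, Rabs_R0. apply cond_pos.
Qed.

Lemma Rmin_max_between a b lo hi c : lo < a < hi -> lo < b < hi -> Rmin a b <= c <= Rmax a b -> lo < c < hi.
Proof. unfold Rmin, Rmax. destruct (Rle_dec a b); lra. Qed.

Section Potential.

Variables a1 b0 b2 b4 eps B : R.

Notation p := (fre a1 b2 b4 eps).
Notation q := (fim a1 b0 b2 b4 eps).

Definition den (x y : R) : R := p x y ^ 2 + q x y ^ 2.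
(** [dpx] and [dqx] are the real and imaginary parts of f'. By the Cauchy-Riemann equations the
    derivatives of [p] and [q] in y are [- dqx] and [dpx]. *)
Definition dpx (x y : R) : R := eps * (a1 - 2 * b2 * y - b4 * (12 * x ^ 2 * y - 4 * y ^ 3)).
Definition dqx (x y : R) : R := 1 + eps * (2 * b2 * x + b4 * (4 * x ^ 3 - 12 * x * y ^ 2)).

(* Real and imaginary parts of 1/f; the Cauchy-Riemann equations for 1/f make
   [recip_im dx + recip_re dy] closed, and it vanishes along f. *)
Definition recip_re (x y : R) : R := p x y / den x y.
Definition recip_im (x y : R) : R := - q x y / den x y.
(** The real part of (1/f)', which is at once the x-derivative of [recip_re] and the y-derivative of
    [recip_im]; this equality is the closedness of the form. *)
Definition recip_d (x y : R) : R :=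
  (dpx x y * (q x y ^ 2 - p x y ^ 2) - 2 * p x y * q x y * dqx x y) / den x y ^ 2.

Lemma recip_re_dx x y : den x y <> 0 -> is_derive (fun u => recip_re u y) x (recip_d x y).
Proof.
  intros H.
  assert (Hp : is_derive (fun u => p u y) x (dpx x y)).
  { unfold fre, hre, dpx. auto_derive; auto; ring. }
  assert (Hq : is_derive (fun u => q u y) x (dqx x y)).
  { unfold fim, him, dqx. auto_derive; auto; ring. }
  assert (Hd : is_derive (fun u => den u y) x (2 * p x y * dpx x y + 2 * q x y * dqx x y)).
  { unfold den.
    apply (is_derive_plus (fun u => p u y ^ 2) (fun u => q u y ^ 2)).
    - replace (2 * p x y * dpx x y) with (INR 2 * dpx x y * p x y ^ 1) by (simpl; ring).
      now apply (is_derive_pow (fun u => p u y)).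
    - replace (2 * q x y * dqx x y) with (INR 2 * dqx x y * q x y ^ 1) by (simpl; ring).
      now apply (is_derive_pow (fun u => q u y)). }
  unfold recip_re.
  replace (recip_d x y) with
    ((dpx x y * den x y - p x y * (2 * p x y * dpx x y + 2 * q x y * dqx x y)) / den x y ^ 2).
  - now apply (is_derive_div (fun u => p u y) (fun u => den u y)).
  - unfold recip_d. f_equal. unfold den. ring.
Qed.

Lemma recip_im_dy x y : den x y <> 0 -> is_derive (fun u => recip_im x u) y (recip_d x y).
Proof.
  intros H.
  assert (Hp : is_derive (fun u => p x u) y (- dqx x y)).
  { unfold fre, hre, dqx. auto_derive; auto; ring. }
  assert (Hq : is_derive (fun u => q x u) y (dpx x y)).
  { unfold fim, him, dpx. auto_derive; auto; ring. }
  assert (Hd : is_derive (fun u => den x u) y (2 * p x y * - dqx x y + 2 * q x y * dpx x y)).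
  { unfold den.
    apply (is_derive_plus (fun u => p x u ^ 2) (fun u => q x u ^ 2)).
    - replace (2 * p x y * - dqx x y) with (INR 2 * - dqx x y * p x y ^ 1) by (simpl; ring).
      now apply (is_derive_pow (fun u => p x u)).
    - replace (2 * q x y * dpx x y) with (INR 2 * dpx x y * q x y ^ 1) by (simpl; ring).
      now apply (is_derive_pow (fun u => q x u)). }
  unfold recip_im.
  replace (recip_d x y) with
    ((- dpx x y * den x y - - q x y * (2 * p x y * - dqx x y + 2 * q x y * dpx x y)) / den x y ^ 2).
  - apply (is_derive_div (fun u => - q x u) (fun u => den x u)); auto.
    now apply (is_derive_opp (fun u => q x u)).
  - unfold recip_d. f_equal. unfold den. ring.
Qed.

Lemma continuity_2d_den x y : continuity_2d_pt den x y.
Proof.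
  apply box_bounded_continuity_2d. unfold den.
  apply box_bounded_plus; apply box_bounded_pow; [apply box_bounded_fre|apply box_bounded_fim].
Qed.

Lemma continuity_2d_recip_re x y : den x y <> 0 -> continuity_2d_pt recip_re x y.
Proof.
  intros H. apply continuity_2d_pt_mult.
  - apply box_bounded_continuity_2d, box_bounded_fre.
  - apply continuity_2d_pt_inv; auto. apply continuity_2d_den.
Qed.

Lemma continuity_2d_recip_im x y : den x y <> 0 -> continuity_2d_pt recip_im x y.
Proof.
  intros H. apply continuity_2d_pt_mult.
  - apply continuity_2d_pt_opp. apply box_bounded_continuity_2d, box_bounded_fim.
  - apply continuity_2d_pt_inv; auto. apply continuity_2d_den.
Qed.

Lemma continuity_2d_recip_d x y : den x y <> 0 -> continuity_2d_pt recip_d x y.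
Proof.
  intros H. apply continuity_2d_pt_mult.
  - apply box_bounded_continuity_2d.
    assert (box_bounded p) by apply box_bounded_fre. assert (box_bounded q) by apply box_bounded_fim.
    apply box_bounded_minus; apply box_bounded_mult.
    + unfold dpx; box_bounded.
    + apply box_bounded_minus; apply box_bounded_pow; auto.
    + apply box_bounded_mult; auto. apply box_bounded_mult; auto. apply box_bounded_const.
    + unfold dqx; box_bounded.
  - apply continuity_2d_pt_inv; [|now apply pow_nonzero].
    apply (continuity_2d_pt_ext (fun x y => den x y * den x y)); [intros; simpl; ring|].
    apply continuity_2d_pt_mult; apply continuity_2d_den.
Qed.

(** The margin between 1/2 and 1 makes the switching line interior, so the potential is
    differentiable where the upper arcs begin and end, while the equilibrium of f near 0 stays
    outside. *)
Definition in_rect (x y : R) : Prop := - B < x < B /\ 1 / 2 < y < B.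

Hypothesis HB : 1 < B.
Hypothesis Hden : forall x y, in_rect x y -> den x y <> 0.

(** Im of the integral of dz/f from [i] along the line Im z = 1. [potential] continues it along the
    vertical segment above or below the point reached. *)
Definition line_potential (x : R) : R := RInt (fun s => recip_im s 1) 0 x.
Definition potential (x y : R) : R := RInt (fun s => recip_re x s) 1 y + line_potential x.

Lemma line_potential_derive x : - B < x < B -> is_derive line_potential x (recip_im x 1).
Proof.
  intros Hx. unfold line_potential.
  assert (Hc : forall u, - B < u < B -> continuous (fun s => recip_im s 1) u).
  { intros u Hu. apply continuity_pt_filterlim, (continuity_2d_pt_fst recip_im), continuity_2d_recip_im.
    apply Hden. split; lra. }
  apply (is_derive_RInt (fun s => recip_im s 1) _ 0 x); [|now apply Hc].
  apply (locally_open_interval _ (- B) B); auto. intros u Hu.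
  apply (RInt_correct (V := R_CompleteNormedModule)), (ex_RInt_continuous (V := R_CompleteNormedModule)).
  intros w Hw. apply Hc. apply (Rmin_max_between 0 u); auto; lra.
Qed.

Lemma continuous_recip_re_snd x y : in_rect x y -> continuous (fun s => recip_re x s) y.
Proof.
  intros H. apply continuity_pt_filterlim, (continuity_2d_pt_snd recip_re), continuity_2d_recip_re. auto.
Qed.

Lemma potential_dy x y : in_rect x y -> is_derive (fun v => potential x v) y (recip_re x y).
Proof.
  intros [Hx Hy]. unfold potential.
  replace (recip_re x y) with (recip_re x y + 0) by ring.
  apply (is_derive_plus (fun v => RInt (fun s => recip_re x s) 1 v) (fun _ => line_potential x));
    [|auto_derive; auto].
  apply (is_derive_RInt (fun s => recip_re x s) _ 1 y).
  - apply (locally_open_interval _ (1 / 2) B); auto. intros u Hu.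
    apply (RInt_correct (V := R_CompleteNormedModule)), (ex_RInt_continuous (V := R_CompleteNormedModule)).
    intros w Hw. apply continuous_recip_re_snd. split; auto. apply (Rmin_max_between 1 u); auto; lra.
  - apply continuous_recip_re_snd. now split.
Qed.

(** Differentiation under the integral turns the vertical part into the integral of [recip_d], which
    by closedness equals [recip_im x y - recip_im x 1]; the horizontal part supplies the missing
    [recip_im x 1]. *)
Lemma potential_dx x y : in_rect x y -> is_derive (fun u => potential u y) x (recip_im x y).
Proof.
  intros [Hx Hy]. unfold potential.
  assert (Hb : forall s, Rmin 1 y <= s <= Rmax 1 y -> 1 / 2 < s < B).
  { intros s. apply (Rmin_max_between 1 y); auto; lra. }
  replace (recip_im x y) with ((recip_im x y - recip_im x 1) + recip_im x 1) by ring.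
  apply (is_derive_plus (fun u => RInt (fun s => recip_re u s) 1 y) line_potential);
    [|now apply line_potential_derive].
  replace (recip_im x y - recip_im x 1) with
    (RInt (fun t => Derive (fun u => recip_re u t) x) 1 y).
  - apply is_derive_RInt_param.
    + apply (locally_open_interval _ (- B) B); auto. intros u Hu t Ht.
      exists (recip_d u t). apply recip_re_dx, Hden. split; auto.
    + intros t Ht. apply (continuity_2d_pt_ext_loc recip_d).
      * assert (Ht' := Hb t Ht).
        assert (Hd : 0 < Rmin (Rmin (x + B) (B - x)) (Rmin (t - 1 / 2) (B - t)))
          by (repeat apply Rmin_glb_lt; lra).
        exists (mkposreal _ Hd). simpl. intros u v Hu Hv. symmetry. apply is_derive_unique, recip_re_dx, Hden.
        generalize (Rmin_l (Rmin (x + B) (B - x)) (Rmin (t - 1 / 2) (B - t)))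
          (Rmin_r (Rmin (x + B) (B - x)) (Rmin (t - 1 / 2) (B - t)))
          (Rmin_l (x + B) (B - x)) (Rmin_r (x + B) (B - x)) (Rmin_l (t - 1 / 2) (B - t)) (Rmin_r (t - 1 / 2) (B - t)).
        intros. apply Rabs_lt_between in Hu. apply Rabs_lt_between in Hv. split; lra.
      * apply continuity_2d_recip_d, Hden. split; auto.
    + apply (locally_open_interval _ (- B) B); auto. intros u Hu.
      apply (ex_RInt_continuous (V := R_CompleteNormedModule)).
      intros s Hs. apply continuous_recip_re_snd. split; auto.
  - apply is_RInt_unique.
    apply (is_RInt_ext (fun t => recip_d x t)).
    + intros t Ht. symmetry. apply is_derive_unique, recip_re_dx, Hden. split; auto. apply Hb; lra.
    + apply (is_RInt_derive (fun t => recip_im x t)).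
      * intros s Hs. apply recip_im_dy, Hden. split; auto.
      * intros s Hs. apply continuity_pt_filterlim, (continuity_2d_pt_snd recip_d), continuity_2d_recip_d, Hden.
        split; auto.
Qed.

Lemma potential_differentiable x y : in_rect x y ->
  differentiable_pt_lim potential x y (recip_im x y) (recip_re x y).
Proof.
  intros H. apply differentiable_of_partials.
  - destruct H as [Hx Hy].
    assert (Hd : 0 < Rmin (Rmin (x + B) (B - x)) (Rmin (y - 1 / 2) (B - y)))
      by (repeat apply Rmin_glb_lt; lra).
    exists (mkposreal _ Hd). simpl. intros u v Hu Hv.
    generalize (Rmin_l (Rmin (x + B) (B - x)) (Rmin (y - 1 / 2) (B - y)))
      (Rmin_r (Rmin (x + B) (B - x)) (Rmin (y - 1 / 2) (B - y)))
      (Rmin_l (x + B) (B - x)) (Rmin_r (x + B) (B - x)) (Rmin_l (y - 1 / 2) (B - y)) (Rmin_r (y - 1 / 2) (B - y)).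
    intros. apply Rabs_lt_between in Hu. apply Rabs_lt_between in Hv.
    split; [apply potential_dx|apply potential_dy]; split; lra.
  - now apply continuity_2d_recip_im, Hden.
  - now apply continuity_2d_recip_re, Hden.
Qed.

Lemma line_potential_conserved (x y : R -> R) s t : s < t ->
  continuity x -> continuity y -> (forall r, s <= r <= t -> in_rect (x r) (y r)) ->
  (forall r, s < r < t -> is_derive x r (p (x r) (y r)) /\ is_derive y r (q (x r) (y r))) ->
  y s = 1 -> y t = 1 -> line_potential (x s) = line_potential (x t).
Proof.
  intros Hst Hcx Hcy Hin Hd Hys Hyt.
  assert (Hl : forall u, line_potential u = potential u 1).
  { intros u. unfold potential. rewrite RInt_point. unfold zero; simpl. ring. }
  rewrite !Hl. rewrite <- Hys at 1. rewrite <- Hyt.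
  destruct (MVT_gen (fun r => potential (x r) (y r)) s t (fun _ => 0)) as [c [_ Hc]]; [| |lra].
  - rewrite Rmin_left, Rmax_right by lra. intros r Hr.
    destruct (Hd r Hr) as [Dx Dy].
    apply is_derive_Reals in Dx. apply is_derive_Reals in Dy. apply is_derive_Reals.
    assert (Hr' := Hin r ltac:(lra)).
    assert (D := derivable_pt_lim_comp_2d _ _ _ _ _ _ _ _ (potential_differentiable _ _ Hr') Dx Dy).
    replace 0 with (recip_im (x r) (y r) * p (x r) (y r) + recip_re (x r) (y r) * q (x r) (y r)); auto.
    unfold recip_im, recip_re. field. now apply Hden.
  - rewrite Rmin_left, Rmax_right by lra. intros r Hr.
    assert (C : continuity_2d_pt potential (x r) (y r)).
    { apply differentiable_continuity_pt. do 2 eexists. apply potential_differentiable. auto. }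
    intros e He. destruct (C (mkposreal _ He)) as [d C'].
    destruct (Hcx r d (cond_pos d)) as [d1 [Hd1 H1]]. destruct (Hcy r d (cond_pos d)) as [d2 [Hd2 H2]].
    exists (Rmin d1 d2). split; [apply Rmin_glb_lt; lra|]. intros w [Hw1 Hw2]. apply C'.
    + apply H1. split; auto. apply (Rlt_le_trans _ _ _ Hw2 (Rmin_l _ _)).
    + apply H2. split; auto. apply (Rlt_le_trans _ _ _ Hw2 (Rmin_r _ _)).
Qed.

End Potential.

(** * The linear focus *)

(** Gronwall's argument: the squared distance of the two curves, weighted by a decreasing
    exponential, is nonincreasing and starts at 0. *)
Lemma gronwall_unique (F1 F2 : R -> R -> R) (B d : R) (x y x' y' : R -> R) :
  box_bounded F1 -> box_bounded F2 -> continuity x -> continuity y -> continuity x' -> continuity y' ->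
  x 0 = x' 0 -> y 0 = y' 0 ->
  (forall t, 0 <= t <= d -> Rabs (x t) <= B /\ Rabs (y t) <= B /\ Rabs (x' t) <= B /\ Rabs (y' t) <= B) ->
  (forall t, 0 < t < d -> is_derive x t (F1 (x t) (y t)) /\ is_derive y t (F2 (x t) (y t)) /\
     is_derive x' t (F1 (x' t) (y' t)) /\ is_derive y' t (F2 (x' t) (y' t))) ->
  forall t, 0 <= t <= d -> x t = x' t /\ y t = y' t.
Proof.
  intros HF1 HF2 Cx Cy Cx' Cy' Ex Ey HB Hd t Ht.
  destruct (HF1 B) as [M1 [HM1 H1]]. destruct (HF2 B) as [M2 [HM2 H2]].
  (* The rate of change of the squared distance is at most 2 M (|dx| + |dy|)^2, which is at most 4 M
     (dx^2 + dy^2). *)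
  set (M := M1 + M2). set (L := 4 * M).
  set (W := fun s => exp (- L * s) * ((x s - x' s) ^ 2 + (y s - y' s) ^ 2)).
  set (dW := fun s => - L * exp (- L * s) * ((x s - x' s) ^ 2 + (y s - y' s) ^ 2) +
     exp (- L * s) * (2 * (x s - x' s) * (F1 (x s) (y s) - F1 (x' s) (y' s)) +
       2 * (y s - y' s) * (F2 (x s) (y s) - F2 (x' s) (y' s)))).
  assert (DE : forall s, is_derive (fun s => exp (- L * s)) s (- L * exp (- L * s))).
  { intros s. auto_derive; auto; ring. }
  assert (HW : W t <= W 0).
  { destruct (MVT_gen W 0 t dW) as [r [Hr Hm]].
    - rewrite Rmin_left, Rmax_right by lra. intros s Hs.
      destruct (Hd s ltac:(lra)) as (D1 & D2 & D3 & D4). unfold W, dW.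
      apply (is_derive_Rmult (fun s => exp (- L * s)) (fun s => (x s - x' s) ^ 2 + (y s - y' s) ^ 2)); auto.
      apply (is_derive_plus (fun s => (x s - x' s) ^ 2) (fun s => (y s - y' s) ^ 2)).
      + replace (2 * (x s - x' s) * (F1 (x s) (y s) - F1 (x' s) (y' s))) with
          (INR 2 * (F1 (x s) (y s) - F1 (x' s) (y' s)) * (x s - x' s) ^ 1) by (simpl; ring).
        apply (is_derive_pow (fun s => x s - x' s)). now apply (is_derive_minus x x').
      + replace (2 * (y s - y' s) * (F2 (x s) (y s) - F2 (x' s) (y' s))) with
          (INR 2 * (F2 (x s) (y s) - F2 (x' s) (y' s)) * (y s - y' s) ^ 1) by (simpl; ring).
        apply (is_derive_pow (fun s => y s - y' s)). now apply (is_derive_minus y y').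
    - intros s _. unfold W. apply continuity_pt_mult.
      + apply derivable_continuous_pt. exists (- L * exp (- L * s)). apply is_derive_Reals, DE.
      + apply continuity_pt_plus.
        * apply (continuity_pt_comp (fun s => x s - x' s) (fun u => u ^ 2)).
          -- now apply continuity_pt_minus.
          -- apply derivable_continuous_pt, derivable_pt_pow.
        * apply (continuity_pt_comp (fun s => y s - y' s) (fun u => u ^ 2)).
          -- now apply continuity_pt_minus.
          -- apply derivable_continuous_pt, derivable_pt_pow.
    - rewrite Rmin_left, Rmax_right in Hr by lra.
      assert (dW r <= 0); [|nra].
      destruct (HB r ltac:(lra)) as (B1 & B2 & B3 & B4).
      destruct (H1 _ _ _ _ B1 B2 B3 B4) as [_ K1]. destruct (H2 _ _ _ _ B1 B2 B3 B4) as [_ K2].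
      unfold dW. assert (He := exp_pos (- L * r)).
      set (dx := x r - x' r) in *. set (dy := y r - y' r) in *.
      set (f1 := F1 (x r) (y r) - F1 (x' r) (y' r)) in *. set (f2 := F2 (x r) (y r) - F2 (x' r) (y' r)) in *.
      assert (Hkey : 2 * dx * f1 + 2 * dy * f2 <= L * (dx ^ 2 + dy ^ 2)).
      { assert (T : forall w f M', M' <= M -> Rabs f <= M' * (Rabs dx + Rabs dy) -> w * f <= Rabs w * (M * (Rabs dx + Rabs dy))).
        { intros w f M' HM' Hf. eapply Rle_trans; [apply Rle_abs|]. rewrite Rabs_mult.
          apply Rmult_le_compat_l; [apply Rabs_pos|]. eapply Rle_trans; [apply Hf|].
          apply Rmult_le_compat_r; auto. generalize (Rabs_pos dx) (Rabs_pos dy); lra. }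
        assert (T1 := T dx f1 M1 ltac:(unfold M; lra) K1). assert (T2 := T dy f2 M2 ltac:(unfold M; lra) K2).
        rewrite <- (pow2_abs dx), <- (pow2_abs dy).
        set (u := Rabs dx) in *. set (v := Rabs dy) in *. assert (0 <= M) by (unfold M; lra).
        assert (T3 : M * ((u + v) * (u + v)) <= M * (2 * (u ^ 2 + v ^ 2))).
        { apply Rmult_le_compat_l; auto. assert (Hsq := pow2_ge_0 (u - v)). lra. }
        unfold L. nra. }
      replace (- L * exp (- L * r) * (dx ^ 2 + dy ^ 2) + exp (- L * r) * (2 * dx * f1 + 2 * dy * f2))
        with (exp (- L * r) * ((2 * dx * f1 + 2 * dy * f2) - L * (dx ^ 2 + dy ^ 2))) by ring.
      nra. }
  assert (HW0 : W 0 = 0) by (unfold W; rewrite Ex, Ey; ring).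
  assert (He := exp_pos (- L * t)). rewrite HW0 in HW. unfold W in HW.
  assert (Q1 := pow2_ge_0 (x t - x' t)). assert (Q2 := pow2_ge_0 (y t - y' t)).
  assert (Hsum : (x t - x' t) ^ 2 + (y t - y' t) ^ 2 <= 0).
  { apply Rmult_le_reg_l with (exp (- L * t)); auto. lra. }
  split; nra.
Qed.

Lemma continuity_shift (f : R -> R) c : continuity f -> continuity (fun t => f (c + t)).
Proof.
  intros Hf. apply (continuity_comp (fun t => c + t) f); auto.
  apply is_derive_continuity with (fun _ => 1). intros t. auto_derive; auto.
Qed.

Lemma is_derive_shift (f : R -> R) c t d : is_derive f (c + t) d -> is_derive (fun t => f (c + t)) t d.
Proof.
  intros Hf. rewrite <- (Rmult_1_l d). apply (is_derive_comp f (fun s => c + s)); auto. auto_derive; auto.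
Qed.

(** [exp ((k + i) s) (- x1 + i)]: for [k = eps * al], the orbit of the focus that starts on the line
    at abscissa [- x1]. *)
Definition spiral (k x1 : R) (s : R) : C :=
  (exp (k * s) * (- x1 * cos s - sin s), exp (k * s) * (- x1 * sin s + cos s)).

Lemma spiral_derive al eps x1 s :
  follows (gre al eps) (gim al eps) (spiral (eps * al) x1) s.
Proof.
  unfold follows, spiral, gre, gim, Re, Im; simpl. split; auto_derive; auto; ring.
Qed.

Lemma spiral_start k x1 : spiral k x1 0 = (- x1, 1).
Proof.
  unfold spiral. rewrite Rmult_0_r, exp_0, cos_0, sin_0. apply injective_projections; simpl; ring.
Qed.

Lemma spiral_continuity al eps x1 :
  continuity (fun s => Re (spiral (eps * al) x1 s)) /\ continuity (fun s => Im (spiral (eps * al) x1 s)).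
Proof.
  split; [apply is_derive_continuity with (1 := fun s => proj1 (spiral_derive al eps x1 s))
         |apply is_derive_continuity with (1 := fun s => proj2 (spiral_derive al eps x1 s))].
Qed.

Lemma linear_focus_flow al eps z s t : s <= t -> continuity (fun r => Re (z r)) -> continuity (fun r => Im (z r)) ->
  (forall r, s < r < t -> follows (gre al eps) (gim al eps) z r) -> Im (z s) = 1 ->
  z t = spiral (eps * al) (- Re (z s)) (t - s).
Proof.
  intros Hst Hcx Hcy Hd Hys. set (w := spiral (eps * al) (- Re (z s))).
  destruct (spiral_continuity al eps (- Re (z s))) as [Hwx Hwy]. fold w in Hwx, Hwy.
  assert (Hzx := continuity_shift _ s Hcx). assert (Hzy := continuity_shift _ s Hcy). cbv beta in Hzx, Hzy.
  destruct (continuity_bounded _ 0 (t - s) Hwx) as [B1 [P1 H1]]. destruct (continuity_bounded _ 0 (t - s) Hwy) as [B2 [P2 H2]].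
  destruct (continuity_bounded _ 0 (t - s) Hzx) as [B3 [P3 H3]]. destruct (continuity_bounded _ 0 (t - s) Hzy) as [B4 [P4 H4]].
  assert (W0 : w 0 = (Re (z s), 1)) by (unfold w; rewrite spiral_start, Ropp_involutive; reflexivity).
  destruct (gronwall_unique (gre al eps) (gim al eps) (B1 + B2 + B3 + B4) (t - s) (fun u => Re (z (s + u))) (fun u => Im (z (s + u)))
    (fun u => Re (w u)) (fun u => Im (w u))) with (t := t - s) as [E1 E2]; auto using box_bounded_gre, box_bounded_gim; try lra.
  - now rewrite Rplus_0_r, W0.
  - now rewrite Rplus_0_r, W0, Hys.
  - intros u Hu. specialize (H1 u Hu). specialize (H2 u Hu). specialize (H3 u Hu). specialize (H4 u Hu). lra.
  - intros u Hu. destruct (Hd (s + u) ltac:(lra)) as [D1 D2]. destruct (spiral_derive al eps (- Re (z s)) u) as [D3 D4].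
    split; [now apply (is_derive_shift (fun r => Re (z r)))|]. split; [now apply (is_derive_shift (fun r => Im (z r)))|].
    split; [exact D3|exact D4].
  - replace (s + (t - s)) with t in E1, E2 by ring. now apply injective_projections.
Qed.

(** The logarithm of the modulus of [s + i]. At eps = 0 the line potential is its opposite. *)
Definition half_ln (s : R) : R := / 2 * ln (1 + s ^ 2).

Lemma half_ln_derive s : is_derive half_ln s (s / (1 + s ^ 2)).
Proof.
  unfold half_ln. assert (0 < 1 + s ^ 2) by nra. auto_derive; [lra|field; lra].
Qed.

(** Write [d = sg + atan x1 + atan x2]. The two coordinate equations say that [sin d = 0] and
    [cos d > 0]; as [d] lies strictly between 0 and [3 * PI], it can only be [2 * PI]. *)
Lemma spiral_angle x1 x2 rho sg : 0 < rho -> 0 < x1 -> 0 < x2 -> 0 < sg < 2 * PI ->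
  x2 = rho * (- x1 * cos sg - sin sg) -> 1 = rho * (- x1 * sin sg + cos sg) ->
  sg = 2 * PI - atan x2 - atan x1.
Proof.
  intros Hr H1 H2 Hsg E1 E2.
  assert (B1 := atan_bound x1). assert (B2 := atan_bound x2).
  assert (P1 : 0 < atan x1) by (rewrite <- atan_0; now apply atan_increasing).
  assert (P2 : 0 < atan x2) by (rewrite <- atan_0; now apply atan_increasing).
  assert (T1 := tan_atan x1). assert (T2 := tan_atan x2). unfold tan in T1, T2.
  set (A1 := atan x1) in *. set (A2 := atan x2) in *.
  assert (C1 : 0 < cos A1) by (apply cos_gt_0; lra).
  assert (C2 : 0 < cos A2) by (apply cos_gt_0; lra).
  assert (S1 : sin A1 = x1 * cos A1) by (rewrite <- T1 at 1; field; lra).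
  assert (S2 : sin A2 = x2 * cos A2) by (rewrite <- T2 at 1; field; lra).
  set (d := sg + A1 + A2).
  assert (Hsin : sin d = 0).
  { unfold d. rewrite sin_plus, sin_plus, cos_plus, S1, S2.
    replace ((sin sg * cos A1 + cos sg * (x1 * cos A1)) * cos A2 +
       (cos sg * cos A1 - sin sg * (x1 * cos A1)) * (x2 * cos A2))
      with (cos A1 * cos A2 * ((sin sg + x1 * cos sg) + x2 * (cos sg - x1 * sin sg))) by ring.
    assert (F : (sin sg + x1 * cos sg) + x2 * (cos sg - x1 * sin sg) = 0); [|rewrite F; ring].
    apply Rmult_eq_reg_l with rho; [|lra]. nra. }
  assert (Hcos : 0 < cos d).
  { unfold d. rewrite cos_plus, sin_plus, cos_plus, S1, S2.
    replace ((cos sg * cos A1 - sin sg * (x1 * cos A1)) * cos A2 -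
       (sin sg * cos A1 + cos sg * (x1 * cos A1)) * (x2 * cos A2))
      with (cos A1 * cos A2 * ((cos sg - x1 * sin sg) - x2 * (sin sg + x1 * cos sg))) by ring.
    apply Rmult_lt_0_compat; [nra|].
    apply Rmult_lt_reg_l with rho; auto. rewrite Rmult_0_r. nra. }
  destruct (sin_eq_0_0 d Hsin) as [k Hk].
  assert (HP := PI_RGT_0).
  assert (0 < d < 3 * PI) by (unfold d; lra).
  assert (0 < k < 3)%Z as Hk3.
  { split; apply lt_IZR; apply Rmult_lt_reg_r with PI; simpl; lra. }
  assert (k = 1 \/ k = 2)%Z as [->| ->] by lia.
  - rewrite Hk in Hcos. replace (1 * PI) with PI in Hcos by ring. rewrite cos_PI in Hcos. lra.
  - unfold d in Hk. simpl in Hk. lra.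
Qed.

(** In polar coordinates the logarithm of the modulus grows at the rate [eps * al], and the flight
    time is the angle given by [spiral_angle]. *)
Lemma spiral_return al eps z s t : s < t < s + 2 * PI ->
  continuity (fun r => Re (z r)) -> continuity (fun r => Im (z r)) ->
  (forall r, s < r < t -> follows (gre al eps) (gim al eps) z r) ->
  Im (z s) = 1 -> Im (z t) = 1 -> Re (z s) < 0 -> 0 < Re (z t) ->
  half_ln (Re (z t)) - half_ln (- Re (z s)) = eps * al * (2 * PI - atan (Re (z t)) - atan (- Re (z s))).
Proof.
  intros Hst Hcx Hcy Hd Hys Hyt Hxs Hxt.
  assert (E := linear_focus_flow al eps z s t ltac:(lra) Hcx Hcy Hd Hys).
  assert (E1 := f_equal Re E). assert (E2 := f_equal Im E). unfold spiral in E1, E2; cbn [Re Im fst snd] in E1, E2.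
  rewrite Hyt in E2. rewrite Ropp_involutive in E1, E2.
  assert (Hr := exp_pos (eps * al * (t - s))).
  rewrite <- (spiral_angle (- Re (z s)) (Re (z t)) (exp (eps * al * (t - s))) (t - s)); auto; try lra.
  - set (rho := exp (eps * al * (t - s))) in *.
    assert (Hm : 1 + Re (z t) ^ 2 = rho * rho * (1 + (- Re (z s)) ^ 2)).
    { assert (Hsc := sin2_cos2 (t - s)). unfold Rsqr in Hsc.
      set (c := cos (t - s)) in *. set (n := sin (t - s)) in *. set (u := Re (z s)) in *.
      transitivity ((rho * (u * c - n)) * (rho * (u * c - n)) + (rho * (u * n + c)) * (rho * (u * n + c))).
      - rewrite <- E1, <- E2. ring.
      - transitivity (rho * rho * ((n * n + c * c) * (1 + u ^ 2))); [ring|rewrite Hsc; ring]. }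
    unfold half_ln. rewrite Hm, !ln_mult; auto; try nra.
    unfold rho. rewrite !ln_exp. field.
Qed.

(** * The displacement equations *)

(** Only the values on [a, b] are controlled; composing with [clamp] gives a function continuous on
    the whole line without changing them. *)
Lemma Lipschitz_IVT (f : R -> R) (a b C : R) : a <= b ->
  (forall x y, a <= x <= y -> y <= b -> Rabs (f y - f x) <= C * (y - x)) ->
  f a < 0 < f b -> exists c, a <= c <= b /\ f c = 0.
Proof.
  intros Hab HL Hf.
  set (cl := clamp a b).
  assert (Hcont : continuity (fun x => f (cl x))).
  { intros x e He. assert (0 < Rabs C + 1) by (generalize (Rabs_pos C); lra).
    exists (e / (Rabs C + 1)). split; [now apply Rdiv_lt_0_compat|].
    intros y [_ Hy]. simpl in *. unfold Rdist in *.
    assert (Hm : forall u v, cl u <= cl v -> Rabs (f (cl v) - f (cl u)) <= (Rabs C + 1) * Rabs (cl v - cl u)).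
    { intros u v Huv. rewrite (Rabs_pos_eq (cl v - cl u)) by lra.
      generalize (clamp_in a b u Hab) (clamp_in a b v Hab). fold cl. intros.
      eapply Rle_trans; [apply HL; lra|]. apply Rmult_le_compat_r; [lra|]. generalize (Rle_abs C); lra. }
    apply Rle_lt_trans with ((Rabs C + 1) * Rabs (y - x)).
    - apply Rle_trans with ((Rabs C + 1) * Rabs (cl y - cl x)).
      + destruct (Rle_lt_dec (cl x) (cl y)); [now apply Hm|].
        rewrite (Rabs_minus_sym (f (cl y))), (Rabs_minus_sym (cl y)). apply Hm; lra.
      + apply Rmult_le_compat_l; [lra|]. now apply clamp_Lipschitz.
    - replace e with ((Rabs C + 1) * (e / (Rabs C + 1))) by (field; lra). now apply Rmult_lt_compat_l. }
  assert (Hca : cl a = a) by (apply clamp_id; lra).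
  assert (Hcb : cl b = b) by (apply clamp_id; lra).
  destruct (IVT_gen (fun x => f (cl x)) a b 0 Hcont) as [c [_ Hc]].
  - rewrite Hca, Hcb, Rmin_left, Rmax_right; lra.
  - exists (cl c). split; auto. now apply clamp_in.
Qed.

Definition slope_between (f : R -> R) (lo hi m W : R) : Prop :=
  forall x y, lo <= x <= y -> y <= hi -> m * (y - x) <= f y - f x <= W * (y - x).

Lemma slope_of_derive (f df : R -> R) (m W lo hi : R) :
  (forall t, lo <= t <= hi -> is_derive f t (df t)) ->
  (forall t, lo <= t <= hi -> m <= df t <= W) -> slope_between f lo hi m W.
Proof.
  intros Hd HL s t Hs Ht.
  destruct (MVT_gen f s t df) as [c [Hc He]].
  - intros c. rewrite Rmin_left, Rmax_right by lra. intros Hc. apply Hd; lra.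
  - intros c. rewrite Rmin_left, Rmax_right by lra. intros Hc.
    apply derivable_continuous_pt. exists (df c). apply is_derive_Reals, Hd; lra.
  - rewrite Rmin_left, Rmax_right in Hc by lra. rewrite He.
    split; apply Rmult_le_compat_r; try lra; apply HL; lra.
Qed.

Lemma slope_lt f lo hi m W x y : slope_between f lo hi m W -> 0 < m -> lo <= x < y -> y <= hi -> f x < f y.
Proof.
  intros H Hm Hx Hy. destruct (H x y ltac:(lra) Hy) as [K _].
  assert (0 < m * (y - x)) by (apply Rmult_lt_0_compat; lra). lra.
Qed.

(** On the curve [A1 x = B1 x'] both variables grow together, so [A x + B x'] is strictly increasing
    along it and takes the value [c] at most once. The sizes of the slopes are not compared: in the
    application [A] and [B] have slopes of order eps^2, [A1] and [B1] of order 1. *)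
Lemma coupled_equations_unique (A B A1 B1 : R -> R) (lo hi c w v W x x' y y' : R) : 0 < w -> 0 < v ->
  slope_between A1 lo hi w W -> slope_between B1 lo hi w W ->
  slope_between A lo hi v W -> slope_between B lo hi v W ->
  lo <= x <= hi -> lo <= x' <= hi -> lo <= y <= hi -> lo <= y' <= hi ->
  A1 x = B1 x' -> A x + B x' = c -> A1 y = B1 y' -> A y + B y' = c -> x = y /\ x' = y'.
Proof.
  intros Hw Hv SA1 SB1 SA SB Hx Hx' Hy Hy' E1 E2 E3 E4.
  assert (HB : forall u u', lo <= u <= hi -> lo <= u' <= hi -> B1 u <= B1 u' -> B u <= B u').
  { intros u u' Hu Hu' H. destruct (Rtotal_order u u') as [Hl|[->|Hl]]; [|lra|].
    - left. apply (slope_lt B lo hi v W); auto; lra.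
    - assert (K := slope_lt B1 lo hi w W u' u SB1 Hw ltac:(lra) ltac:(lra)). lra. }
  assert (Exy : x = y).
  { destruct (Rtotal_order x y) as [H|[H|H]]; auto; exfalso.
    - assert (K1 := slope_lt A1 lo hi w W x y SA1 Hw ltac:(lra) ltac:(lra)).
      assert (K2 := slope_lt A lo hi v W x y SA Hv ltac:(lra) ltac:(lra)).
      assert (K3 := HB x' y' Hx' Hy' ltac:(lra)). lra.
    - assert (K1 := slope_lt A1 lo hi w W y x SA1 Hw ltac:(lra) ltac:(lra)).
      assert (K2 := slope_lt A lo hi v W y x SA Hv ltac:(lra) ltac:(lra)).
      assert (K3 := HB y' x' Hy' Hx' ltac:(lra)). lra. }
  split; auto. subst y.
  destruct (Rtotal_order x' y') as [H|[H|H]]; auto; exfalso.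
  - assert (K := slope_lt B1 lo hi w W x' y' SB1 Hw ltac:(lra) ltac:(lra)). lra.
  - assert (K := slope_lt B1 lo hi w W y' x' SB1 Hw ltac:(lra) ltac:(lra)). lra.
Qed.

(** The first equation is solved for [x' = chi x], a monotone function with Lipschitz constant
    [W / w], and the intermediate value theorem is applied to [A x + B (chi x) - c]. The hypotheses
    place [chi xl] and [chi xr] on either side of [x0], so monotonicity of [B] reduces the sign
    conditions to the value [B x0]. *)
Lemma coupled_equations_solution (A B A1 B1 : R -> R) (lo xl x0 xr hi c w v W : R) :
  lo <= xl <= x0 -> x0 <= xr <= hi -> lo < hi -> 0 < w -> 0 < v ->
  slope_between A1 lo hi w W -> slope_between B1 lo hi w W ->
  slope_between A lo hi v W -> slope_between B lo hi v W ->
  B1 lo < A1 xl -> A1 xl <= B1 x0 -> B1 x0 <= A1 xr -> A1 xr < B1 hi ->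
  0 < A xr + B x0 - c -> A xl + B x0 - c < 0 ->
  exists x x', xl <= x <= xr /\ lo <= x' <= hi /\ A1 x = B1 x' /\ A x + B x' = c.
Proof.
  intros Hl Hr Hlh Hw Hv SA1 SB1 SA SB E1 E2 E3 E4 E5 E6.
  assert (HW : 0 <= W) by (destruct (SB1 lo hi ltac:(lra) ltac:(lra)); nra).
  assert (Habs : forall f m, 0 < m -> slope_between f lo hi m W -> forall x y, lo <= x <= y -> y <= hi ->
    f x <= f y /\ Rabs (f y - f x) <= W * (y - x)).
  { intros f m Hm Hf x y Hx Hy. destruct (Hf x y Hx Hy).
    assert (0 <= m * (y - x)) by (apply Rmult_le_pos; lra). rewrite Rabs_pos_eq; lra. }
  assert (Hex : forall x, xl <= x <= xr -> exists x', lo <= x' <= hi /\ B1 x' = A1 x).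
  { intros x Hx. destruct (Habs A1 w Hw SA1 xl x); try lra. destruct (Habs A1 w Hw SA1 x xr); try lra.
    destruct (Lipschitz_IVT (fun s => B1 s - A1 x) lo hi W) as [x' [Hx' He]]; try lra.
    - intros s t Hs Ht. replace (B1 t - A1 x - (B1 s - A1 x)) with (B1 t - B1 s) by ring. now apply (Habs B1 w).
    - exists x'. split; auto. lra. }
  set (chi := fun x => epsilon (inhabits 0) (fun x' => lo <= x' <= hi /\ B1 x' = A1 x)).
  assert (Hchi : forall x, xl <= x <= xr -> lo <= chi x <= hi /\ B1 (chi x) = A1 x).
  { intros x Hx. apply (epsilon_spec (inhabits 0) (fun x' => lo <= x' <= hi /\ B1 x' = A1 x)). auto. }
  assert (Hmon : forall x y, lo <= x <= hi -> lo <= y <= hi -> B1 x <= B1 y -> x <= y).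
  { intros x y Hx Hy H. apply Rnot_lt_le. intros Hlt.
    assert (K := slope_lt B1 lo hi w W y x SB1 Hw ltac:(lra) ltac:(lra)). lra. }
  assert (Lchi : forall x y, xl <= x <= y -> y <= xr -> chi x <= chi y /\ chi y - chi x <= W / w * (y - x)).
  { intros x y Hx Hy. destruct (Hchi x) as [C1 C2]; [lra|]. destruct (Hchi y) as [C3 C4]; [lra|].
    destruct (SA1 x y) as [_ K2]; try lra. destruct (Habs A1 w Hw SA1 x y) as [K0 _]; try lra.
    assert (K3 : chi x <= chi y) by (apply Hmon; auto; lra). split; auto.
    destruct (SB1 (chi x) (chi y)) as [K1 _]; try lra. rewrite C2, C4 in K1.
    apply Rmult_le_reg_l with w; auto.
    replace (w * (W / w * (y - x))) with (W * (y - x)) by (field; lra). lra. }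
  destruct (Hchi xr) as [C1 C2]; [lra|]. destruct (Hchi xl) as [C3 C4]; [lra|].
  assert (F1 : B x0 <= B (chi xr)) by (apply (Habs B v Hv SB); [split; [lra|]; apply Hmon; lra|lra]).
  assert (F2 : B (chi xl) <= B x0) by (apply (Habs B v Hv SB); [split; [lra|]; apply Hmon; lra|lra]).
  destruct (Lipschitz_IVT (fun x => A x + B (chi x) - c) xl xr (W + W * (W / w))) as [x [Hx He]]; try lra.
  - intros x y Hx Hy.
    replace (A y + B (chi y) - c - (A x + B (chi x) - c)) with ((A y - A x) + (B (chi y) - B (chi x))) by ring.
    eapply Rle_trans; [apply Rabs_triang|].
    destruct (Lchi x y Hx Hy) as [K1 K2].
    destruct (Hchi x) as [K3 _]; [lra|]. destruct (Hchi y) as [K4 _]; [lra|].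
    destruct (Habs A v Hv SA x y) as [_ K5]; try lra. destruct (Habs B v Hv SB (chi x) (chi y)) as [_ K6]; try lra.
    assert (W * (chi y - chi x) <= W * (W / w * (y - x))) by (apply Rmult_le_compat_l; auto). lra.
  - destruct (Hchi x Hx) as [K1 K2]. exists x, (chi x). repeat split; lra.
Qed.

Lemma pos_below (a b : R) : 0 < a -> 0 < b -> exists m, 0 < m /\ m <= a /\ m <= b.
Proof.
  intros Ha Hb. exists (Rmin a b). split; [now apply Rmin_glb_lt|split; [apply Rmin_l|apply Rmin_r]].
Qed.

Lemma pos_below4 (a b c d : R) : 0 < a -> 0 < b -> 0 < c -> 0 < d ->
  exists m, 0 < m /\ m <= a /\ m <= b /\ m <= c /\ m <= d.
Proof.
  intros Ha Hb Hc Hd. destruct (pos_below a b Ha Hb) as (u & Hu). destruct (pos_below c d Hc Hd) as (v & Hv).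
  destruct (pos_below u v) as (m & Hm); try lra. exists m. lra.
Qed.

Lemma Rabs_mult_small e eps M b : 0 < M -> 0 < b -> e <= b / M -> Rabs eps < e -> Rabs eps * M < b.
Proof.
  intros HM Hb He Heps. replace b with (b / M * M) by (field; lra). apply Rmult_lt_compat_r; lra.
Qed.

(** * Expansion in eps and the return equations *)

Section Displacement.

Variables al a1 b0 b2 b4 : R.

Notation hr := (hre a1 b2 b4).
Notation hi := (him a1 b0 b2 b4).
Notation rim := (recip_im a1 b0 b2 b4).
Notation lpot := (line_potential a1 b0 b2 b4).

(* Im (h(z)/z^2) at z = s + i. *)
Definition kap (s : R) : R := (hi s 1 * (s ^ 2 - 1) - 2 * s * hr s 1) / (1 + s ^ 2) ^ 2.
Definition kap_int (s : R) : R := - b0 * (s / (1 + s ^ 2)) - a1 * atan s + b2 * s + b4 * ((s ^ 3 - 3 * s) / 3).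

Lemma kap_int_derive s : is_derive kap_int s (kap s).
Proof.
  unfold kap_int, kap. assert (0 < 1 + s ^ 2) by nra.
  apply (is_derive_ext (fun s => (- b0 * (s / (1 + s ^ 2)) + b2 * s + b4 * ((s ^ 3 - 3 * s) / 3)) - a1 * atan s)).
  { intros t. match goal with |- ?u = ?v => change (@eq R u v) end. unfold Rdiv. ring. }
  replace ((hi s 1 * (s ^ 2 - 1) - 2 * s * hr s 1) / (1 + s ^ 2) ^ 2) with
    ((- b0 * ((1 - s ^ 2) / (1 + s ^ 2) ^ 2) + b2 + b4 * (s ^ 2 - 1)) - a1 * / (1 + s ^ 2)).
  - apply (is_derive_minus (fun s => - b0 * (s / (1 + s ^ 2)) + b2 * s + b4 * ((s ^ 3 - 3 * s) / 3))
      (fun s => a1 * atan s)).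
    + auto_derive; [lra|field; lra].
    + apply is_derive_scal. apply is_derive_Reals.
      apply derivable_pt_lim_atan.
  - unfold him, hre. field. lra.
Qed.

(** The upper arc joins x to about -x, so only the odd part of a primitive of [kap] matters; the
    terms kept in h are ones that contribute an even function to [kap]. *)
Lemma kap_int_odd s : kap_int (- s) = - kap_int s.
Proof. unfold kap_int. rewrite atan_opp. assert (0 < 1 + s ^ 2) by nra. field. nra. Qed.

Lemma kap_even s : kap (- s) = kap s.
Proof. unfold kap, him, hre. assert (0 < 1 + s ^ 2) by nra. field. nra. Qed.

(** Half the derivative of the averaged function D of the overview. *)
Definition phi (s : R) : R := kap s + al / (1 + s ^ 2).

Lemma phi_continuous s : continuity_pt phi s.
Proof.
  unfold phi. assert (0 < 1 + s ^ 2) by nra.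
  apply continuity_pt_filterlim.
  apply (ex_derive_continuous (fun s => kap s + al / (1 + s ^ 2))).
  unfold kap, him, hre. auto_derive. repeat split; auto; nra.
Qed.

(** The expansion 1/(iz + eps h) = 1/(iz) + eps h/z^2 + O(eps^2), whose imaginary part at [s + i] is
    [- s / (1 + s ^ 2) + eps * kap s] up to a uniform quadratic remainder. *)
Lemma recip_bounds B : 1 < B -> exists M e1, 0 < M /\ 0 < e1 /\ forall eps, Rabs eps < e1 ->
  (forall x y, in_rect B x y -> den a1 b0 b2 b4 eps x y <> 0) /\
  (forall s, - B < s < B -> Rabs (kap s) <= M /\
     Rabs (rim eps s 1 + s / (1 + s ^ 2) - eps * kap s) <= M * eps ^ 2).
Proof.
  intros HB1.
  destruct (box_bounded_hre a1 b2 b4 B) as [M1 [HM1 H1]].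
  destruct (box_bounded_him a1 b0 b2 b4 B) as [M2 [HM2 H2]].
  set (num := fun x y : R => hi x y * (x ^ 2 - 1) - 2 * x * hr x y).
  destruct (fun H => (H : box_bounded num) B) as [M3 [HM3 H3]].
  { unfold num, him, hre. box_bounded. }
  set (N2 := fun x y : R => Rabs x * (1 + x ^ 2)).
  set (M4 := B * (1 + B ^ 2) * (M1 ^ 2 + M2 ^ 2) + M3 * (2 * (B * M2 + M1) + (M1 ^ 2 + M2 ^ 2))).
  assert (HM4 : 0 <= M4).
  { unfold M4. assert (0 <= M1 ^ 2 + M2 ^ 2) by nra. assert (0 <= B * M2 + M1) by nra. assert (0 <= B * (1 + B ^ 2)) by nra.
    assert (0 <= B * (1 + B ^ 2) * (M1 ^ 2 + M2 ^ 2)) by now apply Rmult_le_pos. nra. }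
  (* With this bound on eps the perturbation of [- y] is at most 1/4. Since y > 1/2, the real part
     of f is then at most -1/4, whence [den >= 1 / 16] and the factor 16. *)
  exists (M3 + 16 * M4 + 1), (Rmin 1 (/ (4 * (M1 + 1)))).
  split; [lra|]. split.
  { apply Rmin_glb_lt; [lra|]. apply Rinv_0_lt_compat; lra. }
  intros eps Heps.
  assert (He1 := Rlt_le_trans _ _ _ Heps (Rmin_l _ _)). assert (He2 := Rlt_le_trans _ _ _ Heps (Rmin_r _ _)).
  assert (He3 : Rabs eps * M1 <= 1 / 4).
  { assert (0 < 4 * (M1 + 1)) by lra.
    apply Rle_trans with (/ (4 * (M1 + 1)) * M1); [apply Rmult_le_compat_r; lra|].
    apply Rmult_le_reg_l with (4 * (M1 + 1)); auto. rewrite <- Rmult_assoc, Rinv_r; lra. }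
  assert (Hden : forall x y, in_rect B x y -> 1 / 16 <= den a1 b0 b2 b4 eps x y).
  { intros x y [Hx Hy]. unfold den.
    destruct (H1 x y x y) as [K _]; try (apply Rabs_le; lra).
    assert (K1 : Rabs (eps * hr x y) <= 1 / 4).
    { rewrite Rabs_mult. eapply Rle_trans; [|apply He3]. apply Rmult_le_compat_l; auto. apply Rabs_pos. }
    apply Rabs_le_between in K1.
    assert (fre a1 b2 b4 eps x y <= - (1 / 4)) by (unfold fre; lra). nra. }
  split.
  { intros x y Hxy. specialize (Hden x y Hxy). lra. }
  intros s Hs. assert (Hs1 : 0 < 1 + s ^ 2) by nra.
  destruct (H1 s 1 s 1) as [K1 _]; try (apply Rabs_le; lra).
  destruct (H2 s 1 s 1) as [K2 _]; try (apply Rabs_le; lra).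
  destruct (H3 s 1 s 1) as [K3 _]; try (apply Rabs_le; lra).
  assert (Hq : 1 <= (1 + s ^ 2) ^ 2) by nra.
  split.
  - unfold kap. fold (num s 1). unfold Rdiv. rewrite Rabs_mult, (Rabs_pos_eq (/ _)).
    + apply Rle_trans with (Rabs (num s 1) * 1); [|lra]. apply Rmult_le_compat_l; [apply Rabs_pos|].
      rewrite <- Rinv_1. apply Rinv_le_contravar; lra.
    + left; apply Rinv_0_lt_compat; lra.
  - specialize (Hden s 1 ltac:(split; lra)).
    set (dn := den a1 b0 b2 b4 eps s 1) in *.
    (* An exact formula for the remainder: over the common denominator the terms of order 0 and 1 in
       eps cancel. *)
    assert (HH : rim eps s 1 + s / (1 + s ^ 2) - eps * kap s =
      eps ^ 2 * ((s * (1 + s ^ 2) * (hr s 1 ^ 2 + hi s 1 ^ 2)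
        - num s 1 * (2 * (s * hi s 1 - hr s 1) + eps * (hr s 1 ^ 2 + hi s 1 ^ 2))) * / (dn * (1 + s ^ 2) ^ 2))).
    { assert (Hdn : dn = 1 + s ^ 2 + 2 * eps * (s * hi s 1 - hr s 1) + eps ^ 2 * (hr s 1 ^ 2 + hi s 1 ^ 2)).
      { unfold dn, den, fre, fim. ring. }
      unfold recip_im. fold dn. unfold kap. fold (num s 1).
      replace (fim a1 b0 b2 b4 eps s 1) with (s + eps * hi s 1) by reflexivity.
      apply Rmult_eq_reg_r with (dn * (1 + s ^ 2) ^ 2); [|nra].
      transitivity (- (s + eps * hi s 1) * (1 + s ^ 2) ^ 2 + s * (1 + s ^ 2) * dn - eps * num s 1 * dn);
        [field; lra|].
      transitivity (eps ^ 2 * (s * (1 + s ^ 2) * (hr s 1 ^ 2 + hi s 1 ^ 2)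
        - num s 1 * (2 * (s * hi s 1 - hr s 1) + eps * (hr s 1 ^ 2 + hi s 1 ^ 2)))); [|field; lra].
      rewrite Hdn. unfold num. ring. }
    rewrite HH. rewrite Rabs_mult, (Rabs_pos_eq (eps ^ 2)) by nra. rewrite Rmult_comm.
    apply Rmult_le_compat_r; [nra|].
    rewrite Rabs_mult, (Rabs_pos_eq (/ _)) by (left; apply Rinv_0_lt_compat; nra).
    assert (Hinv : / (dn * (1 + s ^ 2) ^ 2) <= 16).
    { replace 16 with (/ (1 / 16)) by field. apply Rinv_le_contravar; nra. }
    assert (Habs : Rabs (s * (1 + s ^ 2) * (hr s 1 ^ 2 + hi s 1 ^ 2)
        - num s 1 * (2 * (s * hi s 1 - hr s 1) + eps * (hr s 1 ^ 2 + hi s 1 ^ 2))) <= M4).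
    { assert (Q : Rabs (hr s 1 ^ 2 + hi s 1 ^ 2) <= M1 ^ 2 + M2 ^ 2).
      { rewrite Rabs_pos_eq by nra. rewrite <- (pow2_abs (hr s 1)), <- (pow2_abs (hi s 1)).
        generalize (Rabs_pos (hr s 1)) (Rabs_pos (hi s 1)). nra. }
      set (qq := hr s 1 ^ 2 + hi s 1 ^ 2) in *.
      assert (S1 : Rabs s <= B) by (apply Rabs_le; lra).
      assert (S2 : Rabs (1 + s ^ 2) <= 1 + B ^ 2).
      { rewrite Rabs_pos_eq by lra. rewrite <- (pow2_abs s). generalize (Rabs_pos s). nra. }
      unfold Rminus at 1. eapply Rle_trans; [apply Rabs_triang|]. rewrite Rabs_Ropp. unfold M4.
      apply Rplus_le_compat.
      - rewrite !Rabs_mult. apply Rmult_le_compat; auto using Rabs_pos.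
        + apply Rmult_le_pos; apply Rabs_pos.
        + apply Rmult_le_compat; auto using Rabs_pos.
      - rewrite Rabs_mult. apply Rmult_le_compat; auto using Rabs_pos.
        eapply Rle_trans; [apply Rabs_triang|]. apply Rplus_le_compat.
        + rewrite Rabs_mult, (Rabs_pos_eq 2) by lra. apply Rmult_le_compat_l; [lra|].
          unfold Rminus. eapply Rle_trans; [apply Rabs_triang|]. rewrite Rabs_Ropp, Rabs_mult.
          apply Rplus_le_compat; auto. apply Rmult_le_compat; auto using Rabs_pos.
        + rewrite Rabs_mult. rewrite <- (Rmult_1_l (M1 ^ 2 + M2 ^ 2)).
          apply Rmult_le_compat; auto using Rabs_pos. lra. }
    apply Rle_trans with (M4 * 16); [|lra].
    apply Rmult_le_compat; auto using Rabs_pos. left; apply Rinv_0_lt_compat; nra.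
Qed.


(** The first equation joins x to -x' above the line by the conserved potential; the second joins
    -x' back to x along the focus, as in [spiral_return]. *)
Definition return_equations (eps x x' : R) : Prop :=
  lpot eps x = lpot eps (- x') /\
  half_ln x - half_ln x' = eps * al * (2 * PI - atan x - atan x').

Lemma half_ln_even s : half_ln (- s) = half_ln s.
Proof. unfold half_ln. now replace ((- s) ^ 2) with (s ^ 2) by ring. Qed.

Lemma atan_derive x : is_derive atan x (/ (1 + x ^ 2)).
Proof. apply is_derive_Reals, derivable_pt_lim_atan. Qed.

(** One equation is replaced by the sum of both, which is of order eps and has nonzero slope
    [eps * phi x0] to first order; the coupled equations lemmas then apply. The radius [rho] of
    uniqueness is fixed before the precision [tau], so the solution tends to [(x0, x0)] as eps tends
    to 0. The strict inequalities in the conclusion serve to locate end points of arcs and to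
    compare laps. *)
Lemma displacement x0 : 0 < x0 -> 2 * kap_int x0 + 2 * al * atan x0 - 2 * PI * al = 0 -> phi x0 <> 0 ->
  exists rho, 0 < rho <= x0 / 2 /\ rho <= 1 /\ forall tau, 0 < tau <= rho -> exists e0, 0 < e0 /\
  forall eps, 0 < Rabs eps < e0 ->
  (forall x y, in_rect (x0 + 3) x y -> den a1 b0 b2 b4 eps x y <> 0) /\
  (forall x y, x0 - rho <= x < y -> y <= x0 + rho ->
     lpot eps y < lpot eps x /\ lpot eps (- y) < lpot eps (- x) /\
     half_ln x + eps * al * atan x < half_ln y + eps * al * atan y /\
     half_ln x - eps * al * atan x < half_ln y - eps * al * atan y) /\
  (forall x x' y y', Rabs (x - x0) <= rho -> Rabs (x' - x0) <= rho -> Rabs (y - x0) <= rho ->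
     Rabs (y' - x0) <= rho -> return_equations eps x x' -> return_equations eps y y' -> x = y /\ x' = y') /\
  (exists x x', Rabs (x - x0) <= tau /\ Rabs (x' - x0) <= tau /\ return_equations eps x x').
Proof.
  intros Hx0 HD Hphi. set (mu := phi x0) in *.
  destruct (recip_bounds (x0 + 3)) as (M & e1 & HM & He1 & Hrec); [lra|].
  assert (Hmu : 0 < Rabs mu) by now apply Rabs_pos_lt.
  destruct (phi_continuous x0 (Rabs mu / 2)) as [r1 [Hr1 Hphic]]; [lra|].
  destruct (pos_below4 (r1 / 2) (x0 / 2) 1 1) as (rho & Hrho0 & Hrho1 & Hrho2 & Hrho3 & _); try lra.
  exists rho. split; [lra|split; [lra|]]. intros tau Htau.
  assert (Hphib : forall s, x0 - rho <= s <= x0 + rho -> Rabs (phi s - mu) <= Rabs mu / 2).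
  { intros s Hs. destruct (Req_dec s x0) as [->|Hne].
    - fold mu. rewrite Rminus_diag, Rabs_R0. lra.
    - left. apply (Hphic s). repeat split; auto. simpl. unfold Rdist. apply Rabs_lt_between. lra. }
  set (wl := (x0 / 2) / (1 + (x0 + 1) ^ 2)).
  assert (Hwl : 0 < wl) by (unfold wl; apply Rdiv_lt_0_compat; nra).
  assert (Hw : forall s, x0 - rho <= s <= x0 + rho -> wl <= s / (1 + s ^ 2) <= 1).
  { intros s Hs. split.
    - unfold wl. apply Rmult_le_compat; try lra.
      + left; apply Rinv_0_lt_compat; nra.
      + apply Rinv_le_contravar; nra.
    - apply Rmult_le_reg_r with (1 + s ^ 2); [nra|]. unfold Rdiv. rewrite Rmult_assoc, Rinv_l; nra. }
  set (Q := (M + Rabs al + 1) * (2 * x0 + 16)). assert (Pal := Rabs_pos al).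
  assert (HQ : 0 < Q) by (unfold Q; apply Rmult_lt_0_compat; lra).
  (* In order, these bounds absorb the remainder against the slope [mu] in [Pth], the perturbation
     of the slopes [s / (1 + s ^ 2)], the shifts by multiples of [k] in [Hend], and the defect at
     [x0] against a slope over length [tau / 2]. [Q] dominates the constants that multiply [ae] in
     [G2], [G3] and [G4]. *)
  destruct (pos_below4 (Rabs mu / 4) (wl / 8) (wl * tau / 4) (Rabs mu * tau / 16))
    as (dl & Hdl0 & Hdl1 & Hdl2 & Hdl3 & Hdl4); try lra; try nra.
  destruct (pos_below4 e1 1 (dl / Q) (dl / Q)) as (e0 & He0 & He01 & He02 & He03 & _); try lra;
    try now apply Rdiv_lt_0_compat.
  exists e0. split; [auto|]. intros eps [Heps0 Heps].
  assert (He5 := Rabs_mult_small e0 eps Q dl HQ Hdl0 He03 Heps).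
  destruct (Hrec eps ltac:(lra)) as [Hden Hbd]. clear Hrec.
  set (ae := Rabs eps) in *.
  assert (Hsq : eps ^ 2 = ae * ae) by (unfold ae; rewrite <- (pow2_abs eps); ring).
  set (k := eps * al).
  assert (Hk : Rabs k = ae * Rabs al) by (unfold k; rewrite Rabs_mult; reflexivity).
  assert (HaQ : forall c, 0 <= c <= Q -> ae * c < dl).
  { intros c Hc. eapply Rle_lt_trans; [|apply He5]. apply Rmult_le_compat_l; lra. }
  assert (G2 : ae * (2 * M) < dl) by (apply HaQ; unfold Q; nra).
  assert (G3 : ae * (Rabs al * 12) < dl) by (apply HaQ; unfold Q; nra).
  assert (G4 : ae * (M * (2 * x0)) < dl) by (apply HaQ; unfold Q; nra).
  set (rem := fun s => rim eps s 1 + s / (1 + s ^ 2) - eps * kap s).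
  assert (HR : forall s, - (x0 + 3) < s < x0 + 3 -> Rabs (rem s) <= M * (ae * ae)).
  { intros s Hs. unfold rem. rewrite <- Hsq. now apply Hbd. }
  assert (HMa : M * (ae * ae) <= ae * M).
  { replace (M * (ae * ae)) with (ae * M * ae) by ring. rewrite <- (Rmult_1_r (ae * M)) at 2.
    apply Rmult_le_compat_l; [apply Rmult_le_pos; lra|lra]. }
  assert (DL : forall s, - (x0 + 3) < s < x0 + 3 -> is_derive (lpot eps) s (rim eps s 1)).
  { intros s Hs. apply line_potential_derive with (x0 + 3); auto; lra. }
  assert (DLn : forall s, - (x0 + 3) < s < x0 + 3 -> is_derive (fun s => lpot eps (- s)) s (- rim eps (- s) 1)).
  { intros s Hs. replace (- rim eps (- s) 1) with (-1 * rim eps (- s) 1) by ring.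
    apply (is_derive_comp (lpot eps) (fun s => - s)); [apply DL; lra|auto_derive; auto]. }
  assert (Hki : forall s, Rabs (k * / (1 + s ^ 2)) <= wl / 8).
  { intros s. rewrite Rabs_mult, Hk, (Rabs_pos_eq (/ _)) by (left; apply Rinv_0_lt_compat; nra).
    apply Rle_trans with (ae * Rabs al * 1); [|nra].
    apply Rmult_le_compat_l; [apply Rmult_le_pos; lra|]. rewrite <- Rinv_1. apply Rinv_le_contravar; nra. }
  (* Multiplying by [th] gives both functions of the second equation a
     positive slope, whatever the signs of [eps] and [mu]. *)
  set (th := eps * mu).
  set (A := fun x => th * (lpot eps x + half_ln x + k * atan x)).
  set (Bf := fun x => th * (- (lpot eps (- x) + half_ln x) + k * atan x)).
  set (A1 := fun x => half_ln x + k * atan x).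
  set (B1 := fun x => half_ln x - k * atan x + 2 * PI * k).
  assert (Hat : forall s, is_derive (fun x => k * atan x) s (k * / (1 + s ^ 2))).
  { intros s. apply is_derive_scal, atan_derive. }
  assert (DA : forall s, x0 - rho <= s <= x0 + rho -> is_derive A s (th * (eps * phi s + rem s))).
  { intros s Hs. apply is_derive_scal.
    replace (eps * phi s + rem s) with ((rim eps s 1 + s / (1 + s ^ 2)) + k * / (1 + s ^ 2))
      by (unfold rem, phi, k, Rdiv; ring).
    apply (is_derive_plus (fun x => lpot eps x + half_ln x) (fun x => k * atan x)); auto.
    apply (is_derive_plus (lpot eps) half_ln); [apply DL; lra|apply half_ln_derive]. }
  assert (DB : forall s, x0 - rho <= s <= x0 + rho -> is_derive Bf s (th * (eps * phi s + rem (- s)))).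
  { intros s Hs. apply is_derive_scal.
    replace (eps * phi s + rem (- s)) with (- (- rim eps (- s) 1 + s / (1 + s ^ 2)) + k * / (1 + s ^ 2)).
    2: { unfold rem, phi, k. rewrite kap_even. replace ((- s) ^ 2) with (s ^ 2) by ring. unfold Rdiv. ring. }
    apply (is_derive_plus (fun x => - (lpot eps (- x) + half_ln x)) (fun x => k * atan x)); auto.
    apply (is_derive_opp (fun x => lpot eps (- x) + half_ln x)).
    apply (is_derive_plus (fun x => lpot eps (- x)) half_ln); [apply DLn; lra|apply half_ln_derive]. }
  assert (SA1 : slope_between A1 (x0 - rho) (x0 + rho) (wl / 2) (2 + wl)).
  { apply (slope_of_derive A1 (fun s => s / (1 + s ^ 2) + k * / (1 + s ^ 2))).
    - intros s _. apply (is_derive_plus half_ln (fun x => k * atan x)); auto. apply half_ln_derive.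
    - intros s Hs. assert (K := Hki s). apply Rabs_le_between in K. specialize (Hw s Hs). lra. }
  assert (SB1 : slope_between B1 (x0 - rho) (x0 + rho) (wl / 2) (2 + wl)).
  { apply (slope_of_derive B1 (fun s => s / (1 + s ^ 2) - k * / (1 + s ^ 2) + 0)).
    - intros s _. apply (is_derive_plus (fun x => half_ln x - k * atan x) (fun _ => 2 * PI * k)); [|auto_derive; auto].
      apply (is_derive_minus half_ln (fun x => k * atan x)); auto. apply half_ln_derive.
    - intros s Hs. assert (K := Hki s). apply Rabs_le_between in K. specialize (Hw s Hs). lra. }
  (* The slopes of [A] and [Bf] are eps^2 mu^2 up to an error of one half from the variation of
     [phi] and one quarter from the remainder, hence between 1/4 and 2 times eps^2 mu^2. *)
  set (v := ae * ae * (Rabs mu * Rabs mu / 4)). set (V := ae * ae * (Rabs mu * Rabs mu * 2)).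
  assert (Hae2 : 0 < ae * ae) by nra. assert (Hmu0 : 0 < Rabs mu * Rabs mu) by nra.
  assert (Hv : 0 < v) by (unfold v; apply Rmult_lt_0_compat; lra).
  assert (Pth : forall s r, x0 - rho <= s <= x0 + rho -> Rabs r <= M * (ae * ae) -> v <= th * (eps * phi s + r) <= V).
  { intros s r Hs Hr. specialize (Hphib s Hs).
    replace (th * (eps * phi s + r)) with (eps ^ 2 * (mu * mu + mu * (phi s - mu)) + th * r) by (unfold th; ring).
    assert (T1 : Rabs (mu * (phi s - mu)) <= Rabs mu * (Rabs mu / 2)).
    { rewrite Rabs_mult. apply Rmult_le_compat_l; lra. }
    assert (T2 : Rabs (th * r) <= ae * ae * (Rabs mu * (Rabs mu / 4))).
    { unfold th. rewrite !Rabs_mult. fold ae.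
      apply Rle_trans with (ae * Rabs mu * (M * (ae * ae))).
      - apply Rmult_le_compat_l; auto. apply Rmult_le_pos; lra.
      - replace (ae * Rabs mu * (M * (ae * ae))) with (ae * ae * (Rabs mu * (ae * M))) by ring.
        apply Rmult_le_compat_l; [lra|]. apply Rmult_le_compat_l; lra. }
    apply Rabs_le_between in T1. apply Rabs_le_between in T2.
    assert (Hmu2 : mu * mu = Rabs mu * Rabs mu) by (rewrite <- Rabs_mult; symmetry; apply Rabs_pos_eq; nra).
    rewrite Hsq, Hmu2. set (a := Rabs mu * Rabs mu) in *. unfold v, V.
    assert (ae * ae * (a / 2) <= ae * ae * (a + mu * (phi s - mu)) <= ae * ae * (a * (3 / 2))).
    { split; apply Rmult_le_compat_l; unfold a in *; lra. }
    unfold a in *; lra. }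
  assert (SA : slope_between A (x0 - rho) (x0 + rho) v V).
  { apply (slope_of_derive A (fun s => th * (eps * phi s + rem s))); auto. intros s Hs. apply Pth; auto. apply HR; lra. }
  assert (SB : slope_between Bf (x0 - rho) (x0 + rho) v V).
  { apply (slope_of_derive Bf (fun s => th * (eps * phi s + rem (- s)))); auto. intros s Hs. apply Pth; auto. apply HR; lra. }
  assert (Hth : th <> 0).
  { unfold th. apply Rmult_integral_contrapositive. split; auto. intros E. unfold ae in Heps0. rewrite E, Rabs_R0 in Heps0. lra. }
  (* [A1 x = B1 x'] is the focus equation. The other is [th] times the sum of both return equations,
     in which [half_ln] cancels the order zero part of the potential. *)
  assert (Heq : forall x x', return_equations eps x x' <-> A1 x = B1 x' /\ A x + Bf x' = th * (2 * PI * k)).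
  { intros x x'. unfold return_equations. fold k. unfold A, Bf, A1, B1. rewrite <- Rmult_plus_distr_l.
    split; intros [U V'].
    - split; [lra|f_equal; lra].
    - apply (Rmult_eq_reg_l th) in V'; auto. split; lra. }
  set (W := 2 + wl + V).
  assert (HV : 0 <= V) by (unfold V; nra).
  assert (Hwiden : forall f m W' lo hi, W' <= W -> x0 - rho <= lo -> hi <= x0 + rho ->
    slope_between f (x0 - rho) (x0 + rho) m W' -> slope_between f lo hi m W).
  { intros f m W' lo hi HW Hlo Hhi Hf x y Hx Hy. destruct (Hf x y) as [K1 K2]; try lra. split; auto.
    apply Rle_trans with (1 := K2). apply Rmult_le_compat_r; lra. }
  split; [exact Hden|]. split; [|split].
  - intros x y Hx Hy.
    assert (Hbase : forall s, - (x0 + 3) < s < x0 + 3 -> Rabs (rim eps s 1 + s / (1 + s ^ 2)) <= wl / 8).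
    { intros s Hs. destruct (Hbd s Hs) as [K1 _]. assert (K2 := HR s Hs).
      replace (rim eps s 1 + s / (1 + s ^ 2)) with (eps * kap s + rem s) by (unfold rem; ring).
      eapply Rle_trans; [apply Rabs_triang|]. rewrite Rabs_mult. fold ae.
      assert (ae * Rabs (kap s) <= ae * M) by (apply Rmult_le_compat_l; lra). lra. }
    assert (Hrim : forall s, x0 - rho <= s <= x0 + rho ->
      wl / 2 <= - rim eps s 1 <= 2 + wl /\ wl / 2 <= - - rim eps (- s) 1 <= 2 + wl).
    { intros s Hs. specialize (Hw s Hs).
      assert (K1 := Hbase s ltac:(lra)). assert (K2 := Hbase (- s) ltac:(lra)).
      replace (- s / (1 + (- s) ^ 2)) with (- (s / (1 + s ^ 2))) in K2
        by (replace ((- s) ^ 2) with (s ^ 2) by ring; unfold Rdiv; ring).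
      apply Rabs_le_between in K1. apply Rabs_le_between in K2. lra. }
    assert (S1 : slope_between (fun s => - lpot eps s) (x0 - rho) (x0 + rho) (wl / 2) (2 + wl)).
    { apply (slope_of_derive _ (fun s => - rim eps s 1)); [|intros; now apply Hrim].
      intros t Ht. apply (is_derive_opp (lpot eps)). apply DL; lra. }
    assert (S2 : slope_between (fun s => - lpot eps (- s)) (x0 - rho) (x0 + rho) (wl / 2) (2 + wl)).
    { apply (slope_of_derive _ (fun s => - - rim eps (- s) 1)); [|intros; now apply Hrim].
      intros t Ht. apply (is_derive_opp (fun s => lpot eps (- s))). apply DLn; lra. }
    assert (K1 := slope_lt _ _ _ _ _ x y S1 ltac:(lra) Hx Hy). assert (K2 := slope_lt _ _ _ _ _ x y S2 ltac:(lra) Hx Hy).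
    assert (K3 := slope_lt _ _ _ _ _ x y SA1 ltac:(lra) Hx Hy). assert (K4 := slope_lt _ _ _ _ _ x y SB1 ltac:(lra) Hx Hy).
    unfold A1 in K3. unfold B1 in K4. fold k. repeat split; lra.
  - intros x x' y y' H1 H2 H3 H4 R1 R2. apply Heq in R1. apply Heq in R2.
    apply Rabs_le_between in H1. apply Rabs_le_between in H2.
    apply Rabs_le_between in H3. apply Rabs_le_between in H4.
    apply (coupled_equations_unique A Bf A1 B1 (x0 - rho) (x0 + rho) (th * (2 * PI * k)) (wl / 2) v W); try tauto; try lra;
      eapply Hwiden; try eassumption; unfold W; lra.
  - assert (Hend : forall s t, x0 - tau <= s <= t -> t <= x0 + tau -> tau / 2 <= t - s ->
       A1 s < B1 t /\ B1 s < A1 t).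
    { intros s t Hs Ht Hst.
      destruct (SA1 s t) as [K1 _]; try lra. destruct (SB1 s t) as [K2 _]; try lra.
      assert (wl * tau / 4 <= wl / 2 * (t - s)) by nra.
      assert (T : forall c, - 3 * PI < c < 3 * PI -> Rabs (k * c) < wl * tau / 4).
      { intros c Hc. rewrite Rabs_mult, Hk. assert (Rabs c <= 12) by (apply Rabs_le; generalize PI_4; lra).
        apply Rle_lt_trans with (ae * Rabs al * 12); [|lra].
        apply Rmult_le_compat_l; auto. apply Rmult_le_pos; lra. }
      generalize (atan_bound s) (atan_bound t) PI_RGT_0. intros.
      assert (T4 := T (2 * PI - 2 * atan t) ltac:(lra)). apply Rabs_lt_between in T4.
      assert (T5 := T (2 * PI - 2 * atan s) ltac:(lra)). apply Rabs_lt_between in T5.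
      unfold A1, B1 in *. split; lra. }
    (* The function [lpot + half_ln - eps * kap_int] has derivative [rem], of order eps^2, and is
       integrated from [- x0] to [x0]. The term of order eps is [eps] times D(x0), which vanishes by
       [HD]. *)
    assert (Hc0 : Rabs (lpot eps x0 - lpot eps (- x0) + 2 * k * atan x0 - 2 * PI * k) <= M * (ae * ae) * (2 * x0)).
    { assert (HL : Rabs (lpot eps x0 + half_ln x0 - eps * kap_int x0 -
         (lpot eps (- x0) + half_ln (- x0) - eps * kap_int (- x0))) <= M * (ae * ae) * (x0 - - x0)).
      { apply (Lipschitz_of_derive (fun s => lpot eps s + half_ln s - eps * kap_int s) rem (M * (ae * ae)) (- x0) x0); try lra.
        - intros t Ht. apply (is_derive_minus (fun s => lpot eps s + half_ln s) (fun s => eps * kap_int s)).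
          + apply (is_derive_plus (lpot eps) half_ln); [apply DL; lra|apply half_ln_derive].
          + apply is_derive_scal, kap_int_derive.
        - intros t Ht. apply HR; lra. }
      rewrite half_ln_even, kap_int_odd in HL.
      replace (lpot eps x0 - lpot eps (- x0) + 2 * k * atan x0 - 2 * PI * k) with
        (lpot eps x0 + half_ln x0 - eps * kap_int x0 - (lpot eps (- x0) + half_ln x0 - eps * - kap_int x0)
          + eps * (2 * kap_int x0 + 2 * al * atan x0 - 2 * PI * al)) by (unfold k; ring).
      rewrite HD, Rmult_0_r, Rplus_0_r. eapply Rle_trans; [apply HL|]. right; ring. }
    assert (Hcth : Rabs (A x0 + Bf x0 - th * (2 * PI * k)) <= ae * ae * (Rabs mu * (Rabs mu * tau / 16))).
    { replace (A x0 + Bf x0 - th * (2 * PI * k)) with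
        (th * (lpot eps x0 - lpot eps (- x0) + 2 * k * atan x0 - 2 * PI * k)) by (unfold A, Bf; ring).
      unfold th. rewrite !Rabs_mult. fold ae.
      apply Rle_trans with (ae * Rabs mu * (M * (ae * ae) * (2 * x0))).
      - apply Rmult_le_compat_l; auto. apply Rmult_le_pos; lra.
      - replace (ae * Rabs mu * (M * (ae * ae) * (2 * x0))) with (ae * ae * (Rabs mu * (ae * (M * (2 * x0))))) by ring.
        apply Rmult_le_compat_l; [lra|]. apply Rmult_le_compat_l; lra. }
    apply Rabs_le_between in Hcth.
    assert (0 < ae * ae * (Rabs mu * Rabs mu) * tau) by (repeat apply Rmult_lt_0_compat; lra).
    destruct (SA x0 (x0 + tau / 2)) as [K1 _]; try lra. destruct (SA (x0 - tau / 2) x0) as [K2 _]; try lra.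
    unfold v in K1, K2.
    (* The abscissa x is sought within [tau / 2] of [x0] and x' within [tau]: the extra room absorbs
       the difference of order eps between [A1] and [B1]. *)
    destruct (coupled_equations_solution A Bf A1 B1 (x0 - tau) (x0 - tau / 2) x0 (x0 + tau / 2) (x0 + tau)
      (th * (2 * PI * k)) (wl / 2) v W) as (x & x' & Hx & Hx' & E1 & E2); try lra;
      try (eapply Hwiden; try eassumption; unfold W; lra); try (apply Hend; lra); try (left; apply Hend; lra).
    exists x, x'. split; [apply Rabs_le; lra|]. split; [apply Rabs_le; lra|]. apply Heq. now split.
Qed.

End Displacement.

(** * Existence of the periodic orbits *)

Lemma geometric_limit (u : nat -> R) (c : R) : 0 <= c ->
  (forall n, Rabs (u (S n) - u n) <= c / 2 ^ n) ->
  exists l, forall n, Rabs (l - u n) <= 2 * c / 2 ^ n.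
Proof.
  intros Hc Hu.
  assert (Hp : forall n, 0 < 2 ^ n) by (intros; apply pow_lt; lra).
  assert (Htel : forall n k, Rabs (u (n + k)%nat - u n) <= 2 * c / 2 ^ n - 2 * c / 2 ^ (n + k)).
  { intros n k. induction k as [|k IH].
    - rewrite Nat.add_0_r, Rminus_diag, Rabs_R0. lra.
    - rewrite Nat.add_succ_r. replace (u (S (n + k)) - u n) with
        ((u (S (n + k)) - u (n + k)%nat) + (u (n + k)%nat - u n)) by ring.
      eapply Rle_trans; [apply Rabs_triang|].
      specialize (Hu (n + k)%nat). specialize (Hp (n + k)%nat). simpl.
      replace (2 * c / (2 * 2 ^ (n + k))) with (c / 2 ^ (n + k)) by (field; lra).
      replace (2 * c / 2 ^ (n + k)) with (c / 2 ^ (n + k) + c / 2 ^ (n + k)) in IH by (field; lra). lra. }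
  assert (Hb : forall n k, (n <= k)%nat -> Rabs (u k - u n) <= 2 * c / 2 ^ n).
  { intros n k Hk. replace k with (n + (k - n))%nat by lia. specialize (Htel n (k - n)%nat).
    assert (0 <= 2 * c / 2 ^ (n + (k - n))).
    { apply Rmult_le_pos; [lra|]. left; apply Rinv_0_lt_compat, Hp. } lra. }
  assert (Hl : ex_finite_lim_seq u).
  { apply ex_lim_seq_cauchy_corr. intros e.
    assert (Hz : is_lim_seq (fun n => 4 * c * (/ 2) ^ n) 0).
    { replace (Finite 0) with (Rbar_mult (4 * c) 0) by (simpl; f_equal; ring).
      apply is_lim_seq_scal_l, is_lim_seq_geom. rewrite Rabs_pos_eq; lra. }
    apply is_lim_seq_spec in Hz. destruct (Hz e) as [N HN]. exists N. intros n m Hn Hm.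
    specialize (HN N (le_n N)). rewrite Rminus_0_r in HN.
    apply Rle_lt_trans with (Rabs (4 * c * (/ 2) ^ N)); auto.
    replace (u n - u m) with ((u n - u N) + - (u m - u N)) by ring.
    eapply Rle_trans; [apply Rabs_triang|]. rewrite Rabs_Ropp.
    generalize (Hb N n Hn) (Hb N m Hm) (Rle_abs (4 * c * (/ 2) ^ N)).
    replace (4 * c * (/ 2) ^ N) with (2 * c / 2 ^ N + 2 * c / 2 ^ N); [lra|].
    rewrite pow_inv. field. generalize (Hp N); lra. }
  destruct Hl as [l Hl]. exists l. intros n.
  apply Rabs_le.
  assert (Hl' : is_lim_seq (fun k => u (k + n)%nat - u n) (l - u n)).
  { apply is_lim_seq_minus'; [|apply is_lim_seq_const]. now apply is_lim_seq_incr_n. }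
  split.
  - apply (is_lim_seq_le (fun _ => - (2 * c / 2 ^ n)) _ (- (2 * c / 2 ^ n)) (l - u n)) in Hl'; auto.
    + intros k. generalize (Hb n (k + n)%nat ltac:(lia)). intros K. apply Rabs_le_between in K. lra.
    + apply is_lim_seq_const.
  - apply (is_lim_seq_le _ (fun _ => 2 * c / 2 ^ n) (l - u n) (2 * c / 2 ^ n)) in Hl'; auto.
    + intros k. generalize (Hb n (k + n)%nat ltac:(lia)). intros K. apply Rabs_le_between in K. lra.
    + apply is_lim_seq_const.
Qed.

Lemma RInt_minus_le (g1 g2 G : R -> R) t : 0 <= t -> continuity g1 -> continuity g2 -> continuity G ->
  (forall s, 0 <= s <= t -> Rabs (g1 s - g2 s) <= G s) ->
  Rabs (RInt g1 0 t - RInt g2 0 t) <= RInt G 0 t.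
Proof.
  intros Ht H1 H2 HG Hle.
  assert (E : RInt g1 0 t - RInt g2 0 t = RInt (fun s => g1 s - g2 s) 0 t).
  { symmetry. apply (RInt_minus (V := R_CompleteNormedModule)); now apply ex_RInt_cont. }
  rewrite E.
  apply Rle_trans with (RInt (fun s => Rabs (g1 s - g2 s)) 0 t).
  - apply abs_RInt_le; auto. apply ex_RInt_cont. now apply continuity_minus.
  - apply RInt_le; auto.
    + apply ex_RInt_cont. apply (continuity_comp (fun s => g1 s - g2 s) Rabs).
      * now apply continuity_minus.
      * apply Rcontinuity_abs.
    + now apply ex_RInt_cont.
    + intros s Hs. apply Hle. lra.
Qed.

(** * Picard iteration for a globally Lipschitz planar field *)

Section Picard.

Variables (F1 F2 : R -> R -> R) (L p1 p2 S0 : R).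
Hypothesis HL : 0 < L.
Hypothesis HS : 0 < S0.
Hypothesis HF1 : forall x y x' y', Rabs (F1 x y - F1 x' y') <= L * (Rabs (x - x') + Rabs (y - y')).
Hypothesis HF2 : forall x y x' y', Rabs (F2 x y - F2 x' y') <= L * (Rabs (x - x') + Rabs (y - y')).

Lemma Lipschitz2_continuity F (x y : R -> R) :
  (forall x y x' y', Rabs (F x y - F x' y') <= L * (Rabs (x - x') + Rabs (y - y'))) ->
  continuity x -> continuity y -> continuity (fun t => F (x t) (y t)).
Proof.
  intros HF Hx Hy t e He.
  assert (He' : 0 < e / (4 * L)) by (apply Rdiv_lt_0_compat; lra).
  destruct (Hx t _ He') as [d1 [Hd1 H1]]. destruct (Hy t _ He') as [d2 [Hd2 H2]].
  exists (Rmin d1 d2). split; [apply Rmin_glb_lt; lra|].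
  intros s [Hs1 Hs2]. simpl in *. unfold Rdist in *.
  specialize (H1 s (conj Hs1 (Rlt_le_trans _ _ _ Hs2 (Rmin_l _ _)))).
  specialize (H2 s (conj Hs1 (Rlt_le_trans _ _ _ Hs2 (Rmin_r _ _)))).
  eapply Rle_lt_trans; [apply HF|].
  apply Rlt_trans with (L * (e / (2 * L))).
  - apply Rmult_lt_compat_l; auto. replace (e / (2 * L)) with (e / (4 * L) + e / (4 * L)) by (field; lra). lra.
  - replace (L * (e / (2 * L))) with (e / 2) by (field; lra). lra.
Qed.

Fixpoint picard (n : nat) : (R -> R) * (R -> R) :=
  match n with
  | O => (fun _ => p1, fun _ => p2)
  | S n => let '(x, y) := picard n in
      (fun t => p1 + RInt (fun s => F1 (x s) (y s)) 0 t, fun t => p2 + RInt (fun s => F2 (x s) (y s)) 0 t)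
  end.

Definition px n := fst (picard n).
Definition py n := snd (picard n).

Lemma px_S n t : px (S n) t = p1 + RInt (fun s => F1 (px n s) (py n s)) 0 t.
Proof. unfold px, py. simpl. now destruct (picard n). Qed.

Lemma py_S n t : py (S n) t = p2 + RInt (fun s => F2 (px n s) (py n s)) 0 t.
Proof. unfold px, py. simpl. now destruct (picard n). Qed.

Lemma continuity_integral (p : R) (g : R -> R) (f : R -> R) : continuity g ->
  (forall t, f t = p + RInt g 0 t) -> continuity f.
Proof.
  intros Hg Hf. apply is_derive_continuity with g. intros t.
  apply (is_derive_ext (fun t => p + RInt g 0 t)); [intros; symmetry; apply Hf|].
  replace (g t) with (0 + g t) by ring.
  apply (is_derive_plus (fun _ => p) (fun t => RInt g 0 t)); [auto_derive; auto|now apply RInt_derive_cont].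
Qed.

Lemma picard_cont n : continuity (px n) /\ continuity (py n).
Proof.
  induction n as [|n [IH1 IH2]].
  - split; apply continuity_const; intros x y; reflexivity.
  - split.
    + apply (continuity_integral p1 (fun s => F1 (px n s) (py n s))); [now apply Lipschitz2_continuity|apply px_S].
    + apply (continuity_integral p2 (fun s => F2 (px n s) (py n s))); [now apply Lipschitz2_continuity|apply py_S].
Qed.

Definition pC : R := S0 * (Rabs (F1 p1 p2) + Rabs (F2 p1 p2)).

Lemma exp_weight_integral c t : 2 * L * RInt (fun s => c * exp (4 * L * s)) 0 t = c / 2 * exp (4 * L * t) - c / 2.
Proof.
  assert (E : RInt (fun s => c * exp (4 * L * s)) 0 t = c / (4 * L) * exp (4 * L * t) - c / (4 * L)).
  { apply is_RInt_unique.
    replace (c / (4 * L) * exp (4 * L * t) - c / (4 * L)) with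
      (minus (c / (4 * L) * exp (4 * L * t)) (c / (4 * L) * exp (4 * L * 0))).
    - apply (is_RInt_derive (fun s => c / (4 * L) * exp (4 * L * s)) (fun s => c * exp (4 * L * s))).
      + intros s _. auto_derive; auto. field. lra.
      + intros s _. apply (ex_derive_continuous (fun s => c * exp (4 * L * s))). auto_derive; auto.
    - rewrite Rmult_0_r, exp_0. unfold minus, plus, opp; simpl. ring. }
  rewrite E. field. lra.
Qed.

Lemma exp_weight_cont c : continuity (fun s => c * exp (4 * L * s)).
Proof.
  apply is_derive_continuity with (fun s => c * (4 * L * exp (4 * L * s))).
  intros s. auto_derive; auto. ring.
Qed.

(** The weight [exp (4 * L * t)] makes each iteration halve the distance, since [2 * L] times its
    integral is at most half of it. Convergence thus holds on all of [0, S0] at once, with no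
    condition of small time. *)
Lemma picard_step n t : 0 <= t <= S0 ->
  Rabs (px (S n) t - px n t) + Rabs (py (S n) t - py n t) <= pC / 2 ^ n * exp (4 * L * t).
Proof.
  revert t. induction n as [|n IH]; intros t Ht.
  - rewrite px_S, py_S. unfold px, py; simpl.
    rewrite !RInt_const. unfold scal; simpl. unfold mult; simpl.
    replace (p1 + (t - 0) * F1 p1 p2 - p1) with (t * F1 p1 p2) by ring.
    replace (p2 + (t - 0) * F2 p1 p2 - p2) with (t * F2 p1 p2) by ring.
    rewrite !Rabs_mult, (Rabs_pos_eq t) by lra.
    assert (1 <= exp (4 * L * t)).
    { rewrite <- exp_0. destruct (Req_dec t 0) as [->|]; [rewrite Rmult_0_r; lra|].
      left. apply exp_increasing. nra. }
    unfold pC. generalize (Rabs_pos (F1 p1 p2)) (Rabs_pos (F2 p1 p2)). intros K1 K2.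
    apply Rle_trans with (S0 * (Rabs (F1 p1 p2) + Rabs (F2 p1 p2)) * 1); [nra|].
    replace (S0 * (Rabs (F1 p1 p2) + Rabs (F2 p1 p2)) / 1) with (S0 * (Rabs (F1 p1 p2) + Rabs (F2 p1 p2))) by field.
    apply Rmult_le_compat_l; auto. nra.
  - destruct (picard_cont n) as [C1 C2]. destruct (picard_cont (S n)) as [C3 C4].
    set (c := pC / 2 ^ n) in *.
    assert (Hp : 0 < 2 ^ n) by (apply pow_lt; lra).
    replace (pC / 2 ^ S n) with (c / 2) by (unfold c; simpl; field; lra).
    assert (Hc : 0 <= c).
    { unfold c, pC. apply Rmult_le_pos; [|left; now apply Rinv_0_lt_compat].
      generalize (Rabs_pos (F1 p1 p2)) (Rabs_pos (F2 p1 p2)). nra. }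
    assert (HI : forall F, (forall x y x' y', Rabs (F x y - F x' y') <= L * (Rabs (x - x') + Rabs (y - y'))) ->
      Rabs (RInt (fun s => F (px (S n) s) (py (S n) s)) 0 t - RInt (fun s => F (px n s) (py n s)) 0 t)
       <= L * RInt (fun s => c * exp (4 * L * s)) 0 t).
    { intros F HF.
      assert (E : L * RInt (fun s => c * exp (4 * L * s)) 0 t = RInt (fun s => L * (c * exp (4 * L * s))) 0 t).
      { symmetry. apply (RInt_scal (V := R_CompleteNormedModule)). apply ex_RInt_cont, exp_weight_cont. }
      rewrite E.
      apply RInt_minus_le; try lra; try now apply Lipschitz2_continuity.
      - apply continuity_scal, exp_weight_cont.
      - intros s Hs. eapply Rle_trans; [apply HF|]. apply Rmult_le_compat_l; [lra|]. apply IH. lra. }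
    rewrite (px_S (S n)), (py_S (S n)), (px_S n t), (py_S n t).
    replace (p1 + RInt (fun s => F1 (px (S n) s) (py (S n) s)) 0 t - (p1 + RInt (fun s => F1 (px n s) (py n s)) 0 t))
      with (RInt (fun s => F1 (px (S n) s) (py (S n) s)) 0 t - RInt (fun s => F1 (px n s) (py n s)) 0 t) by ring.
    replace (p2 + RInt (fun s => F2 (px (S n) s) (py (S n) s)) 0 t - (p2 + RInt (fun s => F2 (px n s) (py n s)) 0 t))
      with (RInt (fun s => F2 (px (S n) s) (py (S n) s)) 0 t - RInt (fun s => F2 (px n s) (py n s)) 0 t) by ring.
    generalize (HI F1 HF1) (HI F2 HF2) (exp_weight_integral c t). lra.
Qed.

(** The limit is chosen pointwise at the clamped time [cl t]. The solution is thereby extended by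
    constants outside [0, S0] and Lipschitz on the whole line, as local absolute continuity on R
    demands. *)
Theorem picard_solution : exists x y : R -> R, x 0 = p1 /\ y 0 = p2 /\
  (exists K, forall s t, s <= t -> Rabs (x t - x s) <= K * (t - s) /\ Rabs (y t - y s) <= K * (t - s)) /\
  forall t, 0 < t < S0 -> is_derive x t (F1 (x t) (y t)) /\ is_derive y t (F2 (x t) (y t)).
Proof.
  set (cl := clamp 0 S0).
  assert (Hcl : forall t, 0 <= cl t <= S0) by (intros; apply clamp_in; lra).
  assert (Hcid : forall t, 0 <= t <= S0 -> cl t = t) by (intros; now apply clamp_id).
  assert (Hcl1 : forall s t, s <= t -> 0 <= cl t - cl s <= t - s) by (intros; apply clamp_step; lra).
  set (c := pC * exp (4 * L * S0)).
  assert (HpC : 0 <= pC).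
  { unfold pC. generalize (Rabs_pos (F1 p1 p2)) (Rabs_pos (F2 p1 p2)). nra. }
  assert (Hc : 0 <= c) by (unfold c; apply Rmult_le_pos; auto; left; apply exp_pos).
  assert (Hst : forall n t, 0 <= t <= S0 ->
     Rabs (px (S n) t - px n t) <= c / 2 ^ n /\ Rabs (py (S n) t - py n t) <= c / 2 ^ n).
  { intros n t Ht. assert (K := picard_step n t Ht).
    assert (Hp : 0 < 2 ^ n) by (apply pow_lt; lra).
    assert (K2 : pC / 2 ^ n * exp (4 * L * t) <= c / 2 ^ n).
    { unfold c. replace (pC * exp (4 * L * S0) / 2 ^ n) with (pC / 2 ^ n * exp (4 * L * S0)) by (field; lra).
      apply Rmult_le_compat_l.
      - apply Rmult_le_pos; auto. left; now apply Rinv_0_lt_compat.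
      - destruct (Req_dec t S0) as [->|]; [lra|]. left. apply exp_increasing. apply Rmult_lt_compat_l; lra. }
    generalize (Rabs_pos (px (S n) t - px n t)) (Rabs_pos (py (S n) t - py n t)). lra. }
  assert (Hx : forall t, exists l, forall n, Rabs (l - px n (cl t)) <= 2 * c / 2 ^ n).
  { intros t. apply (geometric_limit (fun n => px n (cl t))); auto. intros n. now apply Hst. }
  assert (Hy : forall t, exists l, forall n, Rabs (l - py n (cl t)) <= 2 * c / 2 ^ n).
  { intros t. apply (geometric_limit (fun n => py n (cl t))); auto. intros n. now apply Hst. }
  set (x := fun t => epsilon (inhabits 0) (fun l => forall n, Rabs (l - px n (cl t)) <= 2 * c / 2 ^ n)).
  set (y := fun t => epsilon (inhabits 0) (fun l => forall n, Rabs (l - py n (cl t)) <= 2 * c / 2 ^ n)).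
  assert (Hxs : forall t n, Rabs (x t - px n (cl t)) <= 2 * c / 2 ^ n).
  { intros t. apply (epsilon_spec (inhabits 0) (fun l => forall n, Rabs (l - px n (cl t)) <= 2 * c / 2 ^ n)). apply Hx. }
  assert (Hys : forall t n, Rabs (y t - py n (cl t)) <= 2 * c / 2 ^ n).
  { intros t. apply (epsilon_spec (inhabits 0) (fun l => forall n, Rabs (l - py n (cl t)) <= 2 * c / 2 ^ n)). apply Hy. }
  clearbody x y. clear Hx Hy.
  assert (Hsmall : forall K e, 0 < e -> exists n, K * (2 * c / 2 ^ n) < e).
  { intros K e He.
    assert (Hz : is_lim_seq (fun n => K * (2 * c) * (/ 2) ^ n) 0).
    { replace (Finite 0) with (Rbar_mult (K * (2 * c)) 0) by (simpl; f_equal; ring).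
      apply is_lim_seq_scal_l, is_lim_seq_geom. rewrite Rabs_pos_eq; lra. }
    apply is_lim_seq_spec in Hz. destruct (Hz (mkposreal e He)) as [N HN]. exists N.
    specialize (HN N (le_n N)). simpl in HN. rewrite Rminus_0_r in HN.
    eapply Rle_lt_trans; [|apply HN]. eapply Rle_trans; [|apply Rle_abs].
    rewrite pow_inv. unfold Rdiv. lra. }
  assert (Hclc : continuity cl).
  { intros t e He. exists e. split; auto. intros s [_ Hs]. simpl in *. unfold Rdist in *.
    eapply Rle_lt_trans; [|apply Hs]. apply clamp_Lipschitz; lra. }
  assert (Hcont : forall (u : R -> R) (v : nat -> R -> R), (forall n, continuity (v n)) ->
     (forall t n, Rabs (u t - v n (cl t)) <= 2 * c / 2 ^ n) -> continuity u).
  { intros u v Hv Hu t e He. destruct (Hsmall 1 (e / 4)) as [n Hn]; [lra|].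
    destruct (continuity_comp cl (v n) Hclc (Hv n) t (e / 4)) as [d [Hd H]]; [lra|].
    exists d. split; auto. intros s Hs. specialize (H s Hs). simpl in *. unfold Rdist, comp in *.
    replace (u s - u t) with ((u s - v n (cl s)) + (v n (cl s) - v n (cl t)) + - (u t - v n (cl t))) by ring.
    eapply Rle_lt_trans; [apply Rabs_triang|]. rewrite Rabs_Ropp.
    eapply Rle_lt_trans; [apply Rplus_le_compat_r, Rabs_triang|].
    generalize (Hu s n) (Hu t n). lra. }
  assert (Cx : continuity x) by (apply (Hcont x px); [intros; apply picard_cont|auto]).
  assert (Cy : continuity y) by (apply (Hcont y py); [intros; apply picard_cont|auto]).
  assert (Hint : forall (u : R -> R) (v : nat -> R -> R) F p,
     (forall x y x' y', Rabs (F x y - F x' y') <= L * (Rabs (x - x') + Rabs (y - y'))) ->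
     (forall t n, Rabs (u t - v n (cl t)) <= 2 * c / 2 ^ n) ->
     (forall n t, v (S n) t = p + RInt (fun s => F (px n s) (py n s)) 0 t) ->
     forall t, 0 <= t <= S0 -> u t = p + RInt (fun s => F (x s) (y s)) 0 t).
  { intros u v F p HF Hu Hv t Ht.
    assert (Ha : forall n, Rabs (u t - (p + RInt (fun s => F (x s) (y s)) 0 t)) <=
       (1 + S0 * (2 * L)) * (2 * c / 2 ^ n)).
    { intros n. assert (Hp : 0 < 2 ^ n) by (apply pow_lt; lra).
      assert (Hb : 0 <= 2 * c / 2 ^ n) by (apply Rmult_le_pos; [lra|left; now apply Rinv_0_lt_compat]).
      assert (H1 := Hu t (S n)). rewrite (Hcid t Ht), Hv in H1.
      destruct (picard_cont n) as [C1 C2].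
      assert (H2 : Rabs (RInt (fun s => F (px n s) (py n s)) 0 t - RInt (fun s => F (x s) (y s)) 0 t)
         <= RInt (fun _ => 2 * L * (2 * c / 2 ^ n)) 0 t).
      { apply RInt_minus_le; try lra; try now apply Lipschitz2_continuity.
        - apply continuity_const; intros ? ?; reflexivity.
        - intros s Hs. eapply Rle_trans; [apply HF|].
          assert (K1 := Hxs s n). assert (K2 := Hys s n). rewrite (Hcid s) in K1, K2 by lra.
          rewrite Rabs_minus_sym in K1. rewrite Rabs_minus_sym in K2. nra. }
      rewrite RInt_const in H2. unfold scal in H2; simpl in H2. unfold mult in H2; simpl in H2.
      assert (H3 : 2 * c / 2 ^ S n <= 2 * c / 2 ^ n).
      { simpl. replace (2 * c / (2 * 2 ^ n)) with (/ 2 * (2 * c / 2 ^ n)) by (field; lra). lra. }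
      assert (H4 : (t - 0) * (2 * L * (2 * c / 2 ^ n)) <= S0 * (2 * L * (2 * c / 2 ^ n))).
      { apply Rmult_le_compat_r; [|lra]. apply Rmult_le_pos; lra. }
      replace (u t - (p + RInt (fun s => F (x s) (y s)) 0 t)) with
        ((u t - (p + RInt (fun s => F (px n s) (py n s)) 0 t)) +
         (RInt (fun s => F (px n s) (py n s)) 0 t - RInt (fun s => F (x s) (y s)) 0 t)) by ring.
      eapply Rle_trans; [apply Rabs_triang|]. lra. }
    apply NNPP. intros Hne.
    assert (Hpos : 0 < Rabs (u t - (p + RInt (fun s => F (x s) (y s)) 0 t))) by (apply Rabs_pos_lt; lra).
    destruct (Hsmall (1 + S0 * (2 * L)) _ Hpos) as [n Hn]. specialize (Ha n). lra. }
  assert (Ix := Hint x px F1 p1 HF1 Hxs px_S). assert (Iy := Hint y py F2 p2 HF2 Hys py_S).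
  clear Hint.
  assert (Hder : forall (u : R -> R) F p,
     (forall x y x' y', Rabs (F x y - F x' y') <= L * (Rabs (x - x') + Rabs (y - y'))) ->
     (forall t, 0 <= t <= S0 -> u t = p + RInt (fun s => F (x s) (y s)) 0 t) ->
     (forall t, u t = u (cl t)) -> u 0 = p /\
     (exists K, 0 <= K /\ forall s t, s <= t -> Rabs (u t - u s) <= K * (t - s)) /\
     forall t, 0 < t < S0 -> is_derive u t (F (x t) (y t))).
  { intros u F p HF Hu Huc.
    assert (Cg : continuity (fun s => F (x s) (y s))) by now apply Lipschitz2_continuity.
    set (G := fun t => p + RInt (fun s => F (x s) (y s)) 0 t).
    assert (DG : forall t, is_derive G t (F (x t) (y t))).
    { intros t. unfold G. replace (F (x t) (y t)) with (0 + F (x t) (y t)) by ring.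
      apply (is_derive_plus (fun _ => p) (fun t => RInt (fun s => F (x s) (y s)) 0 t)); [auto_derive; auto|].
      now apply (RInt_derive_cont (fun s => F (x s) (y s))). }
    split; [|split].
    - rewrite (Hu 0), RInt_point by lra. unfold zero; simpl. ring.
    - destruct (continuity_bounded _ 0 S0 Cg) as [K [HK HK']].
      exists K. split; auto. intros s t Hst'. rewrite (Huc t), (Huc s), !Hu by auto.
      destruct (Hcl1 s t Hst') as [K1 K2].
      apply Rle_trans with (K * (cl t - cl s)).
      + apply (Lipschitz_of_derive G (fun s => F (x s) (y s)) K 0 S0); auto; [split; [apply Hcl|lra]|apply Hcl].
      + apply Rmult_le_compat_l; lra.
    - intros t Ht. apply (is_derive_ext_loc G); auto.
      apply (locally_open_interval _ 0 S0); auto. intros r Hr. symmetry. apply Hu. lra. }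
  assert (Hcc : forall t, cl (cl t) = cl t) by (intros; apply Hcid, Hcl).
  assert (Huniq : forall (u : R -> R) (v : nat -> R -> R), (forall t n, Rabs (u t - v n (cl t)) <= 2 * c / 2 ^ n) ->
     forall t, u t = u (cl t)).
  { intros u v Hu t. apply NNPP. intros Hne.
    assert (Hpos : 0 < Rabs (u t - u (cl t))) by (apply Rabs_pos_lt; lra).
    destruct (Hsmall 2 _ Hpos) as [n Hn]. assert (K1 := Hu t n). assert (K2 := Hu (cl t) n).
    rewrite Hcc in K2. rewrite Rabs_minus_sym in K2.
    assert (K3 := Rabs_triang (u t - v n (cl t)) (v n (cl t) - u (cl t))).
    replace (u t - v n (cl t) + (v n (cl t) - u (cl t))) with (u t - u (cl t)) in K3 by ring. lra. }
  destruct (Hder x F1 p1 HF1 Ix (Huniq x px Hxs)) as (X1 & [K1 [HK1 X2]] & X3).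
  destruct (Hder y F2 p2 HF2 Iy (Huniq y py Hys)) as (Y1 & [K2 [HK2 Y2]] & Y3).
  exists x, y. split; [auto|split; [auto|split; [|intros t Ht; split; auto]]].
  exists (K1 + K2). intros s t Hst'. specialize (X2 s t Hst'). specialize (Y2 s t Hst'). split; nra.
Qed.

End Picard.

Lemma null_set_range (c : nat -> R) : null_set (fun t => exists n, t = c n).
Proof.
  intros e He. exists (fun n => c n - e / 4 * (/ 2) ^ n), (fun n => c n + e / 4 * (/ 2) ^ n).
  assert (Hp : forall n, 0 < e / 4 * (/ 2) ^ n).
  { intros n. apply Rmult_lt_0_compat; [lra|]. apply pow_lt; lra. }
  assert (Hext : forall n, e / 2 * (/ 2) ^ n = c n + e / 4 * (/ 2) ^ n - (c n - e / 4 * (/ 2) ^ n)).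
  { intros n. field. }
  assert (Hg : Rabs (/ 2) < 1) by (rewrite Rabs_pos_eq; lra).
  repeat split.
  - intros n. specialize (Hp n). lra.
  - intros t [n ->]. exists n. specialize (Hp n). lra.
  - apply (ex_series_ext (fun n => e / 2 * (/ 2) ^ n)); auto.
    apply (ex_series_scal (e / 2) (fun n => (/ 2) ^ n)). now apply ex_series_geom.
  - rewrite <- (Series_ext (fun n => e / 2 * (/ 2) ^ n)) by auto.
    rewrite Series_scal_l, Series_geom by auto. right. field.
Qed.

(** These will be the crossing times of a periodic solution, where no derivative is claimed. In the
    enumeration [n / 4] is the absolute value of [k], and [n mod 4] encodes its sign and the choice
    between the two progressions. *)
Lemma null_set_periodic (T a : R) : null_set (fun t => exists k : Z, t = IZR k * T \/ t = IZR k * T + a).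
Proof.
  set (c := fun n => let q := INR (n / 4) * T in
     match (n mod 4)%nat with O => q | 1%nat => - q | 2%nat => q + a | _ => - q + a end).
  apply null_set_subset with (fun t => exists n, t = c n); [|apply null_set_range].
  intros t [k Hk].
  assert (Hq : forall q r, (r < 4)%nat -> ((4 * q + r) / 4 = q)%nat /\ ((4 * q + r) mod 4 = r)%nat).
  { intros q r Hr. split; symmetry.
    - now apply Nat.div_unique with r.
    - now apply Nat.mod_unique with q. }
  destruct (Z.le_gt_cases 0 k) as [Hk0|Hk0].
  - assert (E : INR (Z.to_nat k) = IZR k) by (rewrite INR_IZR_INZ, Z2Nat.id; auto).
    destruct Hk as [-> | ->].
    + exists (4 * Z.to_nat k + 0)%nat. unfold c. destruct (Hq (Z.to_nat k) 0%nat) as [-> ->]; [lia|]. now rewrite E.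
    + exists (4 * Z.to_nat k + 2)%nat. unfold c. destruct (Hq (Z.to_nat k) 2%nat) as [-> ->]; [lia|]. now rewrite E.
  - assert (E : INR (Z.to_nat (- k)) = - IZR k) by (rewrite INR_IZR_INZ, Z2Nat.id, opp_IZR; auto; lia).
    destruct Hk as [-> | ->].
    + exists (4 * Z.to_nat (- k) + 1)%nat. unfold c. destruct (Hq (Z.to_nat (- k)) 1%nat) as [-> ->]; [lia|].
      rewrite E. ring.
    + exists (4 * Z.to_nat (- k) + 3)%nat. unfold c. destruct (Hq (Z.to_nat (- k)) 3%nat) as [-> ->]; [lia|].
      rewrite E. ring.
Qed.

Lemma Cmod_minus_le (z : R -> C) s t a b : Rabs (Re (z t) - Re (z s)) <= a -> Rabs (Im (z t) - Im (z s)) <= b ->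
  Cmod (z t - z s)%C <= a + b.
Proof.
  intros Ha Hb. eapply Rle_trans; [apply Cmod_le_Rabs|].
  change (Re (z t - z s)%C) with (Re (z t) - Re (z s)). change (Im (z t - z s)%C) with (Im (z t) - Im (z s)). lra.
Qed.

(** The initial error is rotated, which costs at most [2 * d] in each coordinate, and the drift from
    the exact rotation adds at most [2 * m * T]. *)
Lemma near_circle_of r0 k z phi tc T B m d : near_rotation z tc (tc + T) B m -> 0 <= m ->
  Rabs (Re (z tc) - r0 * cos phi) <= d -> Rabs (Im (z tc) - r0 * sin phi) <= d ->
  2 * d + 2 * m * T <= k -> near_circle r0 k z (phi - tc) tc (tc + T).
Proof.
  intros Hz Hm Hx Hy Hk t Ht.
  destruct (near_rotation_close _ _ _ _ _ Hz tc t) as [H1 H2]; try lra.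
  replace (phi - tc + t) with (phi + (t - tc)) by ring. rewrite cos_plus, sin_plus.
  set (s := t - tc) in *.
  assert (Hs : 2 * m * s <= 2 * m * T) by (apply Rmult_le_compat_l; unfold s; lra).
  assert (Hsin : Rabs (sin s) <= 1) by (apply Rabs_le; generalize (SIN_bound s); lra).
  assert (Hcos : Rabs (cos s) <= 1) by (apply Rabs_le; generalize (COS_bound s); lra).
  assert (Hlin : forall a b, Rabs a <= 1 -> Rabs b <= 1 ->
     Rabs ((Re (z tc) - r0 * cos phi) * a + (Im (z tc) - r0 * sin phi) * b) <= 2 * d).
  { intros a b Ha Hb. eapply Rle_trans; [apply Rabs_triang|]. rewrite !Rabs_mult.
    generalize (Rabs_pos (Re (z tc) - r0 * cos phi)) (Rabs_pos (Im (z tc) - r0 * sin phi)) (Rabs_pos a) (Rabs_pos b). nra. }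
  split.
  - replace (Re (z t) - r0 * (cos phi * cos s - sin phi * sin s)) with
      ((Re (z t) - (Re (z tc) * cos s - Im (z tc) * sin s)) +
       ((Re (z tc) - r0 * cos phi) * cos s + (Im (z tc) - r0 * sin phi) * (- sin s))) by ring.
    eapply Rle_trans; [apply Rabs_triang|].
    assert (K := Hlin (cos s) (- sin s) Hcos). rewrite Rabs_Ropp in K. specialize (K Hsin). lra.
  - replace (Im (z t) - r0 * (sin phi * cos s + cos phi * sin s)) with
      ((Im (z t) - (Re (z tc) * sin s + Im (z tc) * cos s)) +
       ((Re (z tc) - r0 * cos phi) * sin s + (Im (z tc) - r0 * sin phi) * cos s)) by ring.
    eapply Rle_trans; [apply Rabs_triang|].
    assert (K := Hlin (sin s) (cos s) Hsin Hcos). lra.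
Qed.

(** * The arcs above and below the line *)

Section Arcs.

Variables al a1 b0 b2 b4 : R.

(** The polynomial field is only locally Lipschitz, so [h] is first evaluated at clamped coordinates
    and Picard's theorem applied. The solution then stays close to a rotation: its coordinates are
    at most [x0 + 2] plus a drift that the bound [/ (64 * M)] keeps below 1. Hence it remains in the
    box, where the clamping has no effect. *)
Lemma upper_arc x0 : 0 < x0 -> exists M e, 0 < M /\ 0 < e /\ forall eps x1, Rabs eps < e -> Rabs x1 <= x0 + 1 ->
  exists z : R -> C, z 0 = (x1, 1) /\
    near_rotation z 0 8 (x0 + 3) (Rabs eps * M) /\
    (exists K, 0 <= K /\ forall s t, s <= t -> Cmod (z t - z s)%C <= K * (t - s)) /\
    (forall t, 0 <= t <= 8 -> Rabs (Re (z t)) < x0 + 3 /\ Rabs (Im (z t)) < x0 + 3) /\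
    (forall t, 0 < t < 8 -> follows (fre a1 b2 b4 eps) (fim a1 b0 b2 b4 eps) z t).
Proof.
  intros Hx0. set (B := x0 + 3).
  destruct (box_bounded_hre a1 b2 b4 B) as [M1 [HM1 H1]].
  destruct (box_bounded_him a1 b0 b2 b4 B) as [M2 [HM2 H2]].
  set (M := M1 + M2 + 1). exists M, (/ (64 * M)).
  assert (HM : 0 < M) by (unfold M; lra).
  split; auto. split; [apply Rinv_0_lt_compat; lra|].
  intros eps x1 Heps Hx1.
  assert (HeM : 32 * (Rabs eps * M) < 1).
  { assert (Rabs eps * (64 * M) < / (64 * M) * (64 * M)) by (apply Rmult_lt_compat_r; lra).
    rewrite Rinv_l in H by lra. generalize (Rabs_pos eps). nra. }
  set (cl := clamp (- B) B).
  assert (HBp : 0 < B) by (unfold B; lra).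
  assert (Hcl : forall u, Rabs (cl u) <= B).
  { intros u. apply Rabs_le. destruct (clamp_in (- B) B u); unfold cl; lra. }
  assert (Hcid : forall u, Rabs u <= B -> cl u = u).
  { intros u Hu. apply Rabs_le_between in Hu. now apply clamp_id. }
  set (F1 := fun x y => - y + eps * hre a1 b2 b4 (cl x) (cl y)).
  set (F2 := fun x y => x + eps * him a1 b0 b2 b4 (cl x) (cl y)).
  set (L := 1 + Rabs eps * M).
  assert (HL : 0 < L) by (unfold L; generalize (Rabs_pos eps); nra).
  assert (HF : forall h M' dl x y x' y', M' <= M -> Rabs dl <= Rabs (x - x') + Rabs (y - y') ->
    Rabs (h (cl x) (cl y) - h (cl x') (cl y')) <= M' * (Rabs (cl x - cl x') + Rabs (cl y - cl y')) ->
    Rabs (dl + eps * (h (cl x) (cl y) - h (cl x') (cl y'))) <= L * (Rabs (x - x') + Rabs (y - y'))).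
  { intros h M' dl x y x' y' HM' Hdl Hh. eapply Rle_trans; [apply Rabs_triang|]. rewrite Rabs_mult.
    assert (C1 := clamp_Lipschitz (- B) B x x' ltac:(lra)). assert (C2 := clamp_Lipschitz (- B) B y y' ltac:(lra)).
    fold cl in C1, C2. assert (K2 : Rabs (h (cl x) (cl y) - h (cl x') (cl y')) <= M * (Rabs (x - x') + Rabs (y - y'))).
    { eapply Rle_trans; [apply Hh|]. generalize (Rabs_pos (cl x - cl x')) (Rabs_pos (cl y - cl y')). intros.
      apply Rle_trans with (M * (Rabs (cl x - cl x') + Rabs (cl y - cl y'))).
      - apply Rmult_le_compat_r; lra.
      - apply Rmult_le_compat_l; lra. }
    apply (Rmult_le_compat_l (Rabs eps)) in K2; [|apply Rabs_pos]. unfold L. lra. }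
  assert (HF1 : forall x y x' y', Rabs (F1 x y - F1 x' y') <= L * (Rabs (x - x') + Rabs (y - y'))).
  { intros x y x' y'. destruct (H1 (cl x) (cl y) (cl x') (cl y')) as [_ K]; auto.
    replace (F1 x y - F1 x' y') with (- (y - y') + eps * (hre a1 b2 b4 (cl x) (cl y) - hre a1 b2 b4 (cl x') (cl y')))
      by (unfold F1; ring).
    apply (HF _ M1); auto; [unfold M; lra|]. rewrite Rabs_Ropp. generalize (Rabs_pos (x - x')). lra. }
  assert (HF2 : forall x y x' y', Rabs (F2 x y - F2 x' y') <= L * (Rabs (x - x') + Rabs (y - y'))).
  { intros x y x' y'. destruct (H2 (cl x) (cl y) (cl x') (cl y')) as [_ K]; auto.
    replace (F2 x y - F2 x' y') with ((x - x') + eps * (him a1 b0 b2 b4 (cl x) (cl y) - him a1 b0 b2 b4 (cl x') (cl y')))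
      by (unfold F2; ring).
    apply (HF _ M2); auto; [unfold M; lra|]. generalize (Rabs_pos (y - y')). lra. }
  destruct (picard_solution F1 F2 L x1 1 8 HL ltac:(lra) HF1 HF2) as (x & y & Hx & Hy & [K HK] & Hd).
  set (z := fun t => (x t, y t) : C).
  assert (HK0 : 0 <= K).
  { destruct (HK 0 1) as [K1 _]; [lra|]. generalize (Rabs_pos (x 1 - x 0)). lra. }
  assert (HzK : forall s t, s <= t -> Cmod (z t - z s)%C <= (K + K) * (t - s)).
  { intros s t Hst. destruct (HK s t Hst). rewrite Rmult_plus_distr_r. now apply Cmod_minus_le. }
  assert (Hac : locally_abs_continuous z).
  { apply Lipschitz_locally_abs_continuous. intros p q. exists (K + K). intros s t Hs _. apply HzK. lra. }
  destruct (continuity_bounded x 0 8 (continuity_Re z Hac)) as [B1 [HB1 HB1']].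
  destruct (continuity_bounded y 0 8 (continuity_Im z Hac)) as [B2 [HB2 HB2']].
  assert (Hnull : null_set (fun _ => False)).
  { apply null_set_subset with (fun t => exists n : nat, t = 0); [tauto|apply (null_set_range (fun _ => 0))]. }
  assert (Hnrd : exists N, null_set N /\ forall t, 0 < t < 8 -> ~ N t ->
      exists v : C, is_derive z t v /\ Rabs (Re v + Im (z t)) <= Rabs eps * M /\ Rabs (Im v - Re (z t)) <= Rabs eps * M).
  { exists (fun _ => False). split; auto. intros t Ht _. destruct (Hd t Ht) as [D1 D2].
    exists (F1 (x t) (y t), F2 (x t) (y t)). split; [now apply is_derive_pair|].
    unfold z, Re, Im, F1, F2; simpl.
    replace (- y t + eps * hre a1 b2 b4 (cl (x t)) (cl (y t)) + y t) with (eps * hre a1 b2 b4 (cl (x t)) (cl (y t))) by ring.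
    replace (x t + eps * him a1 b0 b2 b4 (cl (x t)) (cl (y t)) - x t) with (eps * him a1 b0 b2 b4 (cl (x t)) (cl (y t))) by ring.
    rewrite !Rabs_mult. split; apply Rmult_le_compat_l; try apply Rabs_pos.
    - destruct (H1 (cl (x t)) (cl (y t)) (cl (x t)) (cl (y t))) as [Q _]; auto. unfold M; lra.
    - destruct (H2 (cl (x t)) (cl (y t)) (cl (x t)) (cl (y t))) as [Q _]; auto. unfold M; lra. }
  assert (Hnr : near_rotation z 0 8 (B1 + B2) (Rabs eps * M)).
  { split; auto. intros t Ht. specialize (HB1' t Ht). specialize (HB2' t Ht).
    unfold z, Re, Im; simpl. lra. }
  assert (Hbox : forall t, 0 <= t <= 8 -> Rabs (Re (z t)) < B /\ Rabs (Im (z t)) < B).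
  { intros t Ht. destruct (near_rotation_close _ _ _ _ _ Hnr 0 t) as [E1 E2]; try lra.
    replace (Re (z 0)) with x1 in E1, E2 by (unfold z, Re; simpl; now rewrite Hx).
    replace (Im (z 0)) with 1 in E1, E2 by (unfold z, Im; simpl; now rewrite Hy).
    rewrite Rminus_0_r in E1, E2.
    assert (Ht2 : 2 * (Rabs eps * M) * t <= 16 * (Rabs eps * M)).
    { generalize (Rabs_pos eps). intros. assert (0 <= Rabs eps * M) by nra. nra. }
    assert (Hlin : forall a b, Rabs a <= 1 -> Rabs b <= 1 -> Rabs (x1 * a + b) <= x0 + 2).
    { intros a b Ha Hb. eapply Rle_trans; [apply Rabs_triang|]. rewrite Rabs_mult.
      generalize (Rabs_pos x1) (Rabs_pos a). nra. }
    assert (Hsin : Rabs (sin t) <= 1) by (apply Rabs_le; generalize (SIN_bound t); lra).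
    assert (Hcos : Rabs (cos t) <= 1) by (apply Rabs_le; generalize (COS_bound t); lra).
    assert (L1 := Hlin (cos t) (- sin t) Hcos). rewrite Rabs_Ropp in L1. specialize (L1 Hsin).
    assert (L2 := Hlin (sin t) (cos t) Hsin Hcos).
    apply Rabs_le_between in E1. apply Rabs_le_between in E2.
    apply Rabs_le_between in L1. apply Rabs_le_between in L2.
    split; apply Rabs_lt_between; unfold B; lra. }
  exists z. split; [unfold z; now rewrite Hx, Hy|]. split; [|split; [|split; [exact Hbox|]]].
  - split; auto. intros t Ht. destruct (Hbox t Ht). lra.
  - exists (K + K). split; [lra|exact HzK].
  - intros t Ht. destruct (Hd t Ht) as [D1 D2]. destruct (Hbox t ltac:(lra)) as [Q1 Q2].
    unfold F1 in D1. unfold F2 in D2.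
    rewrite (Hcid (x t)), (Hcid (y t)) in D1, D2 by (left; assumption). now split.
Qed.

(** The bound on eps gives [Rabs (eps * al) <= 1], so over a time 8 the exponential factor is at
    most [exp 8]; this is the origin of [B]. *)
Lemma lower_arc x0 : 0 < x0 -> exists M e B, 0 < M /\ 0 < e /\ forall eps x1, Rabs eps < e -> Rabs x1 <= x0 + 1 ->
    near_rotation (spiral (eps * al) x1) 0 8 B (Rabs eps * M) /\
    exists K, 0 <= K /\ forall s t, 0 <= s <= t -> t <= 8 ->
      Cmod (spiral (eps * al) x1 t - spiral (eps * al) x1 s)%C <= K * (t - s).
Proof.
  intros Hx0. assert (Pa := Rabs_pos al).
  set (B := exp 8 * (x0 + 2)). assert (He8 := exp_pos 8).
  assert (HB : 0 < B) by (unfold B; nra).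
  exists ((Rabs al + 1) * B), (/ (Rabs al + 1)), B. split; [nra|]. split; [apply Rinv_0_lt_compat; lra|].
  intros eps x1 Heps Hx1. set (w := spiral (eps * al) x1).
  assert (Hd : forall s, follows (gre al eps) (gim al eps) w s) by (intros; apply spiral_derive).
  destruct (spiral_continuity al eps x1) as [C1 C2]. fold w in C1, C2.
  assert (C3 : continuity (fun s => gre al eps (Re (w s)) (Im (w s)))).
  { unfold gre. apply continuity_plus; [now apply continuity_opp|]. do 2 apply continuity_scal. auto. }
  assert (C4 : continuity (fun s => gim al eps (Re (w s)) (Im (w s)))).
  { unfold gim. apply continuity_plus; auto. do 2 apply continuity_scal. auto. }
  assert (HLip : forall p q, exists L, 0 <= L /\ forall s t, p <= s <= t -> t <= q -> Cmod (w t - w s)%C <= L * (t - s)).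
  { intros p q. destruct (continuity_bounded _ p q C3) as [L1 [HL1 HL1']].
    destruct (continuity_bounded _ p q C4) as [L2 [HL2 HL2']].
    exists (L1 + L2). split; [lra|]. intros s t Hs Ht. rewrite Rmult_plus_distr_r. apply Cmod_minus_le.
    - apply (Lipschitz_of_derive (fun s => Re (w s)) (fun s => gre al eps (Re (w s)) (Im (w s))) L1 p q); auto. intros; apply Hd.
    - apply (Lipschitz_of_derive (fun s => Im (w s)) (fun s => gim al eps (Re (w s)) (Im (w s))) L2 p q); auto. intros; apply Hd. }
  assert (Hk : Rabs (eps * al) <= 1).
  { rewrite Rabs_mult. assert (Rabs eps * (Rabs al + 1) < / (Rabs al + 1) * (Rabs al + 1)) by (apply Rmult_lt_compat_r; lra).
    rewrite Rinv_l in H by lra. generalize (Rabs_pos eps). nra. }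
  assert (Hbox : forall t, 0 <= t <= 8 -> Rabs (Re (w t)) <= B /\ Rabs (Im (w t)) <= B).
  { intros t Ht. assert (HE : 0 < exp (eps * al * t) <= exp 8).
    { split; [apply exp_pos|]. apply Rabs_le_between in Hk.
      destruct (Req_dec (eps * al * t) 8) as [->|]; [lra|]. left. apply exp_increasing. nra. }
    assert (Hlin : forall a b, Rabs a <= 1 -> Rabs b <= 1 -> Rabs (- x1 * a + b) <= x0 + 2).
    { intros a b Ha Hb. eapply Rle_trans; [apply Rabs_triang|]. rewrite Rabs_mult, Rabs_Ropp.
      generalize (Rabs_pos x1) (Rabs_pos a). nra. }
    assert (Hsin : Rabs (sin t) <= 1) by (apply Rabs_le; generalize (SIN_bound t); lra).
    assert (Hcos : Rabs (cos t) <= 1) by (apply Rabs_le; generalize (COS_bound t); lra).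
    assert (L1 := Hlin (cos t) (- sin t) Hcos). rewrite Rabs_Ropp in L1. specialize (L1 Hsin).
    assert (L2 := Hlin (sin t) (cos t) Hsin Hcos).
    unfold w, spiral, Re, Im; simpl. rewrite !Rabs_mult, (Rabs_pos_eq (exp _)) by lra.
    split; apply Rmult_le_compat; try apply Rabs_pos; try lra; auto. }
  split.
  - split; auto.
    + apply Lipschitz_locally_abs_continuous. intros p q. destruct (HLip p q) as [L [_ H]]. now exists L.
    + exists (fun _ => False). split.
      { apply null_set_subset with (fun t => exists n : nat, t = 0); [tauto|apply (null_set_range (fun _ => 0))]. }
      intros t Ht _. exists (gre al eps (Re (w t)) (Im (w t)), gim al eps (Re (w t)) (Im (w t))).
      destruct (Hd t) as [D1 D2]. split.
      * apply (is_derive_ext (fun s => (Re (w s), Im (w s)) : C)); [intros s; now destruct (w s)|].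
        now apply is_derive_pair.
      * destruct (Hbox t ltac:(lra)) as [Q1 Q2].
        change (Re (gre al eps (Re (w t)) (Im (w t)), gim al eps (Re (w t)) (Im (w t)))) with (gre al eps (Re (w t)) (Im (w t))).
        change (Im (gre al eps (Re (w t)) (Im (w t)), gim al eps (Re (w t)) (Im (w t)))) with (gim al eps (Re (w t)) (Im (w t))).
        unfold gre, gim.
        replace (- Im (w t) + eps * (al * Re (w t)) + Im (w t)) with (eps * (al * Re (w t))) by ring.
        replace (Re (w t) + eps * (al * Im (w t)) - Re (w t)) with (eps * (al * Im (w t))) by ring.
        rewrite !Rabs_mult. split; apply Rmult_le_compat_l; try apply Rabs_pos;
          apply Rmult_le_compat; try apply Rabs_pos; lra.
  - destruct (HLip 0 8) as [L [HL1 HL2]]. exists L. split; auto.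
Qed.

End Arcs.

(** * Periodic extension of a closed arc *)

Definition period_index (T t : R) : Z := Int_part (t / T).

Lemma period_index_spec T t : 0 < T ->
  IZR (period_index T t) * T <= t < (IZR (period_index T t) + 1) * T.
Proof.
  intros HT. destruct (base_Int_part (t / T)) as [H1 H2]. unfold period_index.
  set (n := IZR (Int_part (t / T))) in *.
  replace t with (t / T * T) by (field; lra).
  replace (t / T * T / T) with (t / T) by (field; lra). fold n. split.
  - apply Rmult_le_compat_r; lra.
  - apply Rmult_lt_compat_r; lra.
Qed.

Lemma period_index_unique T t k : 0 < T -> IZR k * T <= t < (IZR k + 1) * T -> period_index T t = k.
Proof.
  intros HT Hk. destruct (period_index_spec T t HT) as [H1 H2].
  set (n := period_index T t) in *.
  assert (IZR k < IZR n + 1) by (apply Rmult_lt_reg_r with T; lra).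
  assert (IZR n < IZR k + 1) by (apply Rmult_lt_reg_r with T; lra).
  rewrite <- plus_IZR in *. apply lt_IZR in H. apply lt_IZR in H0. lia.
Qed.

Section PeriodicExtension.

Variables (zeta : R -> C) (T : R).
Hypothesis HT : 0 < T.
Hypothesis Hclosed : zeta T = zeta 0.

Definition periodic_extension (t : R) : C := zeta (t - IZR (period_index T t) * T).

(** At the right end of a period the index has already moved on, and [Hclosed] identifies the two
    values. Having the formula on closed intervals lets Lipschitz bounds be added across periods. *)
Lemma periodic_extension_eq k t : IZR k * T <= t <= (IZR k + 1) * T ->
  periodic_extension t = zeta (t - IZR k * T).
Proof.
  intros H. unfold periodic_extension. destruct (Req_dec t ((IZR k + 1) * T)) as [E|E].
  - rewrite (period_index_unique T t (k + 1)); auto; rewrite plus_IZR.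
    + rewrite E. replace ((IZR k + 1) * T - (IZR k + 1) * T) with 0 by ring.
      replace ((IZR k + 1) * T - IZR k * T) with T by ring. now rewrite Hclosed.
    + rewrite E. split; [lra|]. nra.
  - rewrite (period_index_unique T t k); auto. lra.
Qed.

Lemma periodic_extension_period t : periodic_extension (t + T) = periodic_extension t.
Proof.
  set (k := period_index T t). assert (H := period_index_spec T t HT). fold k in H.
  rewrite (periodic_extension_eq k t) by lra.
  rewrite (periodic_extension_eq (k + 1) (t + T)); rewrite plus_IZR; [f_equal; ring|lra].
Qed.

Lemma periodic_extension_Lipschitz K : 0 <= K ->
  (forall s t, 0 <= s <= t -> t <= T -> Cmod (zeta t - zeta s)%C <= K * (t - s)) ->
  forall s t, s <= t -> Cmod (periodic_extension t - periodic_extension s)%C <= K * (t - s).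
Proof.
  intros HK HL s t Hst.
  assert (Hpiece : forall k s t, IZR k * T <= s <= t -> t <= (IZR k + 1) * T ->
    Cmod (periodic_extension t - periodic_extension s)%C <= K * (t - s)).
  { intros k u v Hu Hv. rewrite !(periodic_extension_eq k) by lra.
    replace (v - u) with ((v - IZR k * T) - (u - IZR k * T)) by ring. apply HL; lra. }
  set (k := period_index T s). assert (H := period_index_spec T s HT). fold k in H.
  assert (Hn : forall n t, s <= t <= (IZR k + 1 + INR n) * T ->
    Cmod (periodic_extension t - periodic_extension s)%C <= K * (t - s)).
  { induction n as [|n IH]; intros u Hu.
    - simpl in Hu. apply (Hpiece k); lra.
    - rewrite S_INR in Hu. set (m := (IZR k + 1 + INR n) * T).
      destruct (Rle_lt_dec u m) as [Hle|Hlt]; [apply IH; split; unfold m in Hle; lra|].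
      assert (Hsm : s <= m) by (unfold m; generalize (pos_INR n); nra).
      assert (H1 := IH m (conj Hsm (Rle_refl _))).
      assert (H2 : Cmod (periodic_extension u - periodic_extension m)%C <= K * (u - m)).
      { apply (Hpiece (k + 1 + Z.of_nat n)%Z); rewrite !plus_IZR, <- INR_IZR_INZ; fold m; unfold m in *; lra. }
      replace (periodic_extension u - periodic_extension s)%C with
        ((periodic_extension u - periodic_extension m) + (periodic_extension m - periodic_extension s))%C by ring.
      eapply Rle_trans; [apply Cmod_triangle|]. lra. }
  destruct (INR_unbounded ((t - s) / T)) as [n Hnn].
  apply (Hn n). split; auto.
  apply Rmult_lt_compat_r with (r := T) in Hnn; auto.
  replace ((t - s) / T * T) with (t - s) in Hnn by (field; lra). nra.
Qed.

End PeriodicExtension.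

Section Concatenation.

Variables al a1 b0 b2 b4 eps : R.

(** The matching end points make the concatenation Lipschitz, hence absolutely continuous. The
    inclusion is verified away from the joints, which form a null set, so nothing is required of the
    velocity on the switching line. *)
Lemma periodic_concatenation (zu w : R -> C) (t1 sg K : R) : 0 < t1 -> 0 < sg -> 0 <= K ->
  (forall s t, 0 <= s <= t -> t <= t1 -> Cmod (zu t - zu s)%C <= K * (t - s)) ->
  (forall s t, 0 <= s <= t -> t <= sg -> Cmod (w t - w s)%C <= K * (t - s)) ->
  zu t1 = w 0 -> w sg = zu 0 ->
  (forall t, 0 < t < t1 -> 1 < Im (zu t) /\
     follows (fre a1 b2 b4 eps) (fim a1 b0 b2 b4 eps) zu t) ->
  (forall t, 0 < t < sg -> Im (w t) < 1 /\
     follows (gre al eps) (gim al eps) w t) ->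
  exists z : R -> C, filippov_solution eps (coefA al a1) (coefB b0 b2 b4) z /\
    (forall t, z (t + (t1 + sg)) = z t) /\ (forall t, 0 <= t <= t1 -> z t = zu t) /\
    (forall t, (exists s, 0 <= s <= t1 /\ z t = zu s) \/ (exists s, 0 <= s <= sg /\ z t = w s)).
Proof.
  intros Ht1 Hsg HK HLu HLw E1 E2 Hu Hw.
  set (T := t1 + sg). assert (HT : 0 < T) by (unfold T; lra).
  set (zeta := fun t => if Rle_dec t t1 then zu t else w (t - t1)).
  assert (Zu : forall t, t <= t1 -> zeta t = zu t).
  { intros t Ht. unfold zeta. destruct (Rle_dec t t1); [auto|lra]. }
  assert (Zw : forall t, t1 <= t -> zeta t = w (t - t1)).
  { intros t Ht. unfold zeta. destruct (Rle_dec t t1); auto.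
    replace t with t1 by lra. now rewrite Rminus_diag. }
  assert (Hcl : zeta T = zeta 0).
  { rewrite Zw, Zu by (unfold T; lra). replace (T - t1) with sg by (unfold T; ring). auto. }
  assert (HL : forall s t, 0 <= s <= t -> t <= T -> Cmod (zeta t - zeta s)%C <= K * (t - s)).
  { intros s t Hs Ht. destruct (Rle_lt_dec t t1) as [H1|H1]; [|destruct (Rle_lt_dec s t1) as [H2|H2]].
    - rewrite !Zu by lra. apply HLu; lra.
    - rewrite (Zw t), (Zu s) by lra.
      replace (w (t - t1)%R - zu s)%C with ((w (t - t1)%R - w 0%R) + (zu t1 - zu s))%C by (rewrite E1; ring).
      eapply Rle_trans; [apply Cmod_triangle|].
      assert (K1 := HLw 0 (t - t1) ltac:(lra) ltac:(unfold T in Ht; lra)). assert (K2 := HLu s t1 ltac:(lra) ltac:(lra)). lra.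
    - rewrite !Zw by lra. replace (t - s) with ((t - t1) - (s - t1)) by ring. apply HLw; unfold T in Ht; lra. }
  set (z := periodic_extension zeta T).
  exists z. split; [|split; [|split]].
  - split.
    + apply Lipschitz_locally_abs_continuous. intros p q. exists K. intros s t Hs _.
      apply periodic_extension_Lipschitz; auto. lra.
    + apply null_set_subset with (2 := null_set_periodic T t1). intros t Hn. apply NNPP. intros Hk.
      apply Hn. clear Hn. set (k := period_index T t). assert (Hi := period_index_spec T t HT). fold k in Hi.
      assert (Hk1 : t <> IZR k * T) by (intros E; apply Hk; exists k; auto).
      assert (Hk2 : t <> IZR k * T + t1) by (intros E; apply Hk; exists k; auto).
      set (a := IZR k * T) in *.
      assert (Dsh : forall (f : R -> R) d, is_derive f (t - a) d -> is_derive (fun s => f (s - a)) t d).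
      { intros f d Hf. rewrite <- (Rmult_1_l d). apply (is_derive_comp f (fun s => s - a)); auto.
        auto_derive; auto. }
      assert (Hloc : forall (v : R -> C) d1 d2 lo hi, lo < t < hi -> (forall s, lo < s < hi -> z s = v (s - a)) ->
         is_derive (fun s => Re (v s)) (t - a) d1 -> is_derive (fun s => Im (v s)) (t - a) d2 ->
         is_derive z t (d1, d2)).
      { intros v d1 d2 lo hi Ht Hv D1 D2.
        apply (is_derive_ext_loc (fun s => (Re (v (s - a)), Im (v (s - a))) : C)).
        - apply (locally_open_interval _ lo hi); auto. intros s Hs. rewrite Hv by auto. now destruct (v (s - a)).
        - apply is_derive_pair; [apply (Dsh (fun s => Re (v s)))|apply (Dsh (fun s => Im (v s)))]; auto. }
      destruct (Rle_lt_dec t (a + t1)) as [H1|H1].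
      * assert (Hzt : z t = zu (t - a)).
        { unfold z. rewrite (periodic_extension_eq zeta T HT Hcl k t) by (unfold a in *; lra). apply Zu. unfold a in *; lra. }
        destruct (Hu (t - a) ltac:(lra)) as (K1 & D1 & D2).
        exists (fre a1 b2 b4 eps (Re (zu (t - a))) (Im (zu (t - a))), fim a1 b0 b2 b4 eps (Re (zu (t - a))) (Im (zu (t - a)))).
        rewrite Hzt. split; [|now apply filippov_above].
        apply (Hloc zu _ _ a (a + t1)); auto; [lra|].
        intros s Hs. unfold z. rewrite (periodic_extension_eq zeta T HT Hcl k s).
        -- apply Zu. unfold a in *; lra.
        -- unfold T in *; unfold a in *; lra.
      * assert (Hzt : z t = w (t - (a + t1))).
        { unfold z. rewrite (periodic_extension_eq zeta T HT Hcl k t) by (unfold a in *; lra). fold a. rewrite Zw by lra. f_equal; ring. }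
        destruct (Hw (t - (a + t1)) ltac:(unfold T in *; unfold a in *; lra)) as (K1 & D1 & D2).
        exists (gre al eps (Re (w (t - (a + t1)))) (Im (w (t - (a + t1)))), gim al eps (Re (w (t - (a + t1)))) (Im (w (t - (a + t1))))).
        rewrite Hzt. split; [|now apply filippov_below].
        apply (Hloc (fun s => w (s - t1)) _ _ (a + t1) (a + T)); auto.
        -- unfold T in *; unfold a in *; lra.
        -- intros s Hs. unfold z. rewrite (periodic_extension_eq zeta T HT Hcl k s).
           ++ fold a. rewrite Zw by lra. reflexivity.
           ++ unfold T in *; unfold a in *; lra.
        -- replace (t - (a + t1)) with (t - a - t1) in * by ring.
           apply (is_derive_comp (fun s => Re (w s)) (fun s => s - t1)) with (dg := 1) in D1.
           ++ unfold scal in D1; simpl in D1; unfold mult in D1; simpl in D1. now rewrite Rmult_1_l in D1.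
           ++ auto_derive; auto.
        -- replace (t - (a + t1)) with (t - a - t1) in * by ring.
           apply (is_derive_comp (fun s => Im (w s)) (fun s => s - t1)) with (dg := 1) in D2.
           ++ unfold scal in D2; simpl in D2; unfold mult in D2; simpl in D2. now rewrite Rmult_1_l in D2.
           ++ auto_derive; auto.
  - intros t. now apply periodic_extension_period.
  - intros t Ht. unfold z. rewrite (periodic_extension_eq zeta T HT Hcl 0 t) by (unfold T; lra).
    replace (t - 0 * T) with t by ring. apply Zu. lra.
  - intros t. set (k := period_index T t). assert (Hi := period_index_spec T t HT). fold k in Hi.
    unfold z. rewrite (periodic_extension_eq zeta T HT Hcl k t) by lra.
    set (s := t - IZR k * T). assert (Hs : 0 <= s <= t1 + sg) by (unfold s, T in *; lra).
    destruct (Rle_lt_dec s t1) as [H|H].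
    + left. exists s. split; [lra|]. now apply Zu.
    + right. exists (s - t1). split; [lra|]. apply Zw. lra.
Qed.

End Concatenation.

(** * Nearby periodic orbits *)

Section Cycle.

Variables al a1 b0 b2 b4 x0 : R.
Hypothesis Hx0 : 0 < x0.

Definition r0 : R := sqrt (1 + x0 ^ 2).
(** Half the angle between the vertical axis and the crossing point [x0 + i], which has argument
    [PI / 2 - 2 * eta]. At angular distance [eta] from the axis the circle is still strictly above
    the line and already strictly off the axis. *)
Definition eta : R := atan x0 / 2.

Lemma r0_bounds : 1 < r0 <= x0 + 1.
Proof.
  unfold r0. split.
  - rewrite <- sqrt_1 at 1. apply sqrt_lt_1; nra.
  - rewrite <- (sqrt_square (x0 + 1)) by lra. apply sqrt_le_1; nra.
Qed.

Lemma r0_sq : r0 * r0 = 1 + x0 ^ 2.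
Proof. unfold r0. apply sqrt_sqrt. nra. Qed.

Lemma eta_bounds : 0 < eta < PI / 4.
Proof.
  unfold eta. assert (B := atan_bound x0).
  assert (0 < atan x0) by (rewrite <- atan_0; now apply atan_increasing). lra.
Qed.

Lemma r0_cos_sin : r0 * cos (2 * eta) = 1 /\ r0 * sin (2 * eta) = x0.
Proof.
  replace (2 * eta) with (atan x0) by (unfold eta; field).
  rewrite cos_atan, sin_atan, Rsqr_pow2. fold r0. generalize r0_bounds. intros. split; field; lra.
Qed.

Lemma r0_cos_eta : 1 < r0 * cos eta.
Proof.
  destruct r0_cos_sin as [H _]. rewrite <- H at 1. generalize r0_bounds eta_bounds PI_RGT_0. intros.
  apply Rmult_lt_compat_l; [lra|]. apply cos_decreasing_1; lra.
Qed.

Lemma r0_sin_eta : 0 < r0 * sin eta.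
Proof.
  generalize r0_bounds eta_bounds PI_RGT_0. intros.
  apply Rmult_lt_0_compat; [lra|]. apply sin_gt_0; lra.
Qed.

Lemma reference_upper : r0 * cos (PI / 2 - 2 * eta) = x0 /\ r0 * sin (PI / 2 - 2 * eta) = 1.
Proof. rewrite cos_shift, sin_shift. generalize r0_cos_sin. tauto. Qed.

Lemma reference_lower : r0 * cos (PI / 2 + 2 * eta) = - x0 /\ r0 * sin (PI / 2 + 2 * eta) = 1.
Proof.
  destruct r0_cos_sin as [H1 H2]. rewrite cos_plus, sin_plus, cos_PI2, sin_PI2. split; lra.
Qed.

Definition near_orbit (k : R) (w : C) : Prop :=
  exists a, Rabs (Re w - r0 * cos a) <= k /\ Rabs (Im w - r0 * sin a) <= k.

Lemma near_orbit_le k k' w : k <= k' -> near_orbit k w -> near_orbit k' w.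
Proof. intros Hk [a [H1 H2]]. exists a. split; lra. Qed.

Lemma near_orbit_box k w : k <= 1 -> near_orbit k w -> Rabs (Re w) < x0 + 3 /\ Rabs (Im w) < x0 + 3.
Proof.
  intros Hk [a [H1 H2]]. generalize r0_bounds (COS_bound a) (SIN_bound a). intros.
  apply Rabs_le_between in H1. apply Rabs_le_between in H2. split; apply Rabs_lt_between; nra.
Qed.

(** Squares are compared: each squared coordinate is off by at most [k * (2 * r0 + 1)], so with
    [Im w = 1] the square of [Re w] differs from [x0 * x0] by at most [rho * x0]. Dividing by
    [Rabs (Re w) + x0], which is at least [x0], gives the bound. *)
Lemma near_orbit_line rho : 0 < rho -> exists k, 0 < k <= 1 /\
  forall w, near_orbit k w -> Im w = 1 -> Rabs (Rabs (Re w) - x0) <= rho.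
Proof.
  intros Hrho. generalize r0_bounds. intros Hr.
  exists (Rmin 1 (rho * x0 / (2 * (2 * r0 + 1)))). split.
  { split; [|apply Rmin_l]. apply Rmin_glb_lt; [lra|]. apply Rdiv_lt_0_compat; nra. }
  intros w [a [H1 H2]] Hw. rewrite Hw in H2.
  set (k := Rmin 1 (rho * x0 / (2 * (2 * r0 + 1)))) in *.
  assert (K1 : k <= 1) by apply Rmin_l.
  assert (K2 : k * (2 * (2 * r0 + 1)) <= rho * x0).
  { apply Rle_trans with (rho * x0 / (2 * (2 * r0 + 1)) * (2 * (2 * r0 + 1))).
    - apply Rmult_le_compat_r; [lra|apply Rmin_r].
    - right; field; lra. }
  assert (Hc := COS_bound a). assert (Hs := SIN_bound a).
  assert (Hsc := sin2_cos2 a). unfold Rsqr in Hsc.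
  assert (Hk0 : 0 <= k) by (generalize (Rabs_pos (Re w - r0 * cos a)); lra).
  assert (Hsq : forall u c, Rabs (u - r0 * c) <= k -> -1 <= c <= 1 -> Rabs (u * u - r0 * r0 * (c * c)) <= k * (2 * r0 + 1)).
  { intros u c Hu Hc'. replace (u * u - r0 * r0 * (c * c)) with ((u - r0 * c) * ((u - r0 * c) + 2 * r0 * c)) by ring.
    rewrite Rabs_mult. apply Rmult_le_compat; try apply Rabs_pos; auto.
    apply Rabs_le_between in Hu. apply Rabs_le. nra. }
  assert (Q1 := Hsq _ _ H1 Hc). assert (Q2 := Hsq _ _ H2 Hs).
  assert (Q3 : Rabs (Re w * Re w - x0 * x0) <= rho * x0).
  { replace (Re w * Re w - x0 * x0) with
      ((Re w * Re w - r0 * r0 * (cos a * cos a)) + (1 * 1 - r0 * r0 * (sin a * sin a))).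
    - eapply Rle_trans; [apply Rabs_triang|]. lra.
    - assert (r0 * r0 * (cos a * cos a) + r0 * r0 * (sin a * sin a) = 1 + x0 ^ 2); [|lra].
      rewrite <- r0_sq. transitivity (r0 * r0 * (sin a * sin a + cos a * cos a)); [ring|rewrite Hsc; ring]. }
  assert (Hp := Rabs_pos (Re w)).
  assert (E : Re w * Re w = Rabs (Re w) * Rabs (Re w)) by (rewrite <- Rabs_mult; symmetry; apply Rabs_pos_eq; nra).
  rewrite E in Q3. set (u := Rabs (Re w)) in *.
  replace (u * u - x0 * x0) with ((u - x0) * (u + x0)) in Q3 by ring.
  rewrite Rabs_mult, (Rabs_pos_eq (u + x0)) in Q3 by lra.
  apply Rmult_le_reg_r with x0; auto. generalize (Rabs_pos (u - x0)). nra.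
Qed.

Lemma near_circle_near_orbit k z phi p q t : near_circle r0 k z phi p q -> p <= t <= q -> near_orbit k (z t).
Proof. intros H Ht. exists (phi + t). now apply H. Qed.

End Cycle.

Lemma near_rotation_le z p q B m m' : m <= m' -> near_rotation z p q B m -> near_rotation z p q B m'.
Proof.
  intros Hm [H1 H2 [N [HN H3]]]. split; auto. exists N. split; auto. intros t Ht Hn.
  destruct (H3 t Ht Hn) as (v & Hv & K1 & K2). exists v. split; auto. lra.
Qed.


Lemma cos_sin_period_Z a k : cos (a - IZR k * (2 * PI)) = cos a /\ sin (a - IZR k * (2 * PI)) = sin a.
Proof.
  destruct (Z.le_gt_cases 0 k) as [H|H].
  - rewrite <- (Z2Nat.id k), <- INR_IZR_INZ by auto. set (n := Z.to_nat k).
    set (b := a - INR n * (2 * PI)). replace a with (b + 2 * INR n * PI) by (unfold b; ring).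
    now rewrite cos_period, sin_period.
  - replace k with (- Z.of_nat (Z.to_nat (- k)))%Z by (rewrite Z2Nat.id; lia).
    rewrite opp_IZR, <- INR_IZR_INZ. set (n := Z.to_nat (- k)).
    replace (a - - INR n * (2 * PI)) with (a + 2 * INR n * PI) by ring.
    now rewrite cos_period, sin_period.
Qed.

(** * Laps, the increasing return map and uniqueness of the periodic orbit *)

Section Dynamics.

Variables al a1 b0 b2 b4 x0 : R.
Hypothesis Hx0 : 0 < x0.

Notation r0 := (r0 x0).
Notation eta := (eta x0).
Notation lpot := (line_potential a1 b0 b2 b4).

Variables rho kp c kg : R.
Hypothesis Hrho : rho <= x0 / 2.
Hypothesis Hkp : 0 < kp <= 1.
Hypothesis Hcos : 1 < r0 * cos eta - kp.
Hypothesis Hsin : c <= r0 * sin eta - kp.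
Hypothesis Hc : 0 < c.
Hypothesis Hline : forall w, near_orbit x0 kp w -> Im w = 1 -> Rabs (Rabs (Re w) - x0) <= rho.
Hypothesis Hkg : 0 < kg <= kp / 8.
Hypothesis Hlineg : forall w, near_orbit x0 kg w -> Im w = 1 -> Rabs (Rabs (Re w) - x0) <= kp / 8.

Variables eps m : R.
Hypothesis Hm0 : 0 <= m.
Hypothesis Hm : 48 * m <= kp / 4.
Hypothesis Hmc : m < c.
Hypothesis Hbound : forall z v, Rabs (Re z) <= x0 + 3 -> Rabs (Im z) <= x0 + 3 ->
  filippov eps (coefA al a1) (coefB b0 b2 b4) z v ->
  Rabs (Re v + Im z) <= m /\ Rabs (Im v - Re z) <= m.
Hypothesis Hden : forall x y, in_rect (x0 + 3) x y -> den a1 b0 b2 b4 eps x y <> 0.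
Hypothesis Hmono : forall x y, x0 - rho <= x < y -> y <= x0 + rho ->
     lpot eps y < lpot eps x /\ lpot eps (- y) < lpot eps (- x) /\
     half_ln x + eps * al * atan x < half_ln y + eps * al * atan y /\
     half_ln x - eps * al * atan x < half_ln y - eps * al * atan y.

(** Closeness [kg] is to the circle as a set, with no control of the phase. By [Hlineg] it places
    each crossing within [kp / 8] of the reference point, and after the drift over a lap the
    solution is still [kp]-close to a timed reference. *)
Definition good (z : R -> C) : Prop :=
  filippov_solution eps (coefA al a1) (coefB b0 b2 b4) z /\ forall t, near_orbit x0 kg (z t).

Definition crossing (z : R -> C) (t : R) : Prop := Im (z t) = 1 /\ 0 < Re (z t).

Lemma good_box z t : good z -> Rabs (Re (z t)) < x0 + 3 /\ Rabs (Im (z t)) < x0 + 3.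
Proof. intros [_ H]. apply (near_orbit_box x0 Hx0 kg); auto. lra. Qed.

Lemma good_near_rotation z p q : good z -> near_rotation z p q (x0 + 3) m.
Proof.
  intros Hz. destruct Hz as [[Hac HN] Hn] eqn:E. clear E. split; auto.
  - intros t _. destruct (good_box z t Hz). lra.
  - eexists. split; [apply HN|]. intros t Ht H. apply NNPP in H. destruct H as [v [Hv1 Hv2]].
    exists v. split; auto. destruct (good_box z t Hz). apply Hbound; auto; lra.
Qed.

Record lap (z : R -> C) (tc t1 t2 : R) : Prop := {
  lap_start : crossing z tc;
  lap_lt1 : tc < t1;
  lap_lt2 : t1 + 1 < t2;
  lap_mid : Im (z t1) = 1 /\ Re (z t1) < 0;
  lap_end : crossing z t2;
  lap_above : forall t, tc < t < t1 -> 1 < Im (z t);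
  lap_below : forall t, t1 < t < t2 -> Im (z t) < 1;
  lap_near0 : Rabs (Re (z tc) - x0) <= rho;
  lap_near1 : Rabs (- Re (z t1) - x0) <= rho;
  lap_near2 : Rabs (Re (z t2) - x0) <= rho;
  lap_upper : lpot eps (Re (z tc)) = lpot eps (Re (z t1));
  lap_lower : half_ln (Re (z t2)) - half_ln (- Re (z t1)) =
    eps * al * (2 * PI - atan (Re (z t2)) - atan (- Re (z t1))) }.

(** The timed reference is restarted at each crossing of the line, so the phase error does not
    accumulate from one half lap to the next. *)
Lemma lap_exists z tc : good z -> crossing z tc -> exists t1 t2, lap z tc t1 t2.
Proof.
  intros Hz [Hy Hx]. assert (Hr0 := r0_bounds x0 Hx0). assert (He := eta_bounds x0 Hx0).
  assert (Hnk : forall t, near_orbit x0 kp (z t)).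
  { intros t. apply near_orbit_le with kg; [lra|]. apply Hz. }
  assert (Hcx : continuity (fun t => Re (z t))) by apply continuity_Re, Hz.
  assert (Hcy : continuity (fun t => Im (z t))) by apply continuity_Im, Hz.
  destruct (upper_half r0 eta c kp m (x0 + 3) He Hcos Hsin Hmc ltac:(lra) z tc) as (t1 & Ht1 & Hy1 & Hx1 & Hab).
  { now apply good_near_rotation. }
  { destruct (reference_upper x0 Hx0) as [E1 E2].
    apply near_circle_of with (x0 + 3) m (kp / 8); auto.
    - now apply good_near_rotation.
    - rewrite E1. assert (K := Hlineg (z tc) (proj2 Hz tc) Hy). now rewrite (Rabs_pos_eq (Re (z tc))) in K by lra.
    - rewrite E2, Hy, Rminus_diag, Rabs_R0. lra.
    - lra. }
  { auto. }
  destruct (lower_half r0 eta c kp m (x0 + 3) He Hcos Hsin Hmc ltac:(lra) z t1) as (t2 & Ht2 & Hy2 & Hx2 & Hbe).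
  { now apply good_near_rotation. }
  { destruct (reference_lower x0 Hx0) as [E1 E2].
    apply near_circle_of with (x0 + 3) m (kp / 8); auto.
    - now apply good_near_rotation.
    - rewrite E1. assert (K := Hlineg (z t1) (proj2 Hz t1) Hy1). rewrite (Rabs_left1 (Re (z t1))) in K by lra.
      rewrite <- Rabs_Ropp. now replace (- (Re (z t1) - - x0)) with (- Re (z t1) - x0) by ring.
    - rewrite E2, Hy1, Rminus_diag, Rabs_R0. lra.
    - lra. }
  { auto. }
  assert (N0 := Hline (z tc) (Hnk tc) Hy). assert (N1 := Hline (z t1) (Hnk t1) Hy1).
  assert (N2 := Hline (z t2) (Hnk t2) Hy2).
  rewrite (Rabs_pos_eq (Re (z tc))) in N0 by lra. rewrite (Rabs_left1 (Re (z t1))) in N1 by lra. rewrite (Rabs_pos_eq (Re (z t2))) in N2 by lra.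
  exists t1, t2. split; auto; try lra; try (split; auto; lra).
  - apply (line_potential_conserved a1 b0 b2 b4 eps (x0 + 3) ltac:(lra) Hden (fun t => Re (z t)) (fun t => Im (z t)) tc t1); auto; try lra.
    + intros r Hr. destruct (good_box z r Hz) as [Q1 Q2].
      apply Rabs_lt_between in Q1. apply Rabs_lt_between in Q2.
      assert (1 <= Im (z r)).
      { destruct (Req_dec r tc) as [->|]; [lra|]. destruct (Req_dec r t1) as [->|]; [lra|].
        left. apply Hab. lra. }
      split; lra.
    + intros r Hr. apply (solution_derive_above al a1 b0 b2 b4 eps z tc t1); auto. apply Hz.
  - apply (spiral_return al eps z t1 t2); auto; try lra.
    intros r Hr. apply (solution_derive_below al a1 b0 b2 b4 eps z t1 t2); auto. apply Hz.
Qed.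

Lemma lap_no_crossing z tc t1 t2 t : lap z tc t1 t2 -> tc < t -> crossing z t -> t2 <= t.
Proof.
  intros H Ht [Hy Hx]. apply Rnot_lt_le. intros Hlt.
  destruct (Rtotal_order t t1) as [H1|[H1|H1]].
  - assert (K := lap_above _ _ _ _ H t ltac:(lra)). lra.
  - subst. destruct (lap_mid _ _ _ _ H). lra.
  - assert (K := lap_below _ _ _ _ H t ltac:(lra)). lra.
Qed.

(** The return map is increasing because each half lap is: both sides of the potential equation
    decrease in their abscissae, and both sides of the focus equation increase. Only these scalar
    relations are used, so laps of different solutions can be compared. *)
Lemma lap_lt z tc t1 t2 z' sc s1 s2 : lap z tc t1 t2 -> lap z' sc s1 s2 ->
  Re (z tc) < Re (z' sc) -> Re (z t2) < Re (z' s2).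
Proof.
  intros H H' Hlt.
  destruct H as [_ _ _ _ _ _ _ N0 N1 N2 U V]. destruct H' as [_ _ _ _ _ _ _ N0' N1' N2' U' V'].
  apply Rabs_le_between in N0. apply Rabs_le_between in N1. apply Rabs_le_between in N2.
  apply Rabs_le_between in N0'. apply Rabs_le_between in N1'. apply Rabs_le_between in N2'.
  destruct (Hmono (Re (z tc)) (Re (z' sc))) as [K1 _]; try lra.
  assert (K2 : - Re (z t1) < - Re (z' s1)).
  { apply Rnot_le_lt. intros [Hl|He].
    - destruct (Hmono (- Re (z' s1)) (- Re (z t1))) as (_ & K & _); try lra. rewrite !Ropp_involutive in K. lra.
    - assert (Re (z' s1) = Re (z t1)) as E by lra. rewrite E in U'. lra. }
  destruct (Hmono (- Re (z t1)) (- Re (z' s1))) as (_ & _ & _ & K3); try lra.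
  apply Rnot_le_lt. intros [Hl|He].
  - destruct (Hmono (Re (z' s2)) (Re (z t2))) as (_ & _ & K & _); try lra.
  - rewrite He in V'. lra.
Qed.

(* Orientation [sg = 1] or [-1] treats increasing and decreasing crossing
   sequences at once. *)
Lemma crossings_monotone z (sg : R) : sg = 1 \/ sg = -1 -> good z -> forall n tc t1 t2, lap z tc t1 t2 ->
  0 < sg * (Re (z t2) - Re (z tc)) ->
  forall t, tc < t <= tc + INR n -> crossing z t -> 0 < sg * (Re (z t) - Re (z tc)).
Proof.
  intros Hsg Hz. induction n as [|n IH]; intros tc t1 t2 Hlap Hpos t Ht Hcr.
  - simpl in Ht. lra.
  - assert (Hle := lap_no_crossing _ _ _ _ t Hlap (proj1 Ht) Hcr).
    destruct (Req_dec t t2) as [->|Hne]; auto.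
    destruct (lap_exists z t2 Hz (lap_end _ _ _ _ Hlap)) as (s1 & s2 & Hlap').
    assert (L1 := lap_lt1 _ _ _ _ Hlap). assert (L2 := lap_lt2 _ _ _ _ Hlap).
    assert (Hpos' : 0 < sg * (Re (z s2) - Re (z t2))).
    { destruct Hsg as [-> | ->].
      - generalize (lap_lt _ _ _ _ _ _ _ _ Hlap Hlap' ltac:(lra)). lra.
      - generalize (lap_lt _ _ _ _ _ _ _ _ Hlap' Hlap ltac:(lra)). lra. }
    rewrite S_INR in Ht. assert (K := IH t2 s1 s2 Hlap' Hpos' t ltac:(lra) Hcr). lra.
Qed.

(** If the first lap moved the abscissa, all later crossings would lie strictly on the same side of
    the first one, including the crossing at [tc + T], which has the same abscissa. Each lap lasts
    more than one unit of time, so an integer beyond [T] bounds the number of laps. *)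
Lemma periodic_return z T tc t1 t2 : good z -> 0 < T -> (forall t, z (t + T) = z t) ->
  lap z tc t1 t2 -> return_equations al a1 b0 b2 b4 eps (Re (z tc)) (- Re (z t1)).
Proof.
  intros Hz HT Hper Hlap.
  assert (E : Re (z t2) = Re (z tc)).
  { apply NNPP. intros Hne. destruct (INR_unbounded T) as [n Hn].
    assert (Hcr : crossing z (tc + T)) by (unfold crossing; rewrite Hper; apply Hlap).
    assert (Hno : forall sg, sg = 1 \/ sg = -1 -> ~ 0 < sg * (Re (z t2) - Re (z tc))).
    { intros sg Hsg Hp.
      assert (K := crossings_monotone z sg Hsg Hz n tc t1 t2 Hlap Hp (tc + T) ltac:(lra) Hcr).
      rewrite Hper in K. lra. }
    assert (N1 := Hno 1 (or_introl eq_refl)). assert (N2 := Hno (-1) (or_intror eq_refl)). lra. }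
  split.
  - rewrite Ropp_involutive. apply Hlap.
  - rewrite <- E. apply Hlap.
Qed.

Lemma crossing_somewhere z : good z -> exists t, crossing z t.
Proof.
  intros Hz. destruct (proj2 Hz 0) as [a [H1 H2]]. assert (Hr0 := r0_bounds x0 Hx0). assert (HP := PI_RGT_0).
  (* The angle is reduced modulo [2 * PI] to [-PI, PI), as [crossing_exists] asks. *)
  set (k := period_index (2 * PI) (a + PI)).
  assert (Hk := period_index_spec (2 * PI) (a + PI) ltac:(lra)). fold k in Hk.
  destruct (cos_sin_period_Z a k) as [Ec Es]. rewrite <- Ec in H1. rewrite <- Es in H2.
  set (a' := a - IZR k * (2 * PI)) in *.
  destruct (crossing_exists r0 eta c kp m (x0 + 3) (eta_bounds x0 Hx0) Hcos Hsin ltac:(lra) z (a' - 0) 0) as (t & _ & Hy & Hx).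
  - unfold a'; lra.
  - now apply good_near_rotation.
  - apply near_circle_of with (x0 + 3) m kg; auto; [now apply good_near_rotation|lra].
  - exists t. split; auto. lra.
Qed.

(** Uniqueness is assembled half lap by half lap: away from the line each solution follows one
    Lipschitz field, so Gronwall's lemma applies. [Hsync] adds that two solutions from the same
    point return to the line at the same time, for the earlier return would force the other one to
    be on the line too soon. Every lap gains more than one unit of time, so [n] laps suffice. *)
Lemma forward_unique z z' : good z -> good z' -> forall n tc sc, crossing z tc -> z tc = z' sc ->
  forall u, 0 <= u <= INR n -> z (tc + u) = z' (sc + u).
Proof.
  intros Hz Hz'. assert (Cx : continuity (fun t => Re (z t))) by apply continuity_Re, Hz.
  assert (Cy : continuity (fun t => Im (z t))) by apply continuity_Im, Hz.
  assert (Cx' : continuity (fun t => Re (z' t))) by apply continuity_Re, Hz'.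
  assert (Cy' : continuity (fun t => Im (z' t))) by apply continuity_Im, Hz'.
  assert (Harc : forall F1 F2 p q d, box_bounded F1 -> box_bounded F2 -> z p = z' q ->
    (forall u, 0 < u < d -> follows F1 F2 z (p + u)) -> (forall u, 0 < u < d -> follows F1 F2 z' (q + u)) ->
    forall u, 0 <= u <= d -> z (p + u) = z' (q + u)).
  { intros F1 F2 p q d HF1 HF2 Epq D D' u Hu.
    destruct (gronwall_unique F1 F2 (x0 + 3) d (fun u => Re (z (p + u))) (fun u => Im (z (p + u)))
      (fun u => Re (z' (q + u))) (fun u => Im (z' (q + u)))) with (t := u) as [E1 E2]; auto.
    - now apply (continuity_shift (fun t => Re (z t))).
    - now apply (continuity_shift (fun t => Im (z t))).
    - now apply (continuity_shift (fun t => Re (z' t))).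
    - now apply (continuity_shift (fun t => Im (z' t))).
    - now rewrite !Rplus_0_r, Epq.
    - now rewrite !Rplus_0_r, Epq.
    - intros t _. destruct (good_box z (p + t) Hz). destruct (good_box z' (q + t) Hz'). lra.
    - intros t Ht. destruct (D t Ht). destruct (D' t Ht).
      split; [now apply (is_derive_shift (fun t => Re (z t)))|].
      split; [now apply (is_derive_shift (fun t => Im (z t)))|].
      split; [now apply (is_derive_shift (fun t => Re (z' t)))|now apply (is_derive_shift (fun t => Im (z' t)))].
    - apply injective_projections; assumption. }
  assert (Hsync : forall F1 F2 p q d d', box_bounded F1 -> box_bounded F2 -> z p = z' q -> 0 < d -> 0 < d' ->
    (forall u, 0 < u < d -> follows F1 F2 z (p + u)) -> (forall u, 0 < u < d' -> follows F1 F2 z' (q + u)) ->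
    Im (z (p + d)) = 1 -> Im (z' (q + d')) = 1 ->
    (forall u, 0 < u < d -> Im (z (p + u)) <> 1) -> (forall u, 0 < u < d' -> Im (z' (q + u)) <> 1) ->
    d = d' /\ forall u, 0 <= u <= d -> z (p + u) = z' (q + u)).
  { intros F1 F2 p q d d' HF1 HF2 Epq Hd Hd' D D' E E' N N'.
    assert (K : forall m, m <= d -> m <= d' -> forall u, 0 <= u <= m -> z (p + u) = z' (q + u)).
    { intros m' Hm1 Hm2. apply (Harc F1 F2); auto; intros u Hu; [apply D|apply D']; lra. }
    assert (d = d') as <-.
    { destruct (Rtotal_order d d') as [H|[H|H]]; auto; exfalso.
      - apply (N' d); [lra|]. rewrite <- (K d); auto; lra.
      - apply (N d'); [lra|]. rewrite (K d'); auto; lra. }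
    split; auto. apply K; lra. }
  induction n as [|n IH]; intros tc sc Hcr E u Hu.
  - simpl in Hu. replace u with 0 by lra. now rewrite !Rplus_0_r.
  - destruct (lap_exists z tc Hz Hcr) as (t1 & t2 & L).
    assert (Hcr' : crossing z' sc) by (unfold crossing; rewrite <- E; exact Hcr).
    destruct (lap_exists z' sc Hz' Hcr') as (s1 & s2 & L').
    destruct L as [_ T1 T2 [Hy1 _] [Hy2 Hx2] Hab Hbe _ _ _ _ _].
    destruct L' as [_ S1 S2 [Hz1 _] [Hz2 _] Hab' Hbe' _ _ _ _ _].
    destruct (Hsync _ _ tc sc (t1 - tc) (s1 - sc) (box_bounded_fre a1 b2 b4 eps) (box_bounded_fim a1 b0 b2 b4 eps)) as [Et Hup]; auto; try lra.
    { intros v Hv. apply (solution_derive_above al a1 b0 b2 b4 eps z tc t1); auto; [apply Hz|lra]. }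
    { intros v Hv. apply (solution_derive_above al a1 b0 b2 b4 eps z' sc s1); auto; [apply Hz'|lra]. }
    { now replace (tc + (t1 - tc)) with t1 by ring. }
    { now replace (sc + (s1 - sc)) with s1 by ring. }
    { intros v Hv. assert (K := Hab (tc + v) ltac:(lra)). lra. }
    { intros v Hv. assert (K := Hab' (sc + v) ltac:(lra)). lra. }
    assert (E1 : z t1 = z' s1).
    { assert (K := Hup (t1 - tc) ltac:(lra)). replace (tc + (t1 - tc)) with t1 in K by ring. rewrite Et in K.
      now replace (sc + (s1 - sc)) with s1 in K by ring. }
    destruct (Hsync _ _ t1 s1 (t2 - t1) (s2 - s1) (box_bounded_gre al eps) (box_bounded_gim al eps)) as [Et2 Hlo]; auto; try lra.
    { intros v Hv. apply (solution_derive_below al a1 b0 b2 b4 eps z t1 t2); auto; [apply Hz|lra]. }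
    { intros v Hv. apply (solution_derive_below al a1 b0 b2 b4 eps z' s1 s2); auto; [apply Hz'|lra]. }
    { now replace (t1 + (t2 - t1)) with t2 by ring. }
    { now replace (s1 + (s2 - s1)) with s2 by ring. }
    { intros v Hv. assert (K := Hbe (t1 + v) ltac:(lra)). lra. }
    { intros v Hv. assert (K := Hbe' (s1 + v) ltac:(lra)). lra. }
    destruct (Rle_lt_dec u (t1 - tc)) as [Hu1|Hu1].
    + apply Hup; lra.
    + destruct (Rle_lt_dec u (t2 - tc)) as [Hu2|Hu2].
      * replace (tc + u) with (t1 + (u - (t1 - tc))) by ring.
        replace (sc + u) with (s1 + (u - (t1 - tc))) by (rewrite Et; ring).
        apply Hlo; lra.
      * assert (E2 : z t2 = z' s2).
        { assert (K := Hlo (t2 - t1) ltac:(lra)).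
          replace (t1 + (t2 - t1)) with t2 in K by ring. rewrite Et2 in K.
          now replace (s1 + (s2 - s1)) with s2 in K by ring. }
        replace (tc + u) with (t2 + (u - (t2 - tc))) by ring.
        replace (sc + u) with (s2 + (u - (t2 - tc))) by lra.
        rewrite S_INR in Hu. apply IH; [split; auto|auto|lra].
Qed.

Hypothesis Huniq : forall x x' y y', Rabs (x - x0) <= rho -> Rabs (x' - x0) <= rho -> Rabs (y - x0) <= rho ->
  Rabs (y' - x0) <= rho -> return_equations al a1 b0 b2 b4 eps x x' -> return_equations al a1 b0 b2 b4 eps y y' ->
  x = y /\ x' = y'.

(** Both orbits satisfy the return equations, so by [Huniq] they cross the line at the same point
    and agree from there on. A point of [H] is moved beyond the crossing time by adding enough
    periods. *)
Lemma periodic_orbit_included H H' :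
  periodic_orbit eps (coefA al a1) (coefB b0 b2 b4) H -> (forall w, H w -> near_orbit x0 kg w) ->
  periodic_orbit eps (coefA al a1) (coefB b0 b2 b4) H' -> (forall w, H' w -> near_orbit x0 kg w) ->
  forall w, H w -> H' w.
Proof.
  intros (z & T & Hs & HT & Hper & _ & HH) Hn (z' & T' & Hs' & HT' & Hper' & _ & HH') Hn' w Hw.
  assert (Hz : good z) by (split; auto; intros t; apply Hn, HH; now exists t).
  assert (Hz' : good z') by (split; auto; intros t; apply Hn', HH'; now exists t).
  destruct (crossing_somewhere z Hz) as [tc Hcr]. destruct (crossing_somewhere z' Hz') as [sc Hcr'].
  destruct (lap_exists z tc Hz Hcr) as (t1 & t2 & L). destruct (lap_exists z' sc Hz' Hcr') as (s1 & s2 & L').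
  assert (R1 := periodic_return z T tc t1 t2 Hz HT Hper L).
  assert (R2 := periodic_return z' T' sc s1 s2 Hz' HT' Hper' L').
  destruct (Huniq _ _ _ _ (lap_near0 _ _ _ _ L) (lap_near1 _ _ _ _ L) (lap_near0 _ _ _ _ L') (lap_near1 _ _ _ _ L') R1 R2)
    as [E _].
  assert (Ez : z tc = z' sc).
  { apply injective_projections; [exact E|]. change (Im (z tc) = Im (z' sc)). destruct Hcr as [-> _]. now destruct Hcr' as [-> _]. }
  apply HH in Hw. destruct Hw as [t ->].
  assert (HperN : forall n t, z (t + INR n * T) = z t).
  { induction n as [|n IH]; intros s; [now rewrite Rmult_0_l, Rplus_0_r|].
    rewrite S_INR. replace (s + (INR n + 1) * T) with ((s + INR n * T) + T) by ring. now rewrite Hper. }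
  destruct (INR_unbounded ((tc - t) / T)) as [n Hnn].
  apply Rmult_lt_compat_r with (r := T) in Hnn; auto.
  replace ((tc - t) / T * T) with (tc - t) in Hnn by (field; lra).
  set (u := t + INR n * T - tc). destruct (INR_unbounded u) as [N HN].
  apply HH'. exists (sc + u). rewrite <- (HperN n t).
  replace (t + INR n * T) with (tc + u) by (unfold u; ring).
  apply (forward_unique z z' Hz Hz' N tc sc Hcr Ez). unfold u in *; lra.
Qed.

End Dynamics.

(** * The cycle near one circle: uniqueness, existence, convergence *)

Section Family.

Variables al a1 b0 b2 b4 x0 : R.
Hypothesis Hx0 : 0 < x0.

Notation r0 := (r0 x0).
Notation eta := (eta x0).
Notation lpot := (line_potential a1 b0 b2 b4).
Notation cA := (coefA al a1).
Notation cB := (coefB b0 b2 b4).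

Lemma lap_constants rho : 0 < rho -> exists kp c, 0 < kp <= 1 /\ 1 < r0 * cos eta - kp /\
  c <= r0 * sin eta - kp /\ 0 < c /\
  forall w, near_orbit x0 kp w -> Im w = 1 -> Rabs (Rabs (Re w) - x0) <= rho.
Proof.
  intros Hrho. destruct (near_orbit_line x0 Hx0 rho Hrho) as [k [Hk Hl]].
  assert (H1 := r0_cos_eta x0 Hx0). assert (H2 := r0_sin_eta x0 Hx0).
  destruct (pos_below4 k ((r0 * cos eta - 1) / 2) (r0 * sin eta / 2) 1) as (kp & Hkp); try lra.
  exists kp, (r0 * sin eta - kp). split; [lra|]. split; [lra|]. split; [lra|]. split; [lra|].
  intros w Hw. apply Hl. apply near_orbit_le with kp; auto. lra.
Qed.

Hypothesis HD : 2 * kap_int a1 b0 b2 b4 x0 + 2 * al * atan x0 - 2 * PI * al = 0.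
Hypothesis Hphi : phi al a1 b0 b2 b4 x0 <> 0.

Lemma periodic_orbit_unique : exists kg e, 0 < kg <= 1 /\ 0 < e /\ forall eps, 0 < Rabs eps < e ->
  forall H H', periodic_orbit eps cA cB H -> (forall w, H w -> near_orbit x0 kg w) ->
  periodic_orbit eps cA cB H' -> (forall w, H' w -> near_orbit x0 kg w) -> same_set H H'.
Proof.
  destruct (displacement al a1 b0 b2 b4 x0 Hx0 HD Hphi) as (rho & Hrho & Hrho1 & Hdisp).
  destruct (Hdisp rho) as (e0 & He0 & Hd); [lra|]. clear Hdisp.
  destruct (lap_constants rho) as (kp & c & Hkp & Hcos & Hsin & Hc & Hline); [lra|].
  destruct (near_orbit_line x0 Hx0 (kp / 8)) as [k [Hk Hl]]; [lra|].
  destruct (filippov_near_rotation al a1 b0 b2 b4 (x0 + 3)) as [M [HM HMb]].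
  destruct (pos_below k (kp / 8)) as (kg & Hkg); try lra.
  (* [kp / 200] ensures [48 * m <= kp / 4], and [c / 2] ensures [m < c]. *)
  destruct (pos_below (kp / 200) (c / 2)) as (b & Hb); try lra.
  assert (HbM : 0 < b / M) by (apply Rdiv_lt_0_compat; lra).
  destruct (pos_below e0 (b / M)) as (e & He & Hee0 & HebM); auto.
  exists kg, e. split; [lra|]. split; [auto|]. intros eps Heps.
  assert (Hm : Rabs eps * M < b) by (apply Rabs_mult_small with e; lra).
  assert (Hm0 : 0 <= Rabs eps * M) by (apply Rmult_le_pos; lra).
  destruct (Hd eps ltac:(lra)) as (Hden & Hmono & Huniq & _).
  assert (Hlg : forall w, near_orbit x0 kg w -> Im w = 1 -> Rabs (Rabs (Re w) - x0) <= kp / 8).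
  { intros w Hw. apply Hl. apply near_orbit_le with kg; auto. lra. }
  assert (Hinc : forall H H', periodic_orbit eps cA cB H -> (forall w, H w -> near_orbit x0 kg w) ->
    periodic_orbit eps cA cB H' -> (forall w, H' w -> near_orbit x0 kg w) -> forall w, H w -> H' w).
  { apply (periodic_orbit_included al a1 b0 b2 b4 x0 Hx0 rho kp c kg) with (m := Rabs eps * M); auto; try lra. }
  intros H H' P1 N1 P2 N2 w. split; now apply Hinc.
Qed.

(** Solving the return equations is also sufficient. The upper arc from x lands where the potential
    agrees with its value at -x', and strict monotonicity near [x0] identifies the landing point as
    -x'; in the same way the focus started at -x' lands at x, and the two arcs close up. *)
Lemma periodic_orbit_exists kappa : 0 < kappa -> exists e, 0 < e /\ forall eps, 0 < Rabs eps < e ->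
  exists H, periodic_orbit eps cA cB H /\ (forall w, H w -> near_orbit x0 kappa w) /\
  forall a, exists w, H w /\ Rabs (Re w - r0 * cos a) <= kappa /\ Rabs (Im w - r0 * sin a) <= kappa.
Proof.
  intros Hkappa.
  destruct (displacement al a1 b0 b2 b4 x0 Hx0 HD Hphi) as (rho & Hrho & Hrho1 & Hdisp).
  destruct (lap_constants rho) as (kp & c & Hkp & Hcos & Hsin & Hc & Hline); [lra|].
  destruct (pos_below kappa kp) as (k & Hk); try lra.
  destruct (pos_below rho (k / 4)) as (tau & Htau); try lra.
  destruct (Hdisp tau) as (e0 & He0 & Hd); [lra|]. clear Hdisp.
  destruct (upper_arc a1 b0 b2 b4 x0 Hx0) as (M1 & e1 & HM1 & He1 & Hup).
  destruct (lower_arc al x0 Hx0) as (M2 & e2 & B2 & HM2 & He2 & Hlo).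
  destruct (filippov_near_rotation al a1 b0 b2 b4 (x0 + 3)) as [M3 [HM3 HMb]].
  set (M := M1 + M2 + M3). assert (HM : 0 < M) by (unfold M; lra).
  (* Over a time 8 the drift [16 * m] is then at most [k / 4], and with [2 * tau <= k / 2] the arcs
     stay [k]-close to the reference. *)
  destruct (pos_below (k / 64) (c / 2)) as (b & Hb); try lra.
  assert (HbM : 0 < b / M) by (apply Rdiv_lt_0_compat; lra).
  destruct (pos_below4 e0 (b / M) e1 e2) as (e & He); auto.
  exists e. split; [lra|]. intros eps Heps.
  assert (Hm : Rabs eps * M < b) by (apply Rabs_mult_small with e; lra).
  set (m := Rabs eps * M) in *.
  assert (Hm0 : 0 <= m) by (apply Rmult_le_pos; lra).
  assert (HmM : forall M', 0 <= M' <= M -> Rabs eps * M' <= m).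
  { intros M' HM'. unfold m. apply Rmult_le_compat_l; lra. }
  destruct (Hd eps ltac:(lra)) as (Hden & Hmono & _ & (x & x' & Hx & Hx' & [R1 R2])). clear Hd.
  apply Rabs_le_between in Hx as Hxb. apply Rabs_le_between in Hx' as Hxb'.
  assert (Hr0 := r0_bounds x0 Hx0). assert (Heta := eta_bounds x0 Hx0).
  destruct (reference_upper x0 Hx0) as [U1 U2]. destruct (reference_lower x0 Hx0) as [L1 L2].
  destruct (Hup eps x ltac:(lra) ltac:(apply Rabs_le; lra)) as (zu & Z0 & Zn & (K1 & HK1 & ZK) & Zb & Zd).
  destruct (Hlo eps x' ltac:(lra) ltac:(apply Rabs_le; lra)) as (Wn & K2 & HK2 & WK). clear Hup Hlo.
  apply near_rotation_le with (m' := m) in Zn; [|apply HmM; unfold M; lra].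
  apply near_rotation_le with (m' := m) in Wn; [|apply HmM; unfold M; lra].
  set (w := spiral (eps * al) x') in *.
  assert (W0 : w 0 = (- x', 1)) by apply spiral_start.
  assert (Zc : near_circle r0 k zu (PI / 2 - 2 * eta - 0) 0 (0 + 8)).
  { apply near_circle_of with (x0 + 3) m tau; auto.
    - now rewrite Rplus_0_l.
    - rewrite U1, Z0. exact Hx.
    - rewrite U2, Z0. unfold Im; simpl. rewrite Rminus_diag, Rabs_R0. lra.
    - lra. }
  assert (Wc : near_circle r0 k w (PI / 2 + 2 * eta - 0) 0 (0 + 8)).
  { apply near_circle_of with B2 m tau; auto.
    - now rewrite Rplus_0_l.
    - rewrite L1, W0. unfold Re; simpl. rewrite <- Rabs_Ropp. now replace (- (- x' - - x0)) with (x' - x0) by ring.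
    - rewrite L2, W0. unfold Im; simpl. rewrite Rminus_diag, Rabs_R0. lra.
    - lra. }
  assert (Hline' : forall v, near_orbit x0 k v -> Im v = 1 -> Rabs (Rabs (Re v) - x0) <= rho).
  { intros v Hv. apply Hline. apply near_orbit_le with k; auto. lra. }
  destruct (upper_half r0 eta c k m (x0 + 3) Heta ltac:(lra) ltac:(lra) ltac:(lra) ltac:(lra) zu 0)
    as (t1 & Ht1 & Hy1 & Hx1 & Hab); auto.
  { now rewrite Rplus_0_l. }
  { rewrite Z0. reflexivity. }
  destruct (lower_half r0 eta c k m B2 Heta ltac:(lra) ltac:(lra) ltac:(lra) ltac:(lra) w 0)
    as (sg & Hsg & Hy2 & Hx2 & Hbe); auto.
  { now rewrite Rplus_0_l. }
  { rewrite W0. reflexivity. }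
  rewrite Rplus_0_l in Ht1.
  assert (HP4 := PI_4).
  assert (Ccx : continuity (fun t => Re (zu t))) by apply continuity_Re, Zn.
  assert (Ccy : continuity (fun t => Im (zu t))) by apply continuity_Im, Zn.
  assert (Cwx : continuity (fun t => Re (w t))) by apply continuity_Re, Wn.
  assert (Cwy : continuity (fun t => Im (w t))) by apply continuity_Im, Wn.
  assert (E1 : Re (zu t1) = - x').
  { assert (N1 := Hline' (zu t1) (near_circle_near_orbit x0 _ _ _ _ _ t1 Zc ltac:(lra)) Hy1).
    rewrite (Rabs_left1 (Re (zu t1))) in N1 by lra. apply Rabs_le_between in N1.
    assert (C : lpot eps (Re (zu 0)) = lpot eps (Re (zu t1))).
    { apply (line_potential_conserved a1 b0 b2 b4 eps (x0 + 3) ltac:(lra) Hden (fun t => Re (zu t)) (fun t => Im (zu t)) 0 t1); auto; try lra.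
      - intros r Hr. destruct (Zb r ltac:(lra)) as [Q1 Q2].
        apply Rabs_lt_between in Q1. apply Rabs_lt_between in Q2.
        assert (1 <= Im (zu r)).
        { destruct (Req_dec r 0) as [->|]; [rewrite Z0; unfold Im; simpl; lra|]. destruct (Req_dec r t1) as [->|]; [lra|].
          left. apply Hab. lra. }
        split; lra.
      - intros r Hr. apply Zd. lra.
      - rewrite Z0. reflexivity. }
    replace (Re (zu 0)) with x in C by (rewrite Z0; reflexivity).
    destruct (Rtotal_order (- Re (zu t1)) x') as [H|[H|H]]; [|lra|]; exfalso.
    - destruct (Hmono (- Re (zu t1)) x') as (_ & K & _); try lra. rewrite Ropp_involutive in K. lra.
    - destruct (Hmono x' (- Re (zu t1))) as (_ & K & _); try lra. rewrite Ropp_involutive in K. lra. }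
  assert (E2 : Re (w sg) = x).
  { assert (N1 := Hline' (w sg) (near_circle_near_orbit x0 _ _ _ _ _ sg Wc ltac:(lra)) Hy2).
    rewrite (Rabs_pos_eq (Re (w sg))) in N1 by lra. apply Rabs_le_between in N1.
    assert (C := spiral_return al eps w 0 sg ltac:(lra) Cwx Cwy).
    cbv beta in C. replace (Re (w 0)) with (- x') in C by (rewrite W0; reflexivity).
    replace (Im (w 0)) with 1 in C by (rewrite W0; reflexivity). rewrite Ropp_involutive in C.
    specialize (C ltac:(intros r _; apply spiral_derive) eq_refl Hy2 ltac:(lra) ltac:(lra)).
    destruct (Rtotal_order (Re (w sg)) x) as [H|[H|H]]; [|auto|]; exfalso.
    - destruct (Hmono (Re (w sg)) x) as (_ & _ & K & _); lra.
    - destruct (Hmono x (Re (w sg))) as (_ & _ & K & _); lra. }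
  destruct (periodic_concatenation al a1 b0 b2 b4 eps zu w t1 sg (K1 + K2)) as (z & Hsol & Hper & Hzu & Hcov); try lra.
  { intros s t Hs Ht. eapply Rle_trans; [apply ZK; lra|]. apply Rmult_le_compat_r; lra. }
  { intros s t Hs Ht. eapply Rle_trans; [apply WK; lra|]. apply Rmult_le_compat_r; lra. }
  { rewrite W0. apply injective_projections; [exact E1|exact Hy1]. }
  { rewrite Z0. apply injective_projections; [exact E2|exact Hy2]. }
  { intros t Ht. split; [apply Hab; lra|apply Zd; lra]. }
  { intros t Ht. split; [apply Hbe; lra|apply spiral_derive]. }
  assert (Hnear : forall t, near_orbit x0 k (z t)).
  { intros t. destruct (Hcov t) as [[s [Hs ->]]|[s [Hs ->]]].
    - apply (near_circle_near_orbit x0 _ _ _ _ _ s Zc). lra.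
    - apply (near_circle_near_orbit x0 _ _ _ _ _ s Wc). lra. }
  assert (Hz0 : z 0 = (x, 1)) by (rewrite Hzu by lra; exact Z0).
  exists (fun v => exists t, v = z t). split; [|split].
  - exists z, (t1 + sg). split; auto. split; [lra|]. split; auto. split; [|tauto].
    exists t1. rewrite Hz0, Hzu by lra. intros E. assert (Re (zu t1) = x) by (rewrite E; reflexivity). lra.
  - intros v [t ->]. apply near_orbit_le with k; [lra|auto].
  (* Every point of the circle must be approached as well. The reference starts at angle
     [PI / 2 - 2 * eta] and at the time [s], which lies in [0, 2 PI), has the angle [a] modulo
     [2 * PI]. *)
  - intros a. set (n := period_index (2 * PI) (a - (PI / 2 - 2 * eta))).
    assert (HP := PI_RGT_0).
    assert (Hn := period_index_spec (2 * PI) (a - (PI / 2 - 2 * eta)) ltac:(lra)). fold n in Hn.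
    set (s := a - (PI / 2 - 2 * eta) - IZR n * (2 * PI)).
    assert (Zz : near_circle r0 k z (PI / 2 - 2 * eta - 0) 0 (0 + 8)).
    { apply near_circle_of with (x0 + 3) m tau; auto.
      - apply near_rotation_le with (Rabs eps * M3); [apply HmM; unfold M; lra|].
        apply (solution_near_rotation al a1 b0 b2 b4 eps (x0 + 3) M3); auto.
        intros t _. destruct (near_orbit_box x0 Hx0 k (z t)); auto; lra.
      - rewrite U1, Hz0. exact Hx.
      - rewrite U2, Hz0. unfold Im; simpl. rewrite Rminus_diag, Rabs_R0. lra.
      - lra. }
    destruct (cos_sin_period_Z a n) as [Ec Es].
    exists (z s). split; [now exists s|].
    destruct (Zz s ltac:(unfold s; lra)) as [Q1 Q2].
    replace (PI / 2 - 2 * eta - 0 + s) with (a - IZR n * (2 * PI)) in Q1, Q2 by (unfold s; ring).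
    rewrite Ec in Q1. rewrite Es in Q2. lra.
Qed.

Definition circle (r : R) (w : C) : Prop := exists t, w = (r * cos t, r * sin t).

Lemma Cmod_minus_bound (v w : C) d : Rabs (Re v - Re w) <= d -> Rabs (Im v - Im w) <= d -> Cmod (v - w)%C <= 2 * d.
Proof.
  intros H1 H2. eapply Rle_trans; [apply Cmod_le_Rabs|].
  change (Re (v - w)%C) with (Re v - Re w). change (Im (v - w)%C) with (Im v - Im w). lra.
Qed.

Lemma near_orbit_within G k d w : (forall w, G w -> near_orbit x0 k w) -> (exists p, G p /\ Cmod (w - p)%C < d) ->
  near_orbit x0 (k + d) w.
Proof.
  intros HG (p & Hp & Hd). destruct (HG p Hp) as [a [H1 H2]]. exists a.
  assert (K1 := Re_le_Cmod_minus w p). assert (K2 := Im_le_Cmod_minus w p). split.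
  - replace (Re w - r0 * cos a) with ((Re w - Re p) + (Re p - r0 * cos a)) by ring.
    eapply Rle_trans; [apply Rabs_triang|]. lra.
  - replace (Im w - r0 * sin a) with ((Im w - Im p) + (Im p - r0 * sin a)) by ring.
    eapply Rle_trans; [apply Rabs_triang|]. lra.
Qed.

(** [G eps] is defined as the union of all periodic orbits that are [kg]-close to the circle. By
    uniqueness it coincides with any one of them, so the family does not depend on the precision at
    which existence is invoked, and the convergence can use arbitrarily small precision. *)
Theorem limit_cycle_family : exists (e : R) (G : R -> C -> Prop), 0 < e /\
  (forall eps, 0 < Rabs eps < e -> limit_cycle eps cA cB (G eps)) /\ tends_to G (circle r0).
Proof.
  destruct periodic_orbit_unique as (kg & e1 & Hkg & He1 & Huniq).
  set (G := fun eps w => exists H, periodic_orbit eps cA cB H /\ (forall w, H w -> near_orbit x0 kg w) /\ H w).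
  assert (HG : forall eps H, 0 < Rabs eps < e1 -> periodic_orbit eps cA cB H -> (forall w, H w -> near_orbit x0 kg w) ->
    same_set (G eps) H).
  { intros eps H Heps HP HN w. split.
    - intros (H' & HP' & HN' & Hw). now apply (Huniq eps Heps H' H HP' HN' HP HN).
    - intros Hw. now exists H. }
  destruct (periodic_orbit_exists (kg / 2)) as (e2 & He2 & Hex); [lra|].
  destruct (pos_below e1 e2) as (e & He); auto.
  exists e, G. split; [tauto|]. split.
  - intros eps Heps.
    destruct (Hex eps ltac:(lra)) as (H' & HP & HN & _).
    assert (HN' : forall w, H' w -> near_orbit x0 kg w).
    { intros w Hw. apply near_orbit_le with (kg / 2); [lra|auto]. }
    assert (HS := HG eps H' ltac:(lra) HP HN').
    split.
    + destruct HP as (z & T & P1 & P2 & P3 & P4 & P5). exists z, T.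
      split; [auto|split; [auto|split; [auto|split; [auto|]]]].
      intros w. rewrite (HS w). apply P5.
    (* The orbit itself is [kg / 2]-close to the circle, so any orbit within [kg / 2] of it is still
       in the zone of uniqueness. *)
    + exists (kg / 2). split; [lra|]. intros K HK HKw w. rewrite (HS w).
      apply (Huniq eps ltac:(lra) K H' HK); auto.
      intros v Hv. replace kg with (kg / 2 + kg / 2) by field.
      apply near_orbit_within with (G eps); auto.
      intros u Hu. apply HN. now apply HS.
  - intros d Hd. destruct (pos_below kg (d / 4)) as (k & Hk); try lra.
    destruct (periodic_orbit_exists k) as (e3 & He3 & Hex'); [lra|].
    destruct (pos_below e1 e3) as (e' & He'); auto. exists e'. split; [tauto|]. intros eps Heps.
    destruct (Hex' eps ltac:(lra)) as (H' & HP & HN & HC).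
    assert (HN' : forall w, H' w -> near_orbit x0 kg w).
    { intros w Hw. apply near_orbit_le with k; [lra|auto]. }
    assert (HS := HG eps H' ltac:(lra) HP HN').
    split.
    + intros w Hw. apply HS in Hw. destruct (HN w Hw) as [a [Q1 Q2]].
      exists (r0 * cos a, r0 * sin a). split; [now exists a|].
      apply Rle_lt_trans with (2 * k); [|lra]. apply Cmod_minus_bound; auto.
    + intros p [a ->]. destruct (HC a) as (w & Hw & Q1 & Q2). exists w. split; [now apply HS|].
      apply Rle_lt_trans with (2 * k); [|lra].
      apply Cmod_minus_bound; unfold Re, Im in *; simpl; rewrite Rabs_minus_sym; auto.
Qed.

Lemma filippov_unperturbed z : filippov 0 cA cB z (- Im z, Re z).
Proof.
  destruct (Rtotal_order (Im z) 1) as [H|[H|H]].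
  - apply filippov_below; auto. unfold gre, gim. f_equal; ring.
  - right; left. split; auto. rewrite field_upper, field_lower by congruence. unfold fre, fim, gre, gim.
    rewrite !Rmult_0_l, !Rplus_0_r. now apply between_same.
  - apply filippov_above; auto. unfold fre, fim. f_equal; ring.
Qed.

Lemma circle_periodic_orbit : periodic_orbit 0 cA cB (circle r0).
Proof.
  assert (Hr0 := r0_bounds x0 Hx0).
  set (z := fun t => (r0 * cos t, r0 * sin t) : C).
  assert (Hd : forall t, is_derive z t (- Im (z t), Re (z t))).
  { intros t. apply is_derive_pair; unfold z, Re, Im; simpl; auto_derive; auto; ring. }
  exists z, (2 * PI). split; [split|].
  - apply Lipschitz_locally_abs_continuous. intros p q. exists (r0 + r0). intros s t Hs _.
    rewrite Rmult_plus_distr_r. apply Cmod_minus_le; unfold z, Re, Im; simpl.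
    + replace (r0 * cos t - r0 * cos s) with (r0 * (cos t - cos s)) by ring.
      rewrite Rabs_mult, (Rabs_pos_eq r0) by lra. apply Rmult_le_compat_l; [lra|]. apply Rabs_cos_minus; lra.
    + replace (r0 * sin t - r0 * sin s) with (r0 * (sin t - sin s)) by ring.
      rewrite Rabs_mult, (Rabs_pos_eq r0) by lra. apply Rmult_le_compat_l; [lra|]. apply Rabs_sin_minus; lra.
  - apply null_set_subset with (fun t => exists n : nat, t = 0); [|apply (null_set_range (fun _ => 0))].
    intros t Hn. exfalso. apply Hn. exists (- Im (z t), Re (z t)). split; auto. apply filippov_unperturbed.
  - assert (HP := PI_RGT_0). split; [lra|]. split; [|split; [|intros w; reflexivity]].
    + intros t. unfold z. now rewrite cos_plus, sin_plus, cos_2PI, sin_2PI, !Rmult_0_r, !Rmult_1_r, Rminus_0_r, Rplus_0_r.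
    + exists PI. unfold z. rewrite cos_PI, cos_0. intros E. apply (f_equal Re) in E. unfold Re in E; simpl in E. lra.
Qed.

End Family.

(** * The averaged function *)

(** Successive divided differences lower the degree by one each time, until only [p3] remains; the
    other coefficients follow backwards. *)
Lemma cubic_four_roots p0 p1 p2 p3 (u1 u2 u3 u4 : R) :
  u1 <> u2 -> u1 <> u3 -> u1 <> u4 -> u2 <> u3 -> u2 <> u4 -> u3 <> u4 ->
  (forall u, u = u1 \/ u = u2 \/ u = u3 \/ u = u4 -> p0 + p1 * u + p2 * u ^ 2 + p3 * u ^ 3 = 0) ->
  p0 = 0 /\ p1 = 0 /\ p2 = 0 /\ p3 = 0.
Proof.
  intros N12 N13 N14 N23 N24 N34 H.
  assert (H1 := H u1 ltac:(tauto)). assert (H2 := H u2 ltac:(tauto)).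
  assert (H3 := H u3 ltac:(tauto)). assert (H4 := H u4 ltac:(tauto)).
  assert (Q : forall u v, u <> v -> p0 + p1 * u + p2 * u ^ 2 + p3 * u ^ 3 = 0 ->
    p0 + p1 * v + p2 * v ^ 2 + p3 * v ^ 3 = 0 -> p1 + p2 * (u + v) + p3 * (u ^ 2 + u * v + v ^ 2) = 0).
  { intros u v Huv Hu Hv. apply Rmult_eq_reg_l with (u - v); lra. }
  assert (Q12 := Q _ _ N12 H1 H2). assert (Q13 := Q _ _ N13 H1 H3). assert (Q14 := Q _ _ N14 H1 H4).
  assert (S1 : p2 + p3 * (u1 + u2 + u3) = 0) by (apply Rmult_eq_reg_l with (u2 - u3); lra).
  assert (S2 : p2 + p3 * (u1 + u2 + u4) = 0) by (apply Rmult_eq_reg_l with (u2 - u4); lra).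
  assert (P3 : p3 = 0) by (apply Rmult_eq_reg_l with (u3 - u4); lra).
  subst p3. assert (p2 = 0) by lra. subst p2. assert (p1 = 0) by lra. subst p1. repeat split; lra.
Qed.

Definition averaged (al a1 b0 b2 b4 x : R) : R :=
  2 * kap_int a1 b0 b2 b4 x + 2 * al * atan x - 2 * PI * al.

Lemma averaged_derive al a1 b0 b2 b4 x : is_derive (averaged al a1 b0 b2 b4) x (2 * phi al a1 b0 b2 b4 x).
Proof.
  unfold averaged, phi.
  replace (2 * (kap a1 b0 b2 b4 x + al / (1 + x ^ 2))) with
    (2 * kap a1 b0 b2 b4 x + 2 * al * / (1 + x ^ 2) - 0) by (unfold Rdiv; ring).
  apply (is_derive_minus (fun x => 2 * kap_int a1 b0 b2 b4 x + 2 * al * atan x) (fun _ => 2 * PI * al));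
    [|auto_derive; auto].
  apply (is_derive_plus (fun x => 2 * kap_int a1 b0 b2 b4 x) (fun x => 2 * al * atan x)).
  - apply is_derive_scal, kap_int_derive.
  - apply is_derive_scal, atan_derive.
Qed.

(* [phi] is a cubic in [x^2] up to the factor [(1 + x^2)^2], so by Rolle four
   positive zeros of [averaged] leave no room for a multiple one. *)
Lemma averaged_simple_zeros al a1 b0 b2 b4 : al <> a1 ->
  (forall n, (1 <= n <= 4)%nat -> averaged al a1 b0 b2 b4 (INR n) = 0) ->
  forall n, (1 <= n <= 4)%nat -> phi al a1 b0 b2 b4 (INR n) <> 0.
Proof.
  intros Hne Hz n Hn Hphi. set (f := averaged al a1 b0 b2 b4) in *.
  assert (Hrolle : forall k, (1 <= k <= 3)%nat -> exists x, INR k < x < INR k + 1 /\ phi al a1 b0 b2 b4 x = 0).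
  { intros k Hk. assert (E1 := Hz k ltac:(lia)). assert (E2 := Hz (S k) ltac:(lia)). rewrite S_INR in E2.
    assert (pr : forall x, INR k < x < INR k + 1 -> derivable_pt f x).
    { intros x _. exists (2 * phi al a1 b0 b2 b4 x). apply is_derive_Reals, averaged_derive. }
    destruct (Rolle f (INR k) (INR k + 1) pr) as (x & Hx & Hd); try lra.
    - intros x _. apply derivable_continuous_pt. exists (2 * phi al a1 b0 b2 b4 x). apply is_derive_Reals, averaged_derive.
    - exists x. split; auto. rewrite Derive_Reals in Hd.
      assert (K := is_derive_unique _ _ _ (averaged_derive al a1 b0 b2 b4 x)). fold f in K. lra. }
  destruct (Hrolle 1%nat) as (x1 & H1 & P1); [lia|].
  destruct (Hrolle 2%nat) as (x2 & H2 & P2); [lia|].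
  destruct (Hrolle 3%nat) as (x3 & H3 & P3); [lia|].
  simpl in H1, H2, H3.
  (* The supposed multiple zero is an integer, hence distinct from the three Rolle points, which lie
     strictly between consecutive integers. *)
  assert (Hx4 : exists x4, 0 < x4 /\ x4 <> x1 /\ x4 <> x2 /\ x4 <> x3 /\ phi al a1 b0 b2 b4 x4 = 0).
  { exists (INR n). assert (n = 1 \/ n = 2 \/ n = 3 \/ n = 4)%nat as [E|[E|[E|E]]] by lia; subst n;
      simpl in Hphi |- *; repeat split; auto; lra. }
  destruct Hx4 as (x4 & Hx4 & N1 & N2 & N3 & P4).
  assert (Hsq : forall x y, 0 < x -> 0 < y -> x <> y -> x ^ 2 <> y ^ 2).
  { intros x y Hx Hy Hxy E. apply Hxy. apply Rmult_eq_reg_r with (x + y); [|lra].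
    assert ((x - y) * (x + y) = 0) by (ring_simplify; lra).
    apply Rmult_integral in H. destruct H; [|lra]. replace x with y by lra. ring. }
  assert (Hpoly : forall x, phi al a1 b0 b2 b4 x = 0 ->
    (al - a1 - b0 + b2 - b4) + (al - a1 + b0 + 2 * b2 - b4) * x ^ 2 + (b2 + b4) * (x ^ 2) ^ 2 + b4 * (x ^ 2) ^ 3 = 0).
  { intros x Hx. assert (Hp : 0 < 1 + x ^ 2) by nra.
    transitivity (phi al a1 b0 b2 b4 x * (1 + x ^ 2) ^ 2); [|rewrite Hx; ring].
    unfold phi, kap, him, hre. field. lra. }
  destruct (cubic_four_roots (al - a1 - b0 + b2 - b4) (al - a1 + b0 + 2 * b2 - b4) (b2 + b4) b4 (x1 ^ 2) (x2 ^ 2) (x3 ^ 2) (x4 ^ 2))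
    as (C0 & C1 & C2 & C3); try (apply Hsq; lra).
  { intros u [-> |[-> |[-> | ->]]]; now apply Hpoly. }
  (* All four coefficients vanish, so [b4 = b2 = 0], and the sum of the first two relations becomes
     [2 * (al - a1) = 0]. *)
  lra.
Qed.

(* The solution of the four linear equations [averaged n = 0], n = 1, ..., 4,
   for al, b0, b2, b4 under the normalization al - a1 = 1/2. *)
Lemma averaged_four_zeros : exists al a1 b0 b2 b4, al <> a1 /\
  forall n, (1 <= n <= 4)%nat -> averaged al a1 b0 b2 b4 (INR n) = 0.
Proof.
  set (t1 := atan 1). set (t2 := atan 2). set (t3 := atan 3). set (t4 := atan 4).
  (* [A], [C], [E], [F] solve the linear system that makes A + atan x + C x/(1+x^2) + E x + F x^3
     vanish at 1, 2, 3, 4. Matching with the averaged function gives -2 PI al = A, -2 b0 = C, 2 b2 -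
     2 b4 = E and (2/3) b4 = F. *)
  set (A := - (28 * t1 - 70 * t2 + 60 * t3 - 17 * t4)).
  set (C := 85 / 2 * t1 - 340 / 3 * t2 + 595 / 6 * t3 - 85 / 3 * t4).
  set (E := 35 / 6 * t1 - 27 / 2 * t2 + 21 / 2 * t3 - 17 / 6 * t4).
  set (F := - (1 / 12 * t1 - 1 / 6 * t2 + 1 / 12 * t3)).
  assert (HP := PI_RGT_0).
  set (al := - A / (2 * PI)).
  exists al, (al - 1 / 2), (- C / 2), (E / 2 + 3 / 2 * F), (3 / 2 * F). split; [lra|].
  intros n Hn.
  assert (Hform : forall x, averaged al (al - 1 / 2) (- C / 2) (E / 2 + 3 / 2 * F) (3 / 2 * F) x =
    A + atan x + C * (x / (1 + x ^ 2)) + E * x + F * x ^ 3).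
  { intros x. unfold averaged, kap_int.
    replace (2 * PI * al) with (- A) by (unfold al; field; lra). field. nra. }
  rewrite Hform. assert (n = 1 \/ n = 2 \/ n = 3 \/ n = 4)%nat as [-> |[-> |[-> | ->]]] by lia.
  - replace (INR 1) with 1 by (simpl; ring). fold t1. unfold A, C, E, F. field.
  - replace (INR 2) with 2 by (simpl; ring). fold t2. unfold A, C, E, F. field.
  - replace (INR 3) with 3 by (simpl; ring). fold t3. unfold A, C, E, F. field.
  - replace (INR 4) with 4 by (simpl; ring). fold t4. unfold A, C, E, F. field.
Qed.

(** * Four distinct families *)

Lemma circle_separated eps a b G H r s : limit_cycle eps a b G -> 0 < r -> 0 < s ->
  Defs.within (1 / 4) G (circle r) -> Defs.within (1 / 4) H (circle s) -> same_set G H -> Rabs (r - s) < 1 / 2.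
Proof.
  intros [(z & T & _ & _ & _ & _ & HG) _] Hr Hs WG WH Hsame.
  assert (Hz : G (z 0)) by (apply HG; now exists 0).
  destruct (WG _ Hz) as (p & [t ->] & D1). destruct (WH _ (proj1 (Hsame _) Hz)) as (q & [u ->] & D2).
  assert (Hmod : forall r t, 0 < r -> Cmod (r * cos t, r * sin t) = r).
  { intros r' t' Hr'. unfold Cmod; simpl fst; simpl snd.
    replace ((r' * cos t') ^ 2 + (r' * sin t') ^ 2) with (r' * r').
    - apply sqrt_square; lra.
    - assert (Hsc := sin2_cos2 t'). unfold Rsqr in Hsc.
      transitivity (r' * r' * (sin t' * sin t' + cos t' * cos t')); [rewrite Hsc|]; ring. }
  set (p := (r * cos t, r * sin t) : C) in *. set (q := (s * cos u, s * sin u) : C) in *.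
  assert (Ep : Cmod p = r) by (now apply Hmod). assert (Eq : Cmod q = s) by (now apply Hmod).
  rewrite <- Ep, <- Eq.
  assert (T1 : forall v w : C, Cmod v <= Cmod (v - w)%C + Cmod w).
  { intros v w. replace v with ((v - w) + w)%C at 1 by ring. apply Cmod_triangle. }
  assert (T2 : Cmod (p - q)%C <= Cmod (z 0%R - p)%C + Cmod (z 0%R - q)%C).
  { replace (p - q)%C with ((z 0%R - q) + - (z 0%R - p))%C by ring.
    eapply Rle_trans; [apply Cmod_triangle|]. rewrite Cmod_opp. lra. }
  assert (K1 := T1 p q). assert (K2 := T1 q p).
  replace (q - p)%C with (- (p - q))%C in K2 by ring. rewrite Cmod_opp in K2.
  apply Rabs_lt_between. lra.
Qed.

Theorem theoremA :
  exists (a b : zone -> nat -> R) (eps0 : R) (G : nat -> R -> C -> Prop),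
    0 < eps0 /\
    (forall eps : R, 0 < Rabs eps < eps0 ->
       (forall k, (k < 4)%nat -> limit_cycle eps a b (G k eps)) /\
       (forall i j, (i < j < 4)%nat -> ~ same_set (G i eps) (G j eps))) /\
    (forall k, (k < 4)%nat ->
       exists L : C -> Prop, periodic_orbit 0 a b L /\ tends_to (G k) L).
Proof.
  destruct averaged_four_zeros as (al & a1 & b0 & b2 & b4 & Hne & Hz).
  assert (Hs := averaged_simple_zeros al a1 b0 b2 b4 Hne Hz).
  set (cA := coefA al a1). set (cB := coefB b0 b2 b4).
  (* The condition [k < 4] is placed under the existential, with a dummy pair for larger [k], so
     that [epsilon] selects a family indexed by all of nat. *)
  assert (Hfam : forall k, exists eG : R * (R -> C -> Prop), (k < 4)%nat -> 0 < fst eG /\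
    (forall eps, 0 < Rabs eps < fst eG -> limit_cycle eps cA cB (snd eG eps) /\
       Defs.within (1 / 4) (snd eG eps) (circle (r0 (INR (S k))))) /\
    tends_to (snd eG) (circle (r0 (INR (S k))))).
  { intros k. destruct (Nat.lt_ge_cases k 4) as [Hk|Hk].
    - destruct (limit_cycle_family al a1 b0 b2 b4 (INR (S k))) as (e & G & He & HG & HT).
      + apply lt_0_INR. lia.
      + apply Hz. lia.
      + apply Hs. lia.
      + destruct (HT (1 / 4)) as (e' & He' & HW); [lra|].
        exists (Rmin e e', G). intros _. simpl. split; [now apply Rmin_glb_lt|]. split; auto.
        intros eps Heps. generalize (Rmin_l e e') (Rmin_r e e'). intros.
        split; [apply HG; lra|apply HW; lra].
    - exists (0, fun _ _ => False). intros; lia. }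
  set (fam := fun k => epsilon (inhabits (0, fun _ _ => False)) (fun eG : R * (R -> C -> Prop) => (k < 4)%nat -> 0 < fst eG /\
    (forall eps, 0 < Rabs eps < fst eG -> limit_cycle eps cA cB (snd eG eps) /\
       Defs.within (1 / 4) (snd eG eps) (circle (r0 (INR (S k))))) /\
    tends_to (snd eG) (circle (r0 (INR (S k)))))).
  assert (Hf := fun k => epsilon_spec (inhabits (0, fun _ _ => False)) _ (Hfam k)). cbv beta in Hf.
  destruct (pos_below4 (fst (fam 0%nat)) (fst (fam 1%nat)) (fst (fam 2%nat)) (fst (fam 3%nat)))
    as (e0 & He0 & Hle0); try (apply Hf; lia).
  assert (Hle : forall k, (k < 4)%nat -> e0 <= fst (fam k)).
  { intros k Hk. destruct k as [|[|[|[|k]]]]; try lia; tauto. }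
  exists cA, cB, e0, (fun k => snd (fam k)). split; [auto|]. split.
  - intros eps Heps. split.
    + intros k Hk. destruct (Hf k Hk) as (_ & HL & _). apply HL. specialize (Hle k Hk). fold (fam k) in *. lra.
    + intros i j Hij Hsame.
      destruct (Hf i ltac:(lia)) as (_ & HLi & _). destruct (Hf j ltac:(lia)) as (_ & HLj & _).
      assert (Hi := Hle i ltac:(lia)). assert (Hj := Hle j ltac:(lia)). fold (fam i) in HLi. fold (fam j) in HLj.
      destruct (HLi eps ltac:(lra)) as [L1 W1]. destruct (HLj eps ltac:(lra)) as [_ W2].
      assert (Pi : 0 < INR (S i)) by (apply lt_0_INR; lia). assert (Pj : 0 < INR (S j)) by (apply lt_0_INR; lia).
      assert (Bi := r0_bounds _ Pi). assert (Bj := r0_bounds _ Pj).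
      assert (K := circle_separated _ _ _ _ _ (r0 (INR (S i))) (r0 (INR (S j))) L1 ltac:(lra) ltac:(lra) W1 W2 Hsame).
      assert (Qi := r0_sq (INR (S i))). assert (Qj := r0_sq (INR (S j))).
      assert (Hd : INR (S i) + 1 <= INR (S j)) by (rewrite <- S_INR; apply le_INR; lia).
      assert (Hi1 : 1 <= INR (S i)) by (change 1 with (INR 1); apply le_INR; lia).
      apply Rabs_lt_between in K.
      set (ri := r0 (INR (S i))) in *. set (rj := r0 (INR (S j))) in *.
      set (u := INR (S i)) in *. set (v := INR (S j)) in *.
      (* The squared radii are 1 + u^2 and 1 + v^2. Radii closer than 1/2, together with
         [v - u >= 1], would give u + v <= (u + v + 2)/2, that is u + v <= 2, whereas u + v >= 3. *)
      assert (K1 : (rj - ri) * (rj + ri) = (v - u) * (v + u)) by (ring_simplify; lra).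
      assert (K2 : (rj - ri) * (rj + ri) <= 1 / 2 * (u + v + 2)) by (apply Rle_trans with (1 / 2 * (rj + ri)); nra).
      assert (K3 : 1 * (v + u) <= (v - u) * (v + u)) by (apply Rmult_le_compat_r; lra). lra.
  - intros k Hk. destruct (Hf k Hk) as (_ & _ & HT). fold (fam k) in HT.
    exists (circle (r0 (INR (S k)))). split; auto.
    apply circle_periodic_orbit. apply lt_0_INR. lia.
Qed.
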